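(* Let $m_1,m_2$ be positive integers, $\alpha>0$ real, $a_0,\dots,a_{m_1},b_0,\dots,b_{m_2}\in\mathbb{R}$ with $a_{m_1}b_{m_2}\neq0$, and consider the system $$\begin{cases}\dfrac{d^\alpha\varphi}{dz^\alpha}=\dfrac{a_{m_1}}{\alpha^{m_1}}z^{m_1}\dfrac{d^{m_1}\psi}{dz^{m_1}}+\dfrac{a_{m_1-1}}{\alpha^{m_1-1}}z^{m_1-1}\dfrac{d^{m_1-1}\psi}{dz^{m_1-1}}+\cdots+\dfrac{a_1}{\alpha}z\dfrac{d\psi}{dz}+a_0\psi,\\[2mm] \dfrac{d^\alpha\psi}{dz^\alpha}=\dfrac{b_{m_2}}{\alpha^{m_2}}z^{m_2}\dfrac{d^{m_2}\varphi}{dz^{m_2}}+\dfrac{b_{m_2-1}}{\alpha^{m_2-1}}z^{m_2-1}\dfrac{d^{m_2-1}\varphi}{dz^{m_2-1}}+\cdots+\dfrac{b_1}{\alpha}z\dfrac{d\varphi}{dz}+b_0\varphi,\end{cases}\qquad z>0. \quad( * )$$ Let $s_1,\dots,s_{m_1}$ and $s_{m_1+1},\dots,s_{m_1+m_2}$ be the roots of the characteristic polynomials $$P_1(s)=a_0+\sum_{i=1}^{m_1}a_i\prod_{j=0}^{i-1}\left(s-\frac{j}{\alpha}\right)\quad\text{and}\quad P_2(s)=b_0+\sum_{i=1}^{m_2}b_i\prod_{j=0}^{i-1}\left(s-\frac{j}{\alpha}\right),$$ respectively, so that the right-hand sides of $( * )$ equal $2^{m_1}a_{m_1}\prod_{i=1}^{m_1}\left(\frac{1}{2\alpha}z\frac{d}{dz}-\frac{s_i}{2}\right)\psi$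 and $2^{m_2}b_{m_2}\prod_{i=m_1+1}^{m_1+m_2}\left(\frac{1}{2\alpha}z\frac{d}{dz}-\frac{s_i}{2}\right)\varphi$. Put $m=m_1+m_2$ and $A=2^{m_1+m_2}a_{m_1}b_{m_2}$. (1) If $0<\alpha<\frac m2$ and $a_{m_1}b_{m_2}>0$, then $( * )$ has the following as a solution, where $c_1$ is a constant: $$\varphi(z)=c_1\operatorname{sgn}(b_{m_2})\,H^{m,0}_{1,m}\left[\frac{z^{-2\alpha}}{A}\,\Big|\,\begin{array}{c}(1,2\alpha)\\\left(-\frac{s_i}{2}+\frac12,1\right)_{1,m_1},\left(-\frac{s_i}{2},1\right)_{m_1+1,m}\end{array}\right],$$ $$\psi(z)=c_1\,2^{\frac{m_2-m_1}{2}}\sqrt{\frac{b_{m_2}}{a_{m_1}}}\,H^{m,0}_{1,m}\left[\frac{z^{-2\alpha}}{A}\,\Big|\,\begin{array}{c}(1,2\alpha)\\\left(-\frac{s_i}{2},1\right)_{1,m_1},\left(-\frac{s_i}{2}+\frac12,1\right)_{m_1+1,m}\end{array}\right].$$ (2) If $\alpha>\frac m2$, then, with $n$ the positive integer satisfying $n-1<\alpha<n$, $( * )$ has the following as a solution: $$\varphi(z)=\sum_{k=1}^nc_{k,1}z^{\alpha-k}\varphi_{k1}(z)+2^{m_1}a_{m_1}\sum_{k=1}^nc_{k,2}z^{2\alpha-k}\varphi_{k2}(z),$$ $$\psi(z)=2^{m_2}b_{m_2}\sum_{k=1}^nc_{k,1}z^{2\alpha-k}\psi_{k1}(z)+\sum_{k=1}^nc_{k,2}z^{\alpha-k}\psi_{k2}(z),$$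 where $c_{k,1},c_{k,2}$ ($k=1,\dots,n$) are constants and $$\varphi_{k1}(z)={}_{m+1}\Psi_1\left[Az^{2\alpha}\,\Big|\,\begin{array}{c}\left(1-\frac{k}{2\alpha}-\frac{s_i}{2},1\right)_{1,m_1},\left(\frac12-\frac{k}{2\alpha}-\frac{s_i}{2},1\right)_{m_1+1,m},(1,1)\\(1+\alpha-k,2\alpha)\end{array}\right],$$ $$\varphi_{k2}(z)={}_{m+1}\Psi_1\left[Az^{2\alpha}\,\Big|\,\begin{array}{c}\left(\frac32-\frac{k}{2\alpha}-\frac{s_i}{2},1\right)_{1,m_1},\left(1-\frac{k}{2\alpha}-\frac{s_i}{2},1\right)_{m_1+1,m},(1,1)\\(1+2\alpha-k,2\alpha)\end{array}\right],$$ $$\psi_{k1}(z)={}_{m+1}\Psi_1\left[Az^{2\alpha}\,\Big|\,\begin{array}{c}\left(1-\frac{k}{2\alpha}-\frac{s_i}{2},1\right)_{1,m_1},\left(\frac32-\frac{k}{2\alpha}-\frac{s_i}{2},1\right)_{m_1+1,m},(1,1)\\(1+2\alpha-k,2\alpha)\end{array}\right],$$ $$\psi_{k2}(z)={}_{m+1}\Psi_1\left[Az^{2\alpha}\,\Big|\,\begin{array}{c}\left(\frac12-\frac{k}{2\alpha}-\frac{s_i}{2},1\right)_{1,m_1},\left(1-\frac{k}{2\alpha}-\frac{s_i}{2},1\right)_{m_1+1,m},(1,1)\\(1+\alpha-k,2\alpha)\end{array}\right].$$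
   Context: Notation: $(X_i,\alpha_i)_{r,t}$ denotes the list $(X_r,\alpha_r),(X_{r+1},\alpha_{r+1}),\dots,(X_t,\alpha_t)$. $\operatorname{sgn}(x)=1$ for $x>0$ and $-1$ for $x<0$. Riemann-Liouville derivative: for $\alpha=n\in\mathbb{N}$, $\frac{d^\alpha}{dz^\alpha}\varphi=\frac{d^n}{dz^n}\varphi$; for $\alpha\in(n-1,n)$ with $n\in\mathbb{N}=\{1,2,\dots\}$, $\frac{d^\alpha}{dz^\alpha}\varphi(z)=\frac{1}{\Gamma(n-\alpha)}\frac{d^n}{dz^n}\int_0^z(z-s)^{n-\alpha-1}\varphi(s)\,ds$. Generalized Wright function: ${}_p\Psi_q\left[w\,\big|\,\begin{array}{c}(A_i,\alpha_i)_{1,p}\\(B_j,\beta_j)_{1,q}\end{array}\right]=\sum_{k=0}^\infty\frac{\prod_{i=1}^p\Gamma(A_i+\alpha_ik)}{\prod_{j=1}^q\Gamma(B_j+\beta_jk)}\frac{w^k}{k!}$, for $w\in\mathbb{C}$, $p,q\in\{0,1,2,\dots\}$, $A_i,B_j\in\mathbb{C}$, $\alpha_i,\beta_j\in\mathbb{R}\setminus\{0\}$. Fox H-function: for $w\in\mathbb{C}\setminus\{0\}$, $m,l,p,q\in\{0,1,2,\dots\}$ with $(m,l)\ne(0,0)$, $\alpha_i,\beta_j>0$ and $A_i,B_j\in\mathbb{R}$, $$H^{m,l}_{p,q}\left[w\,\Big|\,\begin{array}{c}(A_i,\alpha_i)_{1,p}\\(B_j,\beta_j)_{1,q}\end{array}\right]=\frac{1}{2\pi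 i}\int_{L}\frac{\prod_{j=1}^m\Gamma(B_j-\beta_js)\prod_{i=1}^l\Gamma(1-A_i+\alpha_is)}{\prod_{i=l+1}^p\Gamma(A_i-\alpha_is)\prod_{j=m+1}^q\Gamma(1-B_j+\beta_js)}\,w^s\,ds,$$ where empty products are $1$ and $L$ is a contour from $\gamma-i\infty$ to $\gamma+i\infty$, with $\gamma$ chosen such that $L$ separates the poles of $\Gamma(B_j-\beta_js)$, $1\le j\le m$, from the poles of $\Gamma(1-A_i+\alpha_is)$, $1\le i\le l$ (for $l=0$: the former poles lie to the right of $L$). The integral converges when $\mu=\sum_{i=1}^l\alpha_i-\sum_{i=l+1}^p\alpha_i+\sum_{j=1}^m\beta_j-\sum_{j=m+1}^q\beta_j>0$ and $|\arg w|<\pi\mu/2$. *)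

(* Defs.v *)
From mathcomp Require Import all_boot all_order all_algebra.
From mathcomp Require Import all_classical all_reals all_analysis.
From mathcomp Require Import complex.

Set Implicit Arguments.
Unset Strict Implicit.
Unset Printing Implicit Defensive.

Import Order.TTheory GRing.Theory Num.Theory.
Import numFieldNormedType.Exports.

Local Open Scope classical_set_scope.
Local Open Scope complex_scope.
Local Open Scope ring_scope.

(* Limits, derivatives and integrals of functions R -> R[i] are taken on the
   real and the imaginary part separately.  The bare names Re and Im denote the
   operations of numClosedFieldType, which take values in R[i] instead of R. *)
Notation re := complex.Re.
Notation im := complex.Im.

Section ComplexCalculus.
Variable R : realType.
Implicit Types (f L : R -> R[i]) (D : set R) (w s z p : R[i]).

Definition cintegrable D f : Prop :=
  (@lebesgue_measure R).-integrable D (EFin \o (fun t => re (f t))) /\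
  (@lebesgue_measure R).-integrable D (EFin \o (fun t => im (f t))).

Definition cintegral D f : R[i] :=
  (\int[@lebesgue_measure R]_(t in D) re (f t)) +i*
  (\int[@lebesgue_measure R]_(t in D) im (f t)).

Definition cderiven n f (z : R) : R[i] :=
  derive1n n (fun t => re (f t)) z +i* derive1n n (fun t => im (f t)) z.

(* f is n times differentiable on the half-line z > 0 *)
Definition cdiffn n f : Prop :=
  forall k, (k < n)%N -> forall z : R, 0 < z ->
    derivable (derive1n k (fun t => re (f t))) z 1 /\
    derivable (derive1n k (fun t => im (f t))) z 1.

Definition csum (u : nat -> R[i]) : R[i] :=
  limn (series (fun k => re (u k))) +i*
  limn (series (fun k => im (u k))).

Definition cexp z : R[i] := (expR (re z))%:C * (cos (im z) +i* sin (im z)).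

Definition cabs z : R := Num.sqrt (re z ^+ 2 + im z ^+ 2).

(* principal argument, in ]-pi, pi] *)
Definition carg z : R :=
  if 0 <= im z then acos (re z / cabs z) else - acos (re z / cabs z).

(* principal branch; meaningful for w != 0 only *)
Definition cpow w s : R[i] := cexp (s * (ln (cabs w) +i* carg w)).

Definition gamma_euler z : R[i] :=
  cintegral `]0, +oo[%classic (fun t => cpow t%:C (z - 1) * (expR (- t))%:C).

(* Analytic continuation of the Euler integral by Gamma(z + 1) = z Gamma(z).
   The number N of steps is the least one giving Re z + N > 0.  At a pole
   z = 0, -1, -2, ... the product vanishes and x / 0 = 0, so the value there
   is 0; consequently (cgamma z)^-1 is the entire function 1 / Gamma at every z,
   including the poles of Gamma. *)
Definition cgamma z : R[i] :=
  let N := if 0 < re z then 0%N else (Num.truncn (- re z)).+1 in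
  gamma_euler (z + N%:R) / \prod_(i < N) (z + i%:R).

Definition RL_integral (b : R) f (z : R) : R[i] :=
  (cgamma b%:C)^-1 *
  cintegral `]0, z[%classic (fun s : R => ((z - s) `^ (b - 1))%:C * f s).

(* On z > 0 the Riemann-Liouville derivative of order a > 0 of f exists and is
   equal to g. *)
Definition has_RL_derivative (a : R) f (g : R -> R[i]) : Prop :=
  (exists n : nat, [/\ (0 < n)%N, a = n%:R, cdiffn n f &
     forall z : R, 0 < z -> g z = cderiven n f z]) \/
  (exists n : nat, [/\ (0 < n)%N, n%:R - 1 < a < n%:R,
     forall z : R, 0 < z ->
       cintegrable `]0, z[%classic
         (fun s : R => ((z - s) `^ (n%:R - a - 1))%:C * f s),
     cdiffn n (RL_integral (n%:R - a) f) &
     forall z : R, 0 < z -> g z = cderiven n (RL_integral (n%:R - a) f) z]).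

(* Generalized Wright function; the lists contain the pairs (A_i, alpha_i) and
   (B_j, beta_j). *)
Definition wright (As Bs : seq (R[i] * R)) w : R[i] :=
  csum (fun k : nat =>
    (\prod_(a <- As) cgamma (a.1 + (a.2 * k%:R)%:C)) /
    (\prod_(b <- Bs) cgamma (b.1 + (b.2 * k%:R)%:C)) * (w ^+ k / k`!%:R)).

(* No numerator Gamma factor of the series is evaluated at a pole. *)
Definition wright_defined (As : seq (R[i] * R)) : Prop :=
  forall a, a \in As -> forall k j : nat, a.1 + (a.2 * k%:R)%:C != - j%:R.

(* A simple C^1 curve from g - i oo to g + i oo.  Its velocity may vanish, so
   piecewise C^1 curves are covered up to parametrization. *)
Definition contour (g : R) L : Prop :=
  [/\ injective L,
      (forall t, derivable (fun x => re (L x)) t 1 /\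
                 derivable (fun x => im (L x)) t 1),
      continuous (derive1 (fun x => re (L x))) /\
      continuous (derive1 (fun x => im (L x))),
      re (L t) @[t --> +oo] --> g /\ re (L t) @[t --> -oo] --> g &
      im (L t) @[t --> +oo] --> +oo /\ im (L t) @[t --> -oo] --> -oo].

Definition cvelocity L (t : R) : R[i] := cderiven 1 L t.

(* Total variation of arg (L t - p) along L: it is pi for p to the left of the
   upward curve L and - pi for p to its right. *)
Definition turning L p (v : R) : Prop :=
  (forall t, L t != p) /\
  (\int[@lebesgue_measure R]_(t in `[- T, T])
     im (cvelocity L t / (L t - p))) @[T --> +oo] --> v.

Definition left_of L p : Prop := turning L p pi.
Definition right_of L p : Prop := turning L p (- pi).

(* In the lists As of (A_i, alpha_i) and Bs of (B_j, beta_j), the first l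
   (resp. m) entries are those whose Gamma factor is in the numerator. *)
Definition foxH_integrand (m l : nat) (As Bs : seq (R[i] * R)) w s : R[i] :=
  (\prod_(b <- take m Bs) cgamma (b.1 - b.2%:C * s)) *
  (\prod_(a <- take l As) cgamma (1 - a.1 + a.2%:C * s)) /
  ((\prod_(a <- drop l As) cgamma (a.1 - a.2%:C * s)) *
   (\prod_(b <- drop m Bs) cgamma (1 - b.1 + b.2%:C * s))) * cpow w s.

(* The poles of Gamma(B - beta s) are (B + k) / beta, those of
   Gamma(1 - A + alpha s) are (A - 1 - k) / alpha, with k = 0, 1, 2, ... *)
Definition foxH_separates (m l : nat) (As Bs : seq (R[i] * R)) L : Prop :=
  (forall b, b \in take m Bs -> forall k : nat,
     right_of L ((b.1 + k%:R) / b.2%:C)) /\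
  (forall a, a \in take l As -> forall k : nat,
     left_of L ((a.1 - 1 - k%:R) / a.2%:C)).

(* v is the value at w of the H-function with indices m, l, p = size As and
   q = size Bs.  If mu > 0 and |arg w| < pi mu / 2, where mu is the sum of the
   alpha_i and beta_j over the Gamma factors of the numerator minus the sum over
   those of the denominator, then by Cauchy's theorem v does not depend on the
   contour. *)
Definition is_foxH (m l : nat) (As Bs : seq (R[i] * R)) w (v : R[i]) : Prop :=
  [/\ w != 0, (m <= size Bs)%N /\ (l <= size As)%N, (0 < m + l)%N,
      all (fun a => 0 < a.2) (As ++ Bs) &
      exists (g : R) (L : R -> R[i]),
        [/\ contour g L, foxH_separates m l As Bs L,
            cintegrable setT
              (fun t => foxH_integrand m l As Bs w (L t) * cvelocity L t) &
            v = (0 +i* (2 * pi))^-1 *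
                cintegral setT
                  (fun t => foxH_integrand m l As Bs w (L t) *
                            cvelocity L t)]].

Definition charpoly (al : R) (d : nat) (a : nat -> R) : {poly R[i]} :=
  ((a 0%N)%:C)%:P +
  \sum_(1 <= i < d.+1)
     (a i)%:C *: \prod_(0 <= j < i) ('X - ((j%:R / al)%:C)%:P).

Definition euler_op (al : R) (d : nat) (a : nat -> R) f (z : R) : R[i] :=
  \sum_(0 <= i < d.+1) (a i / al ^+ i * z ^+ i)%:C * cderiven i f z.

Definition is_solution (al : R) (m1 m2 : nat) (a b : nat -> R)
    (phi psi : R -> R[i]) : Prop :=
  [/\ cdiffn m1 psi, cdiffn m2 phi,
      has_RL_derivative al phi (euler_op al m1 a psi) &
      has_RL_derivative al psi (euler_op al m2 b phi)].

(* The parameter list (x - s_i / 2, 1) for s_i in s. *)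
Definition shifted (x : R) (s : seq R[i]) : seq (R[i] * R) :=
  [seq (x%:C - t / 2, 1) | t <- s].

End ComplexCalculus.

(* Main.v *)
(* All functions of the theorem are superpositions z |-> \int Th(t) z^(c t) dmu(t)
   of powers of z, where mu is Lebesgue measure on a vertical line for the
   H-functions and the counting measure for the Wright series.  By Fubini's theorem
   and the Beta integral the Riemann-Liouville derivative multiplies Th by
   Gamma(c + 1) / Gamma(c + 1 - alpha) and lowers c by alpha, whereas the operator
   on the right-hand side multiplies Th by the value of its characteristic
   polynomial at c / alpha, whose linear factors are absorbed into the Gamma factors
   of Th by Gamma(x + 1) = x Gamma(x).  In (2) the two results agree term by term,
   up to a shift of the summation index which is possible because the first term
   contains 1 / Gamma(1 - k) = 0.  In (1) they agree up to a translation of the line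
   of integration by 1 to the left of all poles, which is justified by Cauchy's
   theorem on rectangles for the Gauss products approximating Gamma and by the decay
   |Gamma(x + iy)| ~ e^(-pi |y| / 2) on vertical lines; that decay is read off the
   Gauss product as well. *)
Require Import Defs.
From HB Require Import structures.
From mathcomp Require Import all_boot all_order all_algebra.
From mathcomp Require Import all_classical all_reals all_analysis.
From mathcomp Require Import complex measurable_realfun.
From mathcomp Require Import ring lra.
Set Implicit Arguments.
Unset Strict Implicit.
Unset Printing Implicit Defensive.
Import Order.TTheory GRing.Theory Num.Theory.
Import numFieldNormedType.Exports.
Local Open Scope classical_set_scope.
Local Open Scope complex_scope.
Local Open Scope ring_scope.

(** * Calculus of complex-valued functions *)

(** For the H-functions the exponent of [z] is c = - 2 al s with s = g + i t, so lowering it by [al]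
    means replacing s by s + 1/2. Hence the parameters of phi and psi differ by 1/2 and psi is
    written on the line g + 1/2: each equation moves the line by 1/2, the first one then holds under
    the integral sign, and the second one ends on g + 1 instead of g. The two cases weigh m Gamma
    factors of slope 1 against one of slope 2 al. On a vertical line the former decay like e^(- pi m
    |t| / 2) and the latter, a denominator, contributes e^(pi al |t|), so al < m/2 leaves a decay.
    In the Wright series the quotient of consecutive terms behaves like j^m / j^(2 al), so al > m/2
    sends it to 0. The decay of Gamma rests on one exact identity: the squared quotient of the
    moduli of the Gauss products at x and x + i y is the product of the factors 1 + y^2 / (x + k)^2.
    Its logarithm is compared with the integral of ln (1 + y^2 / u^2), whose antiderivative contains
    2 y atan (u / y); this is where pi comes from. *)

Section ComplexNumbers.
Variable R : realType.
Implicit Types (z w c : R[i]) (x y : R).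

Lemma reD z w : re (z + w) = re z + re w. Proof. by case: z; case: w. Qed.
Lemma imD z w : im (z + w) = im z + im w. Proof. by case: z; case: w. Qed.
Lemma reN z : re (- z) = - re z. Proof. by case: z. Qed.
Lemma imN z : im (- z) = - im z. Proof. by case: z. Qed.
Lemma reB z w : re (z - w) = re z - re w. Proof. by rewrite reD reN. Qed.
Lemma imB z w : im (z - w) = im z - im w. Proof. by rewrite imD imN. Qed.
Lemma reM z w : re (z * w) = re z * re w - im z * im w.
Proof. by case: z; case: w. Qed.
Lemma imM z w : im (z * w) = re z * im w + im z * re w.
Proof. by case: z; case: w. Qed.
Lemma complexP z w : re z = re w -> im z = im w -> z = w.
Proof. by case: z => a b; case: w => a' b' /= -> ->. Qed.
Lemma reV z : re z^-1 = re z / (re z ^+ 2 + im z ^+ 2).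
Proof. by case: z. Qed.
Lemma imV z : im z^-1 = - (im z / (re z ^+ 2 + im z ^+ 2)).
Proof. by case: z. Qed.
Lemma re_nat n : re (n%:R : R[i]) = n%:R.
Proof. by elim: n => // n IH; rewrite -!natr1 reD IH. Qed.
Lemma im_nat n : im (n%:R : R[i]) = 0.
Proof. by elim: n => // n IH; rewrite -!natr1 imD IH add0r. Qed.
Lemma realC_nat n : (n%:R)%:C = n%:R :> R[i].
Proof. by apply: complexP; rewrite ?re_nat ?im_nat. Qed.
Lemma realCD x y : (x + y)%:C = x%:C + y%:C. Proof. exact: rmorphD. Qed.
Lemma realCB x y : (x - y)%:C = x%:C - y%:C. Proof. exact: rmorphB. Qed.
Lemma realCN x : (- x)%:C = - x%:C. Proof. exact: rmorphN. Qed.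
Lemma realCM x y : (x * y)%:C = x%:C * y%:C. Proof. exact: rmorphM. Qed.
Lemma realCX x n : (x ^+ n)%:C = x%:C ^+ n. Proof. exact: rmorphXn. Qed.
Lemma realCV x : (x^-1)%:C = (x%:C)^-1 :> R[i].
Proof.
apply: complexP; rewrite /= ?mul0r ?oppr0// expr0n/= addr0.
have [->|x0] := eqVneq x 0; first by rewrite invr0 mul0r.
by field.
Qed.
Lemma realC_eq0 x : (x%:C == 0 :> R[i]) = (x == 0).
Proof. by apply/eqP/eqP => [[]|->]. Qed.

Lemma cabs_normc z : cabs z = Normc.normc z. Proof. by case: z. Qed.
Lemma cabs_ge0 z : 0 <= cabs z. Proof. exact: sqrtr_ge0. Qed.
Lemma cabsM z w : cabs (z * w) = cabs z * cabs w.
Proof. by rewrite !cabs_normc Normc.normcM. Qed.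
Lemma cabsV z : cabs z^-1 = (cabs z)^-1.
Proof. by rewrite !cabs_normc Normc.normcV. Qed.
Lemma cabsD z w : cabs (z + w) <= cabs z + cabs w.
Proof. by rewrite !cabs_normc le_normcD. Qed.
Lemma cabsN z : cabs (- z) = cabs z.
Proof. by rewrite /cabs reN imN !sqrrN. Qed.
Lemma cabsB z w : cabs (z - w) <= cabs z + cabs w.
Proof. by rewrite (le_trans (cabsD _ _))// cabsN. Qed.
Lemma cabs_real x : cabs x%:C = `|x|.
Proof. by rewrite /cabs /= expr0n/= addr0 sqrtr_sqr. Qed.
Lemma cabs0 : cabs (0 : R[i]) = 0. Proof. by rewrite (cabs_real 0) normr0. Qed.
Lemma cabs1 : cabs (1 : R[i]) = 1. Proof. by rewrite (cabs_real 1) normr1. Qed.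
Lemma cabs_i : cabs ('i%C : R[i]) = 1.
Proof. by rewrite /cabs/= expr0n add0r expr1n sqrtr1. Qed.
Lemma cabs_nat n : cabs (n%:R : R[i]) = n%:R.
Proof. by rewrite -realC_nat cabs_real normr_nat. Qed.
Lemma cabs_eq0 z : (cabs z == 0) = (z == 0).
Proof.
apply/eqP/eqP => [|->]; last exact: cabs0.
by rewrite cabs_normc; exact: Normc.eq0_normc.
Qed.
Lemma cabs_gt0 z : (0 < cabs z) = (z != 0).
Proof. by rewrite lt_def cabs_ge0 cabs_eq0 andbT. Qed.
Lemma re_le_cabs z : `|re z| <= cabs z.
Proof. by rewrite -sqrtr_sqr ler_sqrt ?addr_ge0 ?sqr_ge0// lerDl sqr_ge0. Qed.
Lemma im_le_cabs z : `|im z| <= cabs z.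
Proof. by rewrite -sqrtr_sqr ler_sqrt ?addr_ge0 ?sqr_ge0// lerDr sqr_ge0. Qed.
Lemma cabs_le_re_im z : cabs z <= `|re z| + `|im z|.
Proof.
rewrite -[leRHS]ger0_norm ?addr_ge0// -sqrtr_sqr ler_sqrt ?sqr_ge0//.
rewrite -[re z ^+ 2]real_normK ?num_real// -[im z ^+ 2]real_normK ?num_real//.
by have := normr_ge0 (re z); have := normr_ge0 (im z); nra.
Qed.
Lemma cabsX z n : cabs (z ^+ n) = cabs z ^+ n.
Proof. by elim: n => [|n IH]; rewrite ?cabs1// !exprS cabsM IH. Qed.
Lemma cabs_prod (I : Type) (r : seq I) (P : pred I) (F : I -> R[i]) :
  cabs (\prod_(i <- r | P i) F i) = \prod_(i <- r | P i) cabs (F i).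
Proof. by apply: (big_morph (@cabs R)); [exact: cabsM|exact: cabs1]. Qed.
Lemma cabsE z : cabs z ^+ 2 = re z ^+ 2 + im z ^+ 2.
Proof. by rewrite sqr_sqrtr// addr_ge0 ?sqr_ge0. Qed.

Lemma re_cexp z : re (cexp z) = expR (re z) * cos (im z).
Proof. by rewrite /cexp reM /= mul0r subr0. Qed.
Lemma im_cexp z : im (cexp z) = expR (re z) * sin (im z).
Proof. by rewrite /cexp imM /= mul0r addr0. Qed.
Lemma cexpD z w : cexp (z + w) = cexp z * cexp w.
Proof.
by apply: complexP; rewrite !(reM, imM, re_cexp, im_cexp) reD imD expRD (cosD, sinD); ring.
Qed.
Lemma cexp_real x : cexp x%:C = (expR x)%:C.
Proof. by apply: complexP; rewrite ?re_cexp ?im_cexp /= ?cos0 ?sin0 ?mulr1 ?mulr0. Qed.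
Lemma cexp0 : cexp (0 : R[i]) = 1. Proof. by rewrite (cexp_real 0) expR0. Qed.
Lemma cabs_cexp z : cabs (cexp z) = expR (re z).
Proof.
rewrite /cabs re_cexp im_cexp !exprMn -mulrDr cos2Dsin2 mulr1 sqrtr_sqr.
by rewrite gtr0_norm ?expR_gt0.
Qed.
Lemma cexp_neq0 z : cexp z != 0.
Proof. by rewrite -cabs_gt0 cabs_cexp expR_gt0. Qed.
Lemma cexpN z : cexp (- z) = (cexp z)^-1.
Proof.
by apply: (mulfI (cexp_neq0 z)); rewrite -cexpD subrr cexp0 divff// cexp_neq0.
Qed.

(** For a positive base the logarithm is real and [carg] disappears. At [x = 0] the value is 1
    because [ln 0 = 0]; Gauss products of index 0 meet this case. *)
Definition rpow x c : R[i] := cexp (c * (ln x)%:C).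

Lemma cpow_real x c : 0 < x -> cpow x%:C c = rpow x c.
Proof.
move=> x0; rewrite /cpow /rpow /carg cabs_real gtr0_norm//= lexx divff ?gt_eqF//.
by rewrite acos1.
Qed.
Lemma rpowD x c d : rpow x (c + d) = rpow x c * rpow x d.
Proof. by rewrite /rpow mulrDl cexpD. Qed.
Lemma rpowN x c : rpow x (- c) = (rpow x c)^-1.
Proof. by rewrite /rpow mulNr cexpN. Qed.
Lemma rpow_neq0 x c : rpow x c != 0. Proof. exact: cexp_neq0. Qed.
Lemma rpow_real x y : 0 < x -> rpow x y%:C = (x `^ y)%:C.
Proof. by move=> x0; rewrite /rpow -realCM cexp_real /powR gt_eqF. Qed.
Lemma rpow1 x : 0 < x -> rpow x 1 = x%:C.
Proof. by move=> x0; rewrite (rpow_real 1 x0) powRr1// ltW. Qed.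
Lemma rpow_nat x n : 0 < x -> rpow x n%:R = x%:C ^+ n.
Proof. by move=> x0; rewrite -realC_nat rpow_real// powR_mulrn ?ltW// realCX. Qed.
Lemma cabs_rpow x c : 0 < x -> cabs (rpow x c) = x `^ re c.
Proof.
by move=> x0; rewrite cabs_cexp reM /= mulr0 subr0 /powR gt_eqF.
Qed.
Lemma rpowM x y c : 0 < x -> 0 < y -> rpow (x * y) c = rpow x c * rpow y c.
Proof.
by move=> x0 y0; rewrite /rpow lnM ?posrE// realCD mulrDr cexpD.
Qed.
Lemma rpow_powR x y c : 0 < x -> rpow (x `^ y) c = rpow x (y%:C * c).
Proof. by move=> x0; rewrite /rpow ln_powR realCM mulrCA mulrA. Qed.

Definition ccvg (u : nat -> R[i]) (l : R[i]) : Prop :=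
  re (u n) @[n --> \oo] --> re l /\ im (u n) @[n --> \oo] --> im l.

Lemma ccvg_cst c : ccvg (fun=> c) c.
Proof. by split; exact: cvg_cst. Qed.
Lemma ccvgD u v a b : ccvg u a -> ccvg v b -> ccvg (fun n => u n + v n) (a + b).
Proof.
move=> [u1 u2] [v1 v2]; split.
- by under eq_fun do rewrite reD; rewrite reD; exact: cvgD.
- by under eq_fun do rewrite imD; rewrite imD; exact: cvgD.
Qed.
Lemma ccvgM u v a b : ccvg u a -> ccvg v b -> ccvg (fun n => u n * v n) (a * b).
Proof.
move=> [u1 u2] [v1 v2]; split.
- by under eq_fun do rewrite reM; rewrite reM; apply: cvgB; apply: cvgM.
- by under eq_fun do rewrite imM; rewrite imM; apply: cvgD; apply: cvgM.
Qed.
Lemma ccvgN u a : ccvg u a -> ccvg (fun n => - u n) (- a).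
Proof.
move=> [u1 u2]; split.
- by under eq_fun do rewrite reN; rewrite reN; exact: cvgN.
- by under eq_fun do rewrite imN; rewrite imN; exact: cvgN.
Qed.
Lemma ccvgV u a : a != 0 -> ccvg u a -> ccvg (fun n => (u n)^-1) a^-1.
Proof.
move=> a0 [u1 u2].
have h : (re (u n) ^+ 2 + im (u n) ^+ 2)^-1 @[n --> \oo] -->
   (re a ^+ 2 + im a ^+ 2)^-1.
  apply: cvgV; first by rewrite -cabsE expf_neq0// cabs_eq0.
  by apply: cvgD; rewrite !expr2; apply: cvgM.
split.
- by under eq_fun do rewrite reV; rewrite reV; apply: cvgM.
- by under eq_fun do rewrite imV; rewrite imV; apply: cvgN; apply: cvgM.
Qed.
Lemma ccvg_cabs u a : ccvg u a -> cabs (u n) @[n --> \oo] --> cabs a.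
Proof.
move=> [u1 u2]; apply: (continuous_cvg _ (@sqrt_continuous R _)).
by apply: cvgD; rewrite !expr2; apply: cvgM.
Qed.
Lemma ccvg_real (u : nat -> R) (a : R) : u n @[n --> \oo] --> a ->
  ccvg (fun n => (u n)%:C) a%:C.
Proof. by move=> h; split => //=; exact: cvg_cst. Qed.
Lemma ccvg_unique u a b : ccvg u a -> ccvg u b -> a = b.
Proof.
move=> [a1 a2] [b1 b2]; apply: complexP.
- exact: (cvg_unique _ a1 b1).
- exact: (cvg_unique _ a2 b2).
Qed.
Lemma ccvgS u a : ccvg u a -> ccvg (fun n => u n.+1) a.
Proof.
move=> [h1 h2]; split.
- by rewrite (cvg_shiftS (fun n => re (u n))).
- by rewrite (cvg_shiftS (fun n => im (u n))).
Qed.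
Lemma eq_ccvg u v a : (forall n, (0 < n)%N -> u n = v n) -> ccvg u a -> ccvg v a.
Proof.
move=> e [h1 h2]; split; [apply: cvg_trans h1|apply: cvg_trans h2];
  by apply: near_eq_cvg; near=> n; rewrite e//; near: n; exact: nbhs_infty_gt.
Unshelve. all: by end_near. Qed.

End ComplexNumbers.

(** * Derivatives of complex-valued functions on the half-line *)

Section ComplexDerivative.
Variable R : realType.
Implicit Types (f g : R -> R[i]) (z : R) (l : R[i]).

Definition is_cder f z l :=
  is_derive z 1 (fun t => re (f t)) (re l) /\
  is_derive z 1 (fun t => im (f t)) (im l).

Lemma is_derive_congr (f g : R -> R) (z l l' : R) :
  is_derive z 1 f l -> (forall t, f t = g t) -> l = l' -> is_derive z 1 g l'.
Proof. by move=> h /funext <- <-. Qed.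

Lemma is_cder_eq f z l l' : is_cder f z l -> l = l' -> is_cder f z l'.
Proof. by move=> ? <-. Qed.
Lemma is_cder_cst c z : is_cder (fun=> c) z 0.
Proof. by split; exact: is_derive_cst. Qed.
Lemma is_cderD f g z a b : is_cder f z a -> is_cder g z b ->
  is_cder (fun t => f t + g t) z (a + b).
Proof.
move=> [f1 f2] [g1 g2]; split.
- by apply: is_derive_congr (is_deriveD f1 g1) _ _ => [t|]; rewrite ?reD.
- by apply: is_derive_congr (is_deriveD f2 g2) _ _ => [t|]; rewrite ?imD.
Qed.
Lemma is_cderM f g z a b : is_cder f z a -> is_cder g z b ->
  is_cder (fun t => f t * g t) z (a * g z + f z * b).
Proof.
move=> [f1 f2] [g1 g2]; split.
- apply: is_derive_congr (is_deriveB (is_deriveM f1 g1) (is_deriveM f2 g2)) _ _.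
    by move=> t; rewrite reM.
  by rewrite /GRing.scale/= reD !reM; ring.
- apply: is_derive_congr (is_deriveD (is_deriveM f1 g2) (is_deriveM f2 g1)) _ _.
    by move=> t; rewrite imM.
  by rewrite /GRing.scale/= imD !imM; ring.
Qed.
Lemma is_cderZ f z c a : is_cder f z a -> is_cder (fun t => c * f t) z (c * a).
Proof.
by move=> h; apply: is_cder_eq (is_cderM (is_cder_cst c z) h) _; rewrite mul0r add0r.
Qed.
Lemma is_cder_real (f : R -> R) z a : is_derive z 1 f a ->
  is_cder (fun t => (f t)%:C) z a%:C.
Proof. by move=> h; split => //=; exact: is_derive_cst. Qed.
Lemma is_cder_cexp f z a : is_cder f z a ->
  is_cder (fun t => cexp (f t)) z (a * cexp (f z)).
Proof.
move=> [f1 f2]; split.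
- apply: is_derive_congr (is_deriveM (is_derive1_comp (is_derive_expR _) f1)
    (is_derive1_comp (is_derive_cos _) f2)) _ _.
    by move=> t; rewrite re_cexp.
  by rewrite /GRing.scale/= reM re_cexp im_cexp; ring.
- apply: is_derive_congr (is_deriveM (is_derive1_comp (is_derive_expR _) f1)
    (is_derive1_comp (is_derive_sin _) f2)) _ _.
    by move=> t; rewrite im_cexp.
  by rewrite /GRing.scale/= imM re_cexp im_cexp; ring.
Qed.
Lemma is_cder_rpow c z : 0 < z ->
  is_cder (fun t => rpow t c) z (c * rpow z (c - 1)).
Proof.
move=> z0.
have h := is_cder_cexp (is_cderZ c (is_cder_real (is_derive1_ln z0))).
apply: is_cder_eq h _.
rewrite rpowD rpowN rpow1// realCV /rpow; ring.
Qed.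
(** Higher derivatives are identified by exhibiting the whole chain [F] at once. Only z > 0 matters:
    each such point has a neighbourhood inside the half-line, on which one function may be exchanged
    for the other. *)
Lemma cderiven_chain n f (F : nat -> R -> R[i]) :
  (forall z, 0 < z -> f z = F 0%N z) ->
  (forall k, (k < n)%N -> forall z, 0 < z -> is_cder (F k) z (F k.+1 z)) ->
  cdiffn n f /\ forall k, (k <= n)%N -> forall z, 0 < z -> cderiven k f z = F k z.
Proof.
move=> f0 h.
have E k : (k <= n)%N -> forall z, 0 < z ->
    derive1n k (fun t => re (f t)) z = re (F k z) /\
    derive1n k (fun t => im (f t)) z = im (F k z).
  elim: k => [|k IH] kn z z0; first by rewrite !derive1n0 f0.
  have [[d1 e1] [d2 e2]] := h k kn z z0.
  have nz : \forall t \near z, 0 < t by exact: lt_nbhsr.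
  rewrite !derive1nS !derive1E -e1 -e2.
  by split; apply: near_eq_derive; apply: filterS nz => t t0;
    have [] := IH (ltnW kn) t t0.
split=> [k kn z z0|k kn z z0]; last first.
  by have [e1 e2] := E k kn z z0; apply: complexP.
have [[d1 e1] [d2 e2]] := h k kn z z0.
have nz : \forall t \near z, 0 < t by exact: lt_nbhsr.
split; [apply: near_eq_derivable _ d1|apply: near_eq_derivable _ d2];
  rewrite ?oner_eq0//; apply: filterS nz => t t0;
  by have [] := E k (ltnW kn) t t0.
Qed.

Lemma cdiffn_is_cder n f k z : cdiffn n f -> (k < n)%N -> 0 < z ->
  is_cder (cderiven k f) z (cderiven k.+1 f z).
Proof.
move=> df kn z0; have [d1 d2] := df k kn z z0.
have e (h : R -> R) : derivable (derive1n k h) z 1 ->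
    is_derive z 1 (derive1n k h) (derive1n k.+1 h z).
  by move=> dh; apply: (DeriveDef dh); rewrite derive1nS derive1E.
by split; [exact: e d1|exact: e d2].
Qed.

Lemma cdiffn_congr n f g : (forall z, 0 < z -> f z = g z) -> cdiffn n f ->
  cdiffn n g /\ forall k, (k <= n)%N -> forall z, 0 < z ->
    cderiven k g z = cderiven k f z.
Proof.
move=> fg df; apply: cderiven_chain => [z z0|k kn z z0].
  by rewrite -fg//; apply: complexP.
exact: cdiffn_is_cder df kn z0.
Qed.

Lemma cdiffnD n f g : cdiffn n f -> cdiffn n g ->
  cdiffn n (fun z => f z + g z) /\ forall k, (k <= n)%N -> forall z, 0 < z ->
    cderiven k (fun z => f z + g z) z = cderiven k f z + cderiven k g z.
Proof.
move=> df dg.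
apply: (@cderiven_chain _ _ (fun k z => cderiven k f z + cderiven k g z)).
  by move=> z z0; apply: complexP; rewrite ?reD ?imD.
by move=> k kn z z0; apply: is_cderD; exact: cdiffn_is_cder kn z0.
Qed.

End ComplexDerivative.

(** * Integrals of complex-valued functions for an arbitrary measure *)

Section ComplexIntegral.
Context d (T : measurableType d) (R : realType).
Variable mu : {measure set T -> \bar R}.
Implicit Types (f g : T -> R[i]) (D : set T).

Definition cmeas D f :=
  measurable_fun D (fun t => re (f t)) /\ measurable_fun D (fun t => im (f t)).
(** For [lebesgue_measure] this and [cint] are convertible to [cintegrable] and [cintegral]; the
    measure is left free so that series can be treated as integrals for the counting measure. *)
Definition cintble D f : Prop :=
  mu.-integrable D (EFin \o (fun t => re (f t))) /\
  mu.-integrable D (EFin \o (fun t => im (f t))).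
Definition cint D f : R[i] :=
  (\int[mu]_(t in D) re (f t)) +i* (\int[mu]_(t in D) im (f t)).

Lemma integrable_EFinD D (f g : T -> R) : measurable D ->
  mu.-integrable D (EFin \o f) -> mu.-integrable D (EFin \o g) ->
  mu.-integrable D (EFin \o (fun t => f t + g t)).
Proof.
move=> mD h1 h2; have := integrableD mD h1 h2.
by apply: eq_integrable => // t _; rewrite /= EFinD.
Qed.
Lemma integrable_EFinZ D k (f : T -> R) : measurable D ->
  mu.-integrable D (EFin \o f) -> mu.-integrable D (EFin \o (fun t => k * f t)).
Proof.
move=> mD h; have := integrableZl mD k h.
by apply: eq_integrable => // t _; rewrite /= EFinM.
Qed.

Lemma cmeas_cst D c : cmeas D (fun=> c).
Proof. by split; exact: measurable_cst. Qed.
Lemma cmeas_real D (f : T -> R) : measurable_fun D f -> cmeas D (fun t => (f t)%:C).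
Proof. by split => //=; exact: measurable_cst. Qed.
Lemma cmeasD D f g : cmeas D f -> cmeas D g -> cmeas D (fun t => f t + g t).
Proof.
move=> [f1 f2] [g1 g2]; split.
- by under eq_fun do rewrite reD; exact: measurable_funD.
- by under eq_fun do rewrite imD; exact: measurable_funD.
Qed.
Lemma cmeasM D f g : cmeas D f -> cmeas D g -> cmeas D (fun t => f t * g t).
Proof.
move=> [f1 f2] [g1 g2]; split.
- under eq_fun do rewrite reM.
  by apply: measurable_funB; apply: measurable_funM.
- under eq_fun do rewrite imM.
  by apply: measurable_funD; apply: measurable_funM.
Qed.
Lemma cmeasN D f : cmeas D f -> cmeas D (fun t => - f t).
Proof.
move=> h; under eq_fun do rewrite -mulN1r; exact: cmeasM (cmeas_cst D _) h.
Qed.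
Lemma cmeas_cabs D f : cmeas D f -> measurable_fun D (fun t => cabs (f t)).
Proof.
move=> [f1 f2]; apply: measurableT_comp => //.
  by apply: continuous_measurable_fun; exact: sqrt_continuous.
by apply: measurable_funD; apply: measurable_funX.
Qed.
Lemma measurable_fun_inv_ge0 D (h : T -> R) : (forall t, 0 <= h t) ->
  measurable_fun D h -> measurable_fun D (fun t => (h t)^-1).
Proof.
move=> h0 mh; under eq_fun do rewrite -powR_inv1//.
by apply: (measurableT_comp (measurable_powR _)).
Qed.
Lemma cmeasV D f : cmeas D f -> cmeas D (fun t => (f t)^-1).
Proof.
move=> [f1 f2].
have h : measurable_fun D (fun t => (re (f t) ^+ 2 + im (f t) ^+ 2)^-1).
  apply: measurable_fun_inv_ge0 => [t|]; first by rewrite addr_ge0 ?sqr_ge0.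
  by apply: measurable_funD; apply: measurable_funX.
split.
- by under eq_fun do rewrite reV; exact: measurable_funM.
- under eq_fun do rewrite imV -mulNr.
  by apply: measurable_funM => //; exact: measurableT_comp.
Qed.
Lemma cmeas_cexp D f : cmeas D f -> cmeas D (fun t => cexp (f t)).
Proof.
move=> [f1 f2]; split.
- under eq_fun do rewrite re_cexp.
  apply: measurable_funM; first exact: measurableT_comp.
  by apply: measurableT_comp f2; apply: continuous_measurable_fun; exact: continuous_cos.
- under eq_fun do rewrite im_cexp.
  apply: measurable_funM; first exact: measurableT_comp.
  by apply: measurableT_comp f2; apply: continuous_measurable_fun; exact: continuous_sin.
Qed.
Lemma cmeas_prod (I : Type) (r : seq I) D (F : I -> T -> R[i]) :
  (forall i, cmeas D (F i)) -> cmeas D (fun t => \prod_(i <- r) F i t).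
Proof.
move=> h; elim: r => [|i r IH].
  by under eq_fun do rewrite big_nil; exact: cmeas_cst.
by under eq_fun do rewrite big_cons; exact: cmeasM.
Qed.
Lemma cmeasS D E f : measurable D -> E `<=` D -> cmeas D f -> cmeas E f.
Proof.
by move=> mD ED [h1 h2]; split; [apply: measurable_funS h1|apply: measurable_funS h2].
Qed.
Lemma cmeas_cvg D (F : nat -> T -> R[i]) f : (forall n, cmeas D (F n)) ->
  (forall t, D t -> ccvg (F ^~ t) (f t)) -> cmeas D f.
Proof.
move=> mF Ff; split.
- apply: (@measurable_fun_cvg _ _ _ _ (fun n t => re (F n t))) => [n|t /Ff[]//].
  by case: (mF n).
- apply: (@measurable_fun_cvg _ _ _ _ (fun n t => im (F n t))) => [n|t /Ff[]//].
  by case: (mF n).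
Qed.

Lemma cintble_meas D f : cintble D f -> cmeas D f.
Proof.
by move=> [/measurable_int/measurable_EFinP h1 /measurable_int/measurable_EFinP h2].
Qed.
Lemma cintble_le D f (g : T -> R) : measurable D -> cmeas D f ->
  mu.-integrable D (EFin \o g) -> (forall t, D t -> cabs (f t) <= g t) ->
  cintble D f.
Proof.
move=> mD [f1 f2] ig fg.
split; (apply: (le_integrable mD _ _ ig); first exact/measurable_EFinP);
  move=> t Dt; rewrite lee_fin; apply: (le_trans _ (ler_norm _));
  apply: le_trans (fg t Dt); [exact: re_le_cabs|exact: im_le_cabs].
Qed.
Lemma cintble_cabs D f : measurable D -> cintble D f ->
  mu.-integrable D (EFin \o (fun t => cabs (f t))).
Proof.
move=> mD h; have := h => -[h1 h2].
have := integrableD mD (integrable_norm h1) (integrable_norm h2).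
apply: le_integrable => //.
  by apply/measurable_EFinP; apply: cmeas_cabs; exact: cintble_meas.
move=> t _ /=; rewrite lee_fin ger0_norm ?cabs_ge0//.
by rewrite ger0_norm ?addr_ge0// cabs_le_re_im.
Qed.
Lemma eq_cintble D f g : measurable D -> (forall t, D t -> f t = g t) ->
  cintble D f -> cintble D g.
Proof.
move=> mD fg [h1 h2]; split; [move: h1|move: h2]; apply: eq_integrable => // t;
  by rewrite inE => /fg /= ->.
Qed.
Lemma eq_cint D f g : (forall t, D t -> f t = g t) -> cint D f = cint D g.
Proof.
by move=> fg; congr (_ +i* _); apply: eq_Rintegral => t; rewrite inE => /fg ->.
Qed.
Lemma cintbleD D f g : measurable D -> cintble D f -> cintble D g ->
  cintble D (fun t => f t + g t).
Proof.
move=> mD [f1 f2] [g1 g2]; split.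
- by under eq_fun do rewrite reD; apply: integrable_EFinD.
- by under eq_fun do rewrite imD; apply: integrable_EFinD.
Qed.
Lemma cintbleZ D c f : measurable D -> cintble D f -> cintble D (fun t => c * f t).
Proof.
move=> mD h; have mf := cintble_meas h.
apply: (@cintble_le _ _ (fun t => cabs c * cabs (f t))) => //.
- exact: cmeasM (cmeas_cst D c) mf.
- by apply: integrable_EFinZ => //; exact: cintble_cabs.
- by move=> t _; rewrite cabsM.
Qed.
Lemma cintD D f g : measurable D -> cintble D f -> cintble D g ->
  cint D (fun t => f t + g t) = cint D f + cint D g.
Proof.
move=> mD [f1 f2] [g1 g2]; apply: complexP.
- rewrite reD /= -RintegralD//.
  by apply: eq_Rintegral => t _; rewrite reD.
- rewrite imD /= -RintegralD//.
  by apply: eq_Rintegral => t _; rewrite imD.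
Qed.
Lemma cintZ D c f : measurable D -> cintble D f ->
  cint D (fun t => c * f t) = c * cint D f.
Proof.
move=> mD [f1 f2].
apply: complexP.
- rewrite reM /= -!RintegralZl// -RintegralB//; [|exact: integrable_EFinZ..].
  by apply: eq_Rintegral => t _; rewrite reM.
- rewrite imM /= -!RintegralZl// -RintegralD//; [|exact: integrable_EFinZ..].
  by apply: eq_Rintegral => t _; rewrite imM.
Qed.
Lemma cintB D f g : measurable D -> cintble D f -> cintble D g ->
  cint D (fun t => f t - g t) = cint D f - cint D g.
Proof.
move=> mD hf hg; rewrite -[- cint D g]mulN1r -cintZ// -cintD//; last exact: cintbleZ.
by apply: eq_cint => t _; rewrite mulN1r.
Qed.
(** The factor 2 comes from estimating the real and the imaginary part separately; it only enlarges
    the constants of later estimates. *)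
Lemma cabs_cint_le D f (g : T -> R) : measurable D -> cmeas D f ->
  mu.-integrable D (EFin \o g) -> (forall t, D t -> cabs (f t) <= g t) ->
  cabs (cint D f) <= 2 * \int[mu]_(t in D) g t.
Proof.
move=> mD mf ig fg; have [i1 i2] := cintble_le mD mf ig fg.
apply: (le_trans (cabs_le_re_im _)); rewrite mulr_natl mulr2n lerD//=.
- apply: (le_trans (le_normr_Rintegral mD i1)); apply: le_Rintegral => //.
    exact: integrable_norm.
  by move=> t Dt; apply: le_trans (re_le_cabs _) (fg _ Dt).
- apply: (le_trans (le_normr_Rintegral mD i2)); apply: le_Rintegral => //.
    exact: integrable_norm.
  by move=> t Dt; apply: le_trans (im_le_cabs _) (fg _ Dt).
Qed.

Lemma cint_mkcond D f :
  cint D f = cint setT (fun t => if t \in D then f t else 0).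
Proof.
congr (_ +i* _); rewrite Rintegral_mkcond; apply: eq_Rintegral => t _;
  by rewrite patchE; case: ifP.
Qed.
Lemma cintble_mkcond D f : measurable D ->
  cintble D f <-> cintble setT (fun t => if t \in D then f t else 0).
Proof.
move=> mD.
have e (h : T -> R) : (EFin \o (fun t => if t \in D then h t else 0)) =
    (EFin \o h) \_ D.
  by apply/funext => t; rewrite patchE/=; case: ifP.
have e1 : (fun t => re (if t \in D then f t else 0)) =
  (fun t => if t \in D then re (f t) else 0) by apply/funext => t; case: ifP.
have e2 : (fun t => im (if t \in D then f t else 0)) =
  (fun t => if t \in D then im (f t) else 0) by apply/funext => t; case: ifP.
rewrite /cintble e1 e2 !e.
by split=> -[h1 h2]; split; apply/(integrable_mkcond _ mD).
Qed.

Lemma Rintegral_dct D (F : nat -> T -> R) (f g : T -> R) : measurable D ->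
  (forall n, measurable_fun D (F n)) ->
  (forall t, D t -> F n t @[n --> \oo] --> f t) ->
  mu.-integrable D (EFin \o g) -> (forall n t, D t -> `|F n t| <= g t) ->
  mu.-integrable D (EFin \o f) /\
  \int[mu]_(t in D) F n t @[n --> \oo] --> \int[mu]_(t in D) f t.
Proof.
move=> mD mF Ff ig Fg.
have mf : measurable_fun D f by apply: measurable_fun_cvg Ff.
have A1 n : measurable_fun D (EFin \o F n) by exact/measurable_EFinP.
have A2 : measurable_fun D (EFin \o f) by exact/measurable_EFinP.
have A3 : {ae mu, forall t, D t -> (EFin \o F n) t @[n --> \oo] --> (EFin \o f) t}.
  by apply: aeW => t Dt; apply: cvg_EFin; [exact: nearW|exact: Ff].
have A4 : {ae mu, forall t n, D t -> (`|(EFin \o F n) t| <= (EFin \o g) t)%E}.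
  by apply: aeW => t n Dt; rewrite lee_fin Fg.
have [i _ c] := dominated_convergence mD A1 A2 A3 ig A4.
split=> //; apply: fine_cvg; rewrite /Rintegral fineK//.
exact: integrable_fin_num.
Qed.

Lemma cint_dct D (F : nat -> T -> R[i]) f (g : T -> R) : measurable D ->
  (forall n, cmeas D (F n)) ->
  (forall t, D t -> ccvg (F ^~ t) (f t)) ->
  mu.-integrable D (EFin \o g) -> (forall n t, D t -> cabs (F n t) <= g t) ->
  cintble D f /\ ccvg (fun n => cint D (F n)) (cint D f).
Proof.
move=> mD mF Ff ig Fg.
have b1 n t : D t -> `|re (F n t)| <= g t.
  by move=> Dt; apply: le_trans (re_le_cabs _) (Fg n t Dt).
have b2 n t : D t -> `|im (F n t)| <= g t.
  by move=> Dt; apply: le_trans (im_le_cabs _) (Fg n t Dt).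
have [i1 c1] := Rintegral_dct mD (fun n => (mF n).1) (fun t Dt => (Ff t Dt).1) ig b1.
have [i2 c2] := Rintegral_dct mD (fun n => (mF n).2) (fun t Dt => (Ff t Dt).2) ig b2.
by [].
Qed.

End ComplexIntegral.

(** * Fubini's theorem under a product bound *)

Section Fubini.
Context d1 d2 (T1 : measurableType d1) (T2 : measurableType d2) (R : realType).
Variables (m1 : {sigma_finite_measure set T1 -> \bar R})
          (m2 : {sigma_finite_measure set T2 -> \bar R}).

(** A majorant that separates the variables reduces integrability on the product to one variable at
    a time. Superpositions of powers have such a majorant, with one factor in the point [u] and one
    in the parameter [t]. *)
Lemma Rintegral_Fubini (f : T1 * T2 -> R) (g : T1 -> R) (h : T2 -> R) :
  measurable_fun setT f -> m1.-integrable setT (EFin \o g) ->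
  m2.-integrable setT (EFin \o h) ->
  (forall x y, `|f (x, y)| <= g x * h y) ->
  [/\ m1.-integrable setT (EFin \o (fun x => \int[m2]_y f (x, y))),
      m2.-integrable setT (EFin \o (fun y => \int[m1]_x f (x, y))) &
      \int[m1]_x \int[m2]_y f (x, y) = \int[m2]_y \int[m1]_x f (x, y)].
Proof.
move=> mf ig ih fgh.
have fgh' x y : `|f (x, y)| <= `|g x| * `|h y|.
  by rewrite -normrM (le_trans (fgh x y))// ler_norm.
have mf1 x : measurable_fun setT (fun y => f (x, y)).
  exact: measurable_fun_pair2.
have mf2 y : measurable_fun setT (fun x => f (x, y)).
  exact: measurable_fun_pair1.
have i2 x : m2.-integrable setT (EFin \o (fun y => f (x, y))).
  apply: (le_integrable measurableT _ _ (integrable_EFinZ `|g x| measurableT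
    (integrable_norm ih))); first exact/measurable_EFinP.
  move=> y _ /=; rewrite lee_fin [leRHS]ger0_norm ?mulr_ge0//.
have i1 y : m1.-integrable setT (EFin \o (fun x => f (x, y))).
  apply: (le_integrable measurableT _ _ (integrable_EFinZ `|h y| measurableT
    (integrable_norm ig))); first exact/measurable_EFinP.
  by move=> x _ /=; rewrite lee_fin [leRHS]ger0_norm ?mulr_ge0// mulrC.
have E2 x : (\int[m2]_y (EFin \o f) (x, y) = (\int[m2]_y f (x, y))%:E)%E.
  by rewrite /Rintegral fineK//; exact: integrable_fin_num (i2 x).
have E1 y : (\int[m1]_x (EFin \o f) (x, y) = (\int[m1]_x f (x, y))%:E)%E.
  by rewrite /Rintegral fineK//; exact: integrable_fin_num (i1 y).
have meF : measurable_fun setT (EFin \o f) by exact/measurable_EFinP.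
have iF : (m1 \x m2)%E.-integrable setT (EFin \o f).
  apply/(integrable12ltyP _ _ meF).
  have /integrableP[mh hoo] := ih; have /integrableP[mg goo] := ig.
  apply: (@le_lt_trans _ _
    (\int[m1]_x ((`|g x|)%:E * \int[m2]_y (`|h y|)%:E))%E).
    apply: ge0_le_integral => //.
    - by move=> x _; exact: integral_ge0.
    - apply: (@measurable_fun_fubini_tonelli_F _ _ T1 T2 R m2 (abse \o (EFin \o f))) => //=.
      exact: measurableT_comp.
    - apply: emeasurable_funM; last exact: measurable_cst.
      apply/measurable_EFinP; apply: measurableT_comp => //.
      by move/measurable_EFinP : mg.
    - move=> x _; rewrite -ge0_integralZl//; last first.
        apply/measurable_EFinP; apply: measurableT_comp => //.
        by move/measurable_EFinP : mh.
      apply: ge0_le_integral => //.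
      + by apply: measurableT_comp => //; exact/measurable_EFinP.
      + apply: emeasurable_funM; first exact: measurable_cst.
        apply/measurable_EFinP; apply: measurableT_comp => //.
        by move/measurable_EFinP : mh.
      + by move=> y _; rewrite -EFinM lee_fin.
  have [c c0 ->] : exists2 c : R, 0 <= c & (\int[m2]_y (`|h y|)%:E = c%:E)%E.
    exists (fine (\int[m2]_y (`|h y|)%:E)); first by rewrite fine_ge0// integral_ge0.
    by rewrite fineK// ge0_fin_numE// integral_ge0.
  rewrite ge0_integralZr//; last first.
    apply/measurable_EFinP; apply: measurableT_comp => //.
    by move/measurable_EFinP : mg.
  by rewrite muleC lte_mul_pinfty.
split.
- have := integrable_fubini_F iF.
  by apply: eq_integrable => // x _; exact: E2.
- have : m2.-integrable setT (fubini_G m1 (EFin \o f)).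
    apply/integrableP; split; first exact: measurable_fubini_G iF.
    have /(integrable21ltyP _ _ meF) := iF; apply: le_lt_trans.
    apply: ge0_le_integral => //.
    - by apply: measurableT_comp => //; exact: measurable_fubini_G iF.
    - apply: (@measurable_fun_fubini_tonelli_G _ _ T1 T2 R m1 (abse \o (EFin \o f))) => //=.
      exact: measurableT_comp.
    - move=> y _; apply: le_abse_integral => //.
      exact/measurable_EFinP.
  by apply: eq_integrable => // y _; exact: E1.
- congr fine; transitivity (\int[m1]_x \int[m2]_y (EFin \o f) (x, y))%E.
    by apply: eq_integral => x _; rewrite E2.
  by rewrite Fubini//; apply: eq_integral => y _; rewrite E1.
Qed.

Lemma cint_Fubini (f : T1 * T2 -> R[i]) (g : T1 -> R) (h : T2 -> R) :
  cmeas setT f -> m1.-integrable setT (EFin \o g) ->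
  m2.-integrable setT (EFin \o h) ->
  (forall x y, cabs (f (x, y)) <= g x * h y) ->
  [/\ cintble m1 setT (fun x => cint m2 setT (fun y => f (x, y))),
      cintble m2 setT (fun y => cint m1 setT (fun x => f (x, y))) &
      cint m1 setT (fun x => cint m2 setT (fun y => f (x, y))) =
      cint m2 setT (fun y => cint m1 setT (fun x => f (x, y)))].
Proof.
move=> [mf1 mf2] ig ih fgh.
have b1 x y : `|re (f (x, y))| <= g x * h y.
  by apply: le_trans (re_le_cabs _) (fgh x y).
have b2 x y : `|im (f (x, y))| <= g x * h y.
  by apply: le_trans (im_le_cabs _) (fgh x y).
have [p1 p2 p3] := Rintegral_Fubini mf1 ig ih b1.
have [q1 q2 q3] := Rintegral_Fubini mf2 ig ih b2.
by split => //; rewrite /cint /= p3 q3.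
Qed.
End Fubini.

(** * Differentiation under the integral sign *)

Section DerivativeUnderIntegral.
Context d (T : measurableType d) (R : realType).
Variable mu : {measure set T -> \bar R}.

Lemma is_derive_Rintegral (f df : R -> T -> R) (a u v : R) (G : T -> R) :
  a \in `]u, v[ ->
  (forall x, x \in `]u, v[ -> mu.-integrable setT (EFin \o f x)) ->
  (forall x y, x \in `]u, v[ -> is_derive x 1 (f ^~ y) (df x y)) ->
  mu.-integrable setT (EFin \o G) ->
  (forall x y, x \in `]u, v[ -> `|df x y| <= G y) ->
  is_derive a 1 (fun x => \int[mu]_y f x y) (\int[mu]_y df a y).
Proof.
move=> auv intf derf intG Gub.
have G0 y : 0 <= G y by apply: le_trans (Gub a y auv).
have derf1 x y : `]u, v[%classic x -> setT y -> derivable (f ^~ y) x 1.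
  by move=> xuv _; have [] := derf x y xuv.
have E x y : x \in `]u, v[ -> partial1of2 f x y = df x y.
  by move=> xuv; rewrite partial1of2E; have [_ ->] := derf x y xuv.
have Gub' x y : `]u, v[%classic x -> setT y -> `|partial1of2 f x y| <= G y.
  by move=> xuv _; rewrite E//; exact: Gub.
apply: DeriveDef.
  exact: (derivable_under_integral measurableT auv intf derf1 G0 intG Gub').
rewrite -derive1E.
rewrite (differentiation_under_integral measurableT auv intf derf1 G0 intG Gub').
by apply: eq_Rintegral => y _; rewrite E.
Qed.

Lemma is_cder_cint (f df : R -> T -> R[i]) (a u v : R) (G : T -> R) :
  a \in `]u, v[ ->
  (forall x, x \in `]u, v[ -> cintble mu setT (f x)) ->
  (forall x y, x \in `]u, v[ -> is_cder (f ^~ y) x (df x y)) ->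
  mu.-integrable setT (EFin \o G) ->
  (forall x y, x \in `]u, v[ -> cabs (df x y) <= G y) ->
  is_cder (fun x => cint mu setT (f x)) a (cint mu setT (df a)).
Proof.
move=> auv intf derf intG Gub; split.
- apply: (@is_derive_Rintegral (fun x y => re (f x y)) (fun x y => re (df x y))
    _ _ _ G auv) => //.
  + by move=> x /intf[].
  + by move=> x y /(derf x y)[].
  + by move=> x y /(Gub x y); apply: le_trans; exact: re_le_cabs.
- apply: (@is_derive_Rintegral (fun x y => im (f x y)) (fun x y => im (df x y))
    _ _ _ G auv) => //.
  + by move=> x /intf[].
  + by move=> x y /(derf x y)[].
  + by move=> x y /(Gub x y); apply: le_trans; exact: im_le_cabs.
Qed.

End DerivativeUnderIntegral.

(** * The fundamental theorem of calculus with singular end points *)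

Section OpenIntervalFTC.
Variable R : realType.
Notation mu := (@lebesgue_measure R).
Implicit Types (f F : R -> R) (a b : R).

Section approximation.
Variables (a b : R).
Hypothesis ab : a < b.
(** The denominator is at least 3, so [a + e n < b - e n] for every [n], and the compact intervals
    [S n] exhaust the open one without degenerating. *)
Let e n := (b - a) / n.+3%:R.
Let S n : set R := `[a + e n, b - e n]%classic.

Let e_gt0 n : 0 < e n. Proof. by rewrite divr_gt0 ?subr_gt0. Qed.
Let e_cvg : e n @[n --> \oo] --> 0.
Proof.
rewrite -(mulr0 (b - a)); apply: cvgMr.
have h := @cvg_harmonic R.
by rewrite -(cvg_shiftn 2) in h; apply: cvg_trans h; apply: near_eq_cvg;
  near=> n; rewrite /harmonic/= addn2.
Unshelve. all: by end_near. Qed.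
Let eS n : e n.+1 <= e n.
Proof. by rewrite ler_pM2l ?subr_gt0// lef_pV2 ?posrE// ler_nat. Qed.
Let e_lt n : a + e n < b - e n.
Proof.
have h : e n * n.+3%:R = b - a by rewrite divfK.
have h3 : 3 <= n.+3%:R :> R by rewrite ler_nat.
by have := e_gt0 n; nra.
Qed.
Let S_sub n : S n `<=` `]a, b[.
Proof.
move=> x; rewrite /S /= !in_itv/= => /andP[h1 h2].
by rewrite (lt_le_trans _ h1) ?ltrDl//= (le_lt_trans h2)// gtrBl.
Qed.
Let S_ev x : x \in `]a, b[ -> \forall n \near \oo, S n x.
Proof.
rewrite in_itv/= => /andP[ax xb].
have m0 : 0 < Num.min (x - a) (b - x) by rewrite lt_min !subr_gt0 ax.
have h : \forall n \near \oo, e n < Num.min (x - a) (b - x).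
  exact: (cvgr_lt 0).
apply: filterS h => n; rewrite lt_min => /andP[h1 h2].
by rewrite /S /= in_itv/=; lra.
Qed.

Lemma FTC_approx f F n : (forall x, x \in `]a, b[ -> is_derive x 1 F (f x)) ->
  (forall x, x \in `]a, b[ -> {for x, continuous f}) ->
  (\int[mu]_(x in S n) (f x)%:E = (F (b - e n) - F (a + e n))%:E)%E.
Proof.
move=> dF cf.
have cF x : S n x -> {for x, continuous F}.
  move=> /S_sub Sx; apply/differentiable_continuous/derivable1_diffP.
  by have [] := dF _ Sx.
have Sl : S n (a + e n) by rewrite /S/= in_itv/= lexx ltW//.
have Sr : S n (b - e n) by rewrite /S/= in_itv/= lexx ltW//.
rewrite (@continuous_FTC2 R f F)//.
- apply: continuous_in_subspaceT => x; rewrite inE => /S_sub; exact: cf.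
- split.
  + by move=> x /subset_itv_oo_cc/S_sub xab; have [] := dF _ xab.
  + by apply: cvg_at_right_filter; exact: cF.
  + by apply: cvg_at_left_filter; exact: cF.
- move=> x /subset_itv_oo_cc/S_sub xab.
  by rewrite derive1E; have [_ ->] := dF _ xab.
Qed.

(** A bounded antiderivative bounds the integrals over all [S n] by twice [M]; monotone convergence
    then gives finiteness even if [f] is unbounded near an end point. *)
Lemma ge0_integrable_FTC f F M :
  (forall x, x \in `]a, b[ -> is_derive x 1 F (f x)) ->
  (forall x, x \in `]a, b[ -> {for x, continuous f}) ->
  (forall x, x \in `]a, b[ -> 0 <= f x) ->
  (forall x, x \in `]a, b[ -> `|F x| <= M) ->
  mu.-integrable `]a, b[ (EFin \o f).
Proof.
move=> dF cf f0 FM.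
have mf : measurable_fun `]a, b[ f.
  by apply: open_continuous_measurable_fun => // x /set_mem; exact: cf.
apply/integrableP; split; first exact/measurable_EFinP.
under eq_integral => x xab.
  rewrite /= ger0_norm; last by apply: f0; rewrite inE in xab.
  over.
have US : `]a, b[%classic = \bigcup_n S n.
  apply/seteqP; split=> x; last by move=> [n _ /S_sub].
  by move=> /S_ev [N _ /(_ N (leqnn N)) h]; exists N.
have ndS : nondecreasing_seq S.
  apply/nondecreasing_seqP => n; apply/subsetPset => x.
  by rewrite /S/= !in_itv/=; have := eS n; lra.
rewrite US.
have mS n : measurable (S n) by exact: measurable_itv.
have mfS n : measurable_fun (S n) (EFin \o f).
  by apply/measurable_EFinP; apply: measurable_funS mf => //; exact: S_sub.
have fS0 n x : S n x -> (0 <= (EFin \o f) x)%E by move=> /S_sub/f0; rewrite lee_fin.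
have c : (\int[mu]_(x in S i) (EFin \o f) x @[i --> \oo] -->
    \int[mu]_(x in \bigcup_i S i) (EFin \o f) x)%E.
  exact: ge0_nondecreasing_set_cvg_integral.
rewrite -(cvg_lim _ c)//.
apply: (@le_lt_trans _ _ (2 * M)%:E); last exact: ltry.
apply: lime_le; first by apply/cvg_ex; eexists; exact: c.
apply: nearW => n; rewrite (FTC_approx n dF cf) lee_fin.
have Sl : S n (a + e n) by rewrite /S/= in_itv/= lexx ltW//.
have Sr : S n (b - e n) by rewrite /S/= in_itv/= lexx ltW//.
have := FM _ (S_sub Sl); have := FM _ (S_sub Sr); rewrite !ler_norml; lra.
Qed.

(** Dominated convergence along [S n] replaces continuity on a closed interval by one-sided limits
    of [F], as the Beta kernel requires when its exponents are negative. *)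
Lemma FTC_oo f F (A B : R) :
  (forall x, x \in `]a, b[ -> is_derive x 1 F (f x)) ->
  (forall x, x \in `]a, b[ -> {for x, continuous f}) ->
  mu.-integrable `]a, b[ (EFin \o f) ->
  F x @[x --> a^'+] --> A -> F x @[x --> b^'-] --> B ->
  \int[mu]_(x in `]a, b[) f x = B - A.
Proof.
move=> dF cf intf FA FB.
have mf := measurable_int _ intf; move/measurable_EFinP in mf.
have [] := @Rintegral_dct _ _ R mu `]a, b[ (fun n => f \_ (S n)) f (fun x => `|f x|).
- exact: measurable_itv.
- move=> n; apply/measurable_restrict => //; first exact: measurable_itv.
  by apply: measurable_funS mf => // x [].
- move=> x xab; apply: cvg_near_cst; have := S_ev xab.
  by apply: filterS => n Sx; rewrite patchE mem_set.
- exact: integrable_norm.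
- by move=> n x _; rewrite patchE; case: ifP; rewrite ?normr0.
move=> _ c1.
have c2 : F (b - e n) - F (a + e n) @[n --> \oo] --> B - A.
  apply: cvgB.
  - move/cvg_at_leftP : FB; apply; split; first by move=> n; rewrite gtrBl.
    by rewrite -[X in _ --> X]subr0; apply: cvgB => //; exact: cvg_cst.
  - move/cvg_at_rightP : FA; apply; split; first by move=> n; rewrite ltrDl.
    by rewrite -[X in _ --> X]addr0; apply: cvgD => //; exact: cvg_cst.
suff c3 : \int[mu]_(t in `]a, b[) (f \_ (S n)) t @[n --> \oo] --> B - A.
  exact: (cvg_unique _ c1 c3).
apply: cvg_trans c2; apply: near_eq_cvg; near=> n; rewrite -Rintegral_mkcondr (_ : _ `&` _ = S n).
  by rewrite /Rintegral (FTC_approx n dF cf).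
by apply/seteqP; split => [x []//|x Sx]; split => //; exact: S_sub Sx.
Unshelve. all: by end_near. Qed.
End approximation.

End OpenIntervalFTC.

Section ComplexFTC.
Variable R : realType.
Notation mu := (@lebesgue_measure R).
Implicit Types (f F : R -> R[i]) (a b x z p : R).

Definition ccont f x :=
  {for x, continuous (fun t => re (f t))} /\ {for x, continuous (fun t => im (f t))}.

Lemma is_derive_continuous (f : R -> R) x l : is_derive x 1 f l -> {for x, continuous f}.
Proof.
by move=> [h _]; apply/differentiable_continuous/derivable1_diffP.
Qed.

Lemma is_cder_ccont f x l : is_cder f x l -> ccont f x.
Proof. by move=> [h1 h2]; split; apply: is_derive_continuous; eassumption. Qed.

Lemma ccont_cmeas f (D : set R) : open D -> (forall x, D x -> ccont f x) -> cmeas D f.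
Proof.
move=> oD h; split; apply: open_continuous_measurable_fun => // x /set_mem /h;
  by case.
Qed.

Lemma cvg_of_cabs (T : Type) (G : set_system T) (FG : Filter G) (F : T -> R[i]) (l : R[i]) :
  cabs (F t - l) @[t --> G] --> (0 : R) ->
  re (F t) @[t --> G] --> re l /\ im (F t) @[t --> G] --> im l.
Proof.
move=> h; split; apply/cvgrPdist_lt => e e0; move/cvgr0Pnorm_lt : (h) => /(_ e e0);
  apply: filterS => t; rewrite ger0_norm ?cabs_ge0//; apply: le_lt_trans;
  rewrite distrC -?reB -?imB; [exact: re_le_cabs|exact: im_le_cabs].
Qed.

Lemma ccvg_of_cabs (u : nat -> R[i]) l :
  cabs (u n - l) @[n --> \oo] --> (0 : R) -> ccvg u l.
Proof. by move/cvg_of_cabs. Qed.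

Lemma cFTC_oo f F a b A B : a < b ->
  (forall x, x \in `]a, b[ -> is_cder F x (f x)) ->
  (forall x, x \in `]a, b[ -> ccont f x) ->
  cintble mu `]a, b[ f ->
  cabs (F x - A) @[x --> a^'+] --> (0 : R) ->
  cabs (F x - B) @[x --> b^'-] --> (0 : R) ->
  cint mu `]a, b[ f = B - A.
Proof.
move=> ab dF cf [i1 i2] /cvg_of_cabs[a1 a2] /cvg_of_cabs[b1 b2].
apply: complexP; rewrite /= ?reB ?imB.
- by apply: (FTC_oo ab _ _ i1 a1 b1) => x xab;
    [case: (dF x xab)|case: (cf x xab)].
- by apply: (FTC_oo ab _ _ i2 a2 b2) => x xab;
    [case: (dF x xab)|case: (cf x xab)].
Qed.

Lemma powR_small p e : 0 < p -> 0 < e ->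
  exists2 d : R, 0 < d & forall t, 0 < t -> t < d -> t `^ p < e.
Proof.
move=> p0 e0; exists (e `^ p^-1); first exact: powR_gt0.
move=> t t0 td.
rewrite -[ltRHS](powRr1 (ltW e0)) -(mulVf (lt0r_neq0 p0)) powRrM.
by apply: gt0_ltr_powR => //; rewrite nnegrE ?powR_ge0// ltW.
Qed.

(** The power is monotone in its base, in a direction that depends on the sign of [c]; the sum of
    the end values covers both cases, hence all exponents at once. *)
Lemma powR_between a b t c : 0 < a -> a <= t -> t <= b -> t `^ c <= a `^ c + b `^ c.
Proof.
move=> a0 at_ tb; have t0 := lt_le_trans a0 at_; have b0 := lt_le_trans t0 tb.
have [c0|c0] := leP 0 c.
  apply: (@le_trans _ _ (b `^ c)); last by rewrite lerDr powR_ge0.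
  by apply: ge0_ler_powR => //; rewrite nnegrE ltW.
apply: (@le_trans _ _ (a `^ c)); last by rewrite lerDl powR_ge0.
rewrite -[c]opprK !(powRN _ (- c)) lef_pV2 ?posrE ?powR_gt0//.
by apply: ge0_ler_powR => //; rewrite ?nnegrE ?oppr_ge0 ltW.
Qed.

Lemma is_derive_subl z x : is_derive x 1 (fun t : R => z - t) (-1 : R).
Proof.
have h : is_derive x 1 (fun t : R => (fun=> z) t - id t) (0 - 1 : R).
  exact: is_deriveB.
by apply: is_derive_congr h _ _ => //; rewrite sub0r.
Qed.

Lemma is_derive_powR_subl z p u : u < z ->
  is_derive u 1 (fun t => (z - t) `^ p) (- (p * (z - u) `^ (p - 1))).
Proof.
move=> uz.
have zu : 0 < z - u by rewrite subr_gt0.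
have h := @is_derive1_comp _ (fun t : R => t `^ p) (fun t : R => z - t) u _ _
  (is_derive1_powR p zu) (is_derive_subl z u).
by apply: is_derive_congr h _ _ => //; rewrite mulrN1.
Qed.

Lemma integrable_powR p z : 0 < p -> 0 < z ->
  mu.-integrable `]0, z[ (EFin \o (fun u => u `^ (p - 1))).
Proof.
move=> p0 z0.
have := @ge0_integrable_FTC R 0 z z0 (fun u => u `^ (p - 1)) (fun u => p^-1 * u `^ p) (p^-1 * z `^ p).
apply.
- move=> u; rewrite in_itv/= => /andP[u0 _].
  have h := is_deriveZ p^-1 (is_derive1_powR p u0).
  by apply: is_derive_congr h _ _ => //; rewrite /GRing.scale/= mulKf ?gt_eqF.
- move=> u; rewrite in_itv/= => /andP[u0 _].
  exact: is_derive_continuous (is_derive1_powR (p - 1) u0).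
- by move=> u _; exact: powR_ge0.
- move=> u; rewrite in_itv/= => /andP[u0 uz].
  rewrite ger0_norm ?mulr_ge0 ?powR_ge0 ?invr_ge0 ?(ltW p0)//.
  rewrite ler_wpM2l ?invr_ge0 ?(ltW p0)//.
  by apply: ge0_ler_powR; rewrite ?nnegrE ltW.
Qed.

Lemma integrable_powR_subl p z : 0 < p -> 0 < z ->
  mu.-integrable `]0, z[ (EFin \o (fun u => (z - u) `^ (p - 1))).
Proof.
move=> p0 z0.
have := @ge0_integrable_FTC R 0 z z0 (fun u => (z - u) `^ (p - 1)) (fun u => (- p^-1) * (z - u) `^ p) (p^-1 * z `^ p).
apply.
- move=> u; rewrite in_itv/= => /andP[_ uz].
  have h := is_deriveZ (- p^-1) (is_derive_powR_subl p uz).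
  by apply: is_derive_congr h _ _ => //; rewrite /GRing.scale/= mulrNN mulKf ?gt_eqF.
- move=> u; rewrite in_itv/= => /andP[_ uz].
  exact: is_derive_continuous (is_derive_powR_subl (p - 1) uz).
- by move=> u _; exact: powR_ge0.
- move=> u; rewrite in_itv/= => /andP[u0 uz].
  rewrite mulNr normrN ger0_norm ?mulr_ge0 ?powR_ge0 ?invr_ge0 ?(ltW p0)//.
  rewrite ler_wpM2l ?invr_ge0 ?(ltW p0)//.
  by apply: ge0_ler_powR; rewrite ?nnegrE; lra.
Qed.

Lemma integrable_beta x p z : 0 < x -> 0 < p -> 0 < z ->
  mu.-integrable `]0, z[ (EFin \o (fun u => u `^ (x - 1) * (z - u) `^ (p - 1))).
Proof.
move=> x0 p0 z0.
(* On the left half of the interval [z - u] stays between z / 2 and z, on the right half [u] does;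
   [C] bounds the factor that is not singular there. *)
pose C q := (z / 2) `^ (q - 1) + z `^ (q - 1).
have C0 q : 0 <= C q by rewrite addr_ge0 ?powR_ge0.
have mD : measurable (`]0, z[%classic : set (measurableTypeR R)).
  exact: measurable_itv.
have := integrable_EFinD mD (integrable_EFinZ (C p) mD (integrable_powR x0 z0))
  (integrable_EFinZ (C x) mD (integrable_powR_subl p0 z0)).
apply: le_integrable => //.
  apply/measurable_EFinP; apply: measurable_funM.
    apply: measurable_funTS; exact: measurable_powR.
  apply: measurable_funTS; apply: (measurableT_comp (measurable_powR _)).
  exact: measurable_funB.
move=> u; rewrite /= in_itv/= => /andP[u0 uz].
rewrite lee_fin !ger0_norm ?addr_ge0 ?mulr_ge0 ?powR_ge0//.
have [h|h] := leP u (z / 2).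
  rewrite ler_wpDr ?mulr_ge0 ?powR_ge0// mulrC ler_wpM2r ?powR_ge0//.
  by apply: powR_between; lra.
rewrite ler_wpDl ?mulr_ge0 ?powR_ge0// ler_wpM2r ?powR_ge0//.
by apply: powR_between; lra.
Qed.

End ComplexFTC.

(** * The Beta integral *)

Section BetaKernel.
Variable R : realType.
Notation mu := (@lebesgue_measure R).
Implicit Types (q : R[i]) (p z u : R).

(** [q] is complex because it will be one plus the exponent of a power of [z]; [p] is real because
    it will be the order of a fractional integral or an integer. *)
Definition beta_kernel q p z u : R[i] := rpow u (q - 1) * ((z - u) `^ (p - 1))%:C.
Definition beta_integral q p z := cint mu `]0, z[ (beta_kernel q p z).

Let mI z : measurable (`]0, z[%classic : set (measurableTypeR R)).
Proof. exact: measurable_itv. Qed.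

Lemma is_cder_powR_subl z p u : u < z ->
  is_cder (fun t => ((z - t) `^ p)%:C) u (- (p * (z - u) `^ (p - 1)))%:C.
Proof. by move=> uz; apply: is_cder_real; exact: is_derive_powR_subl. Qed.

Lemma beta_kernel_cont q p z u : u \in `]0, z[ -> ccont (beta_kernel q p z) u.
Proof.
rewrite in_itv/= => /andP[u0 uz].
exact: is_cder_ccont (is_cderM (is_cder_rpow _ u0) (is_cder_powR_subl _ uz)).
Qed.

Lemma beta_kernel_meas q p z : cmeas `]0, z[ (beta_kernel q p z).
Proof.
apply: ccont_cmeas; first exact: itv_open.
by move=> u uz; exact: beta_kernel_cont.
Qed.

Lemma cabs_beta_kernel q p z u : 0 < u ->
  cabs (beta_kernel q p z u) = u `^ (re q - 1) * (z - u) `^ (p - 1).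
Proof.
by move=> u0; rewrite cabsM cabs_rpow// cabs_real ger0_norm ?powR_ge0// reB.
Qed.

Lemma beta_kernel_intble q p z : 0 < re q -> 0 < p -> 0 < z ->
  cintble mu `]0, z[ (beta_kernel q p z).
Proof.
move=> q0 p0 z0; apply: cintble_le (integrable_beta q0 p0 z0) _ => //.
  exact: beta_kernel_meas.
by move=> u; rewrite /= in_itv/= => /andP[u0 _]; rewrite cabs_beta_kernel.
Qed.

(** The function u^q (z - u)^p vanishes at both ends, so its derivative integrates to 0; writing u
    as z - (z - u) expresses that derivative by the two kernels. *)
Lemma beta_integral_rec q p z : 0 < re q -> 0 < p -> 0 < z ->
  (q + p%:C) * beta_integral q (p + 1) z = (z * p)%:C * beta_integral q p z.
Proof.
move=> q0 p0 z0.
have i1 : cintble mu `]0, z[ (beta_kernel q (p + 1) z).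
  by apply: beta_kernel_intble => //; rewrite addr_gt0.
have i2 := beta_kernel_intble q0 p0 z0.
apply/eqP; rewrite -subr_eq0 -!cintZ// -cintB//; [|exact: cintbleZ..].
apply/eqP; rewrite -(subr0 0).
apply: (@cFTC_oo _ _ (fun u => rpow u q * ((z - u) `^ p)%:C) _ _ _ _ z0).
- move=> u; rewrite in_itv/= => /andP[u0 uz].
  apply: is_cder_eq (is_cderM (is_cder_rpow q u0) (is_cder_powR_subl p uz)) _.
  rewrite /beta_kernel (_ : p + 1 - 1 = p); last by ring.
  have -> : (z - u) `^ p = (z - u) * (z - u) `^ (p - 1).
    by rewrite mulr_powRB1// subr_ge0 ltW.
  have -> : rpow u q = u%:C * rpow u (q - 1).
    by rewrite -(rpow1 u0) -rpowD addrC subrK.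
  rewrite !(realCM, realCB, realCN); ring.
- move=> u uz.
  have h c (g : R -> R[i]) : ccont g u -> ccont (fun t => c * g t) u.
    move=> [g1 g2]; split.
      have -> : (fun t => re (c * g t)) = (fun t => re c * re (g t) - im c * im (g t)).
        by apply/funext => t; rewrite reM.
      by apply: cvgB; apply: cvgMr.
    have -> : (fun t => im (c * g t)) = (fun t => re c * im (g t) + im c * re (g t)).
      by apply/funext => t; rewrite imM.
    by apply: cvgD; apply: cvgMr.
  have [g1 g2] := h (q + p%:C) _ (beta_kernel_cont q (p + 1) uz).
  have [g3 g4] := h (z * p)%:C _ (beta_kernel_cont q p uz).
  split.
    under [X in {for u, continuous X}]funext do rewrite reB.
    by apply: cvgB.
  under [X in {for u, continuous X}]funext do rewrite imB.
  by apply: cvgB.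
- by have := cintbleD (mI z) (cintbleZ (q + p%:C) (mI z) i1)
    (cintbleZ (- (z * p)%:C) (mI z) i2); apply: eq_cintble => // u _;
    rewrite mulNr.
- apply/cvgr0Pnorm_lt => e e0.
  have [d d0 dP] := powR_small q0 (divr_gt0 e0 (powR_gt0 p z0)).
  near=> u.
  have u0 : 0 < u by near: u; exact: nbhs_right_gt.
  have ud : u < d by near: u; exact: nbhs_right_lt.
  have uz : u < z by near: u; exact: nbhs_right_lt.
  rewrite subr0 ger0_norm ?cabs_ge0// cabsM cabs_rpow// cabs_real ger0_norm ?powR_ge0//.
  apply: (@le_lt_trans _ _ (u `^ re q * z `^ p)).
    rewrite ler_wpM2l ?powR_ge0//; apply: ge0_ler_powR; rewrite ?nnegrE; lra.
  by rewrite -ltr_pdivlMr ?powR_gt0// dP.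
- apply/cvgr0Pnorm_lt => e e0.
  have [d d0 dP] := powR_small p0 (divr_gt0 e0 (powR_gt0 (re q) z0)).
  near=> u.
  have uz : u < z by near: u; exact: nbhs_left_lt.
  have ud : z - d < u by near: u; apply: nbhs_left_gt; rewrite ltrBlDr ltrDl.
  have u0 : 0 < u by near: u; exact: nbhs_left_gt.
  rewrite subr0 ger0_norm ?cabs_ge0// cabsM cabs_rpow// cabs_real ger0_norm ?powR_ge0//.
  apply: (@le_lt_trans _ _ (z `^ re q * (z - u) `^ p)).
    rewrite ler_wpM2r ?powR_ge0//; apply: ge0_ler_powR; rewrite ?nnegrE; lra.
  by rewrite mulrC -ltr_pdivlMr ?powR_gt0// dP//; lra.
Unshelve. all: by end_near. Qed.

Lemma beta_integral1 q z : 0 < re q -> 0 < z -> beta_integral q 1 z = rpow z q / q.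
Proof.
move=> q0 z0.
have q_neq0 : q != 0 by apply: contraTneq q0 => ->; rewrite /= ltxx.
have i1 := beta_kernel_intble q0 ltr01 z0.
apply: (mulfI q_neq0); rewrite mulrCA divff// mulr1 -cintZ//.
rewrite -(subr0 (rpow z q)).
apply: (@cFTC_oo _ _ (fun u => rpow u q) _ _ _ _ z0).
- move=> u; rewrite in_itv/= => /andP[u0 uz].
  apply: is_cder_eq (is_cder_rpow q u0) _.
  by rewrite /beta_kernel subrr powRr0 mulr1.
- move=> u; rewrite in_itv/= => /andP[u0 uz].
  have [h1 h2] := is_cder_ccont (is_cderZ q (is_cder_rpow (q - 1) u0)).
  rewrite /ccont /beta_kernel.
  by split; under [X in {for u, continuous X}]funext do rewrite subrr powRr0 mulr1.
- exact: cintbleZ.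
- apply/cvgr0Pnorm_lt => e e0; have [d d0 dP] := powR_small q0 e0.
  near=> u.
  have u0 : 0 < u by near: u; exact: nbhs_right_gt.
  have ud : u < d by near: u; exact: nbhs_right_lt.
  by rewrite subr0 ger0_norm ?cabs_ge0// cabs_rpow// dP.
- have [h1 h2] := is_cder_ccont (is_cder_rpow q z0).
  apply: cvg_at_left_filter.
  have e1 : cabs (rpow z q - rpow z q) = 0 by rewrite subrr cabs0.
  rewrite -[X in _ --> X]e1.
  apply: (continuous_cvg _ (@sqrt_continuous R _)).
  apply: cvgD; rewrite !expr2; apply: cvgM;
    (under [X in X @ _ --> _]funext do rewrite ?reB ?imB);
    rewrite ?reB ?imB; by apply: cvgB => //; exact: cvg_cst.
Unshelve. all: by end_near. Qed.

(** At [z = n%:R] the right-hand side is n^n times Gauss's product for Gamma(q), which is how Gamma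
    enters. *)
Lemma beta_integral_nat q z n : 0 < re q -> 0 < z ->
  beta_integral q n.+1%:R z =
  n`!%:R * rpow z (q + n%:R) / \prod_(k < n.+1) (q + k%:R).
Proof.
move=> q0 z0.
have nz k : q + k%:R != 0.
  rewrite -cabs_gt0; apply: lt_le_trans (re_le_cabs _).
  by rewrite reD re_nat gtr0_norm ltr_wpDr.
elim: n => [|n IH].
  by rewrite big_ord_recl big_ord0 fact0 beta_integral1// mulr1 !addr0 mul1r.
apply: (mulfI (nz n.+1)).
rewrite -[n.+2%:R]natr1 -{1}realC_nat beta_integral_rec// IH.
have -> : rpow z (q + n.+1%:R) = rpow z (q + n%:R) * z%:C.
  have -> : q + n.+1%:R = (q + n%:R) + 1 by rewrite -natr1 addrA.
  by rewrite [LHS]rpowD rpow1.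
have nzp : \prod_(k < n.+1) (q + k%:R) != 0.
  by apply/prodf_neq0 => i _; exact: nz.
have := nz n.+1; rewrite [in RHS]big_ord_recr/= factS natrM realCM realC_nat.
move: (n.+1%:R) (\prod_(k < n.+1) _) nzp => N P nzp nzN; field.
by rewrite nzN.
Qed.

End BetaKernel.

(** * The Gamma function *)

Section ExponentialBounds.
Variable R : realType.
Implicit Types (u x : R).

Lemma bernoulli_ineq x n : -1 <= x -> 1 + n%:R * x <= (1 + x) ^+ n.
Proof.
move=> x1; elim: n => [|n IH]; first by rewrite mul0r addr0 expr0.
rewrite exprS -natr1.
have h : 0 <= 1 + x by lra.
apply: (le_trans _ (ler_wpM2l h IH)).
have := ler0n R n; have := sqr_ge0 x; nra.
Qed.

Lemma expn1B_le u n : (0 < n)%N -> u <= n%:R -> (1 - u / n%:R) ^+ n <= expR (- u).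
Proof.
move=> n0 un.
have n0' : 0 < n%:R :> R by rewrite ltr0n.
have h : 0 <= 1 - u / n%:R by rewrite subr_ge0 ler_pdivrMr// mul1r.
apply: (@le_trans _ _ (expR (- (u / n%:R)) ^+ n)).
  by rewrite lerXn2r ?nnegrE ?expR_ge0// expR_ge1Dx.
by rewrite -expRM_natl mulrN mulrCA divff ?mulr1// gt_eqF.
Qed.

(** Since e^(u/n) >= 1 + u/n, multiplication by e^u leaves at least (1 - u^2/n^2)^n, and Bernoulli's
    inequality bounds this below by 1 - u^2/n. *)
Lemma expn1B_ge u n : (0 < n)%N -> 0 <= u -> u <= n%:R ->
  expR (- u) * (1 - u ^+ 2 / n%:R) <= (1 - u / n%:R) ^+ n.
Proof.
move=> n0 u0 un.
have n0' : 0 < n%:R :> R by rewrite ltr0n.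
have t1 : u / n%:R <= 1 by rewrite ler_pdivrMr// mul1r.
have t0 : 0 <= u / n%:R by rewrite divr_ge0// ltW.
rewrite expRN ler_pdivrMl ?expR_gt0//.
have -> : expR u = expR (u / n%:R) ^+ n.
  by rewrite -expRM_natl mulrCA divff ?mulr1// gt_eqF.
rewrite -exprMn.
apply: (@le_trans _ _ ((1 - (u / n%:R) ^+ 2) ^+ n)); last first.
  rewrite lerXn2r ?nnegrE//; first by rewrite subr_ge0 exprn_ile1.
    by rewrite mulr_ge0 ?expR_ge0// subr_ge0.
  have := expR_ge1Dx (u / n%:R); nra.
have -> : 1 - u ^+ 2 / n%:R = 1 + n%:R * (- (u / n%:R) ^+ 2).
  by field; rewrite gt_eqF.
apply: bernoulli_ineq; rewrite lerN2 exprn_ile1//.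
Qed.

Lemma cvg_expn1B u : 0 <= u -> (1 - u / n%:R) ^+ n @[n --> \oo] --> expR (- u).
Proof.
move=> u0.
apply: (@squeeze_cvgr _ _ _ _ (fun n : nat => expR (- u) * (1 - u ^+ 2 / n%:R))
  (fun=> expR (- u))).
- near=> n.
  have n0 : (0 < n)%N by near: n; exact: nbhs_infty_gt.
  have un : u <= n%:R by near: n; exact: nbhs_infty_ger.
  by rewrite expn1B_ge//= expn1B_le.
- rewrite -[X in _ --> X]mulr1; apply: cvgMr.
  rewrite -[X in _ --> X]subr0; apply: cvgB; first exact: cvg_cst.
  rewrite -(mulr0 (u ^+ 2)); apply: cvgMr.
  by apply/gtr0_cvgV0; [near=> n; rewrite ltr0n; near: n; exact: nbhs_infty_gt|exact: cvgr_idn].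
- exact: cvg_cst.
Unshelve. all: by end_near. Qed.

Lemma powR_le_expR x : exists2 C : R, 0 <= C &
  forall u, 1 <= u -> u `^ x <= C * expR (u / 2).
Proof.
pose n := (Num.truncn `|x|).+1.
exists (n.+1`!%:R * 2 ^+ n.+1) => [|u u1]; first by rewrite mulr_ge0.
apply: (@le_trans _ _ (u ^+ n.+1)).
  rewrite -powR_mulrn ?(le_trans ler01)//; apply: ler_powR => //.
  apply: (le_trans (ler_norm x)); apply: (@le_trans _ _ n%:R); last by rewrite ler_nat.
  by rewrite ltW// truncnS_gt.
have h0 : 0 <= u / 2 by lra.
have h := expR_ge1Dxn n h0.
have : (u / 2) ^+ n.+1 / n.+1`!%:R <= expR (u / 2) by lra.
rewrite ler_pdivrMr ?ltr0n ?fact_gt0// expr_div_n ler_pdivrMr ?exprn_gt0//.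
by move=> hh; rewrite [leRHS]mulrC mulrA.
Qed.

Notation mu := (@lebesgue_measure R).

Lemma integrable_expRN_half :
  mu.-integrable `]0, +oo[ (EFin \o (fun u : R => expR (- (u / 2)))).
Proof.
have ce : continuous (fun u : R => expR (- (u / 2))).
  move=> u; apply: (@continuous_comp _ _ _ (fun u : R => - (u / 2)) expR).
    by apply: cvgN; apply: cvgMl; exact: cvg_id.
  exact: continuous_expR.
apply: (@integrableS _ _ _ mu `[0, +oo[) => //.
- by apply: subset_itvr; rewrite bnd_simp.
apply/integrableP; split.
  apply/measurable_EFinP; apply: measurable_funTS.
  exact: continuous_measurable_fun.
under eq_integral do rewrite /= ger0_norm ?expR_ge0//.
have dF (x : R) : is_derive x 1 (fun u : R => - 2 * expR (- (u / 2))) (expR (- (x / 2))).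
  have h1 : is_derive x 1 (fun u : R => - 2^-1 * u) (- 2^-1 * 1 : R).
    exact: is_deriveZ.
  have h2 := @is_derive1_comp _ expR (fun u : R => - 2^-1 * u) x _ _ (is_derive_expR _) h1.
  have h3 := is_deriveZ (-2 : R) h2.
  apply: is_derive_congr h3 _ _ => [t|] /=; rewrite /GRing.scale/=.
    by congr (_ * expR _); ring.
  rewrite (_ : - 2^-1 * x = - (x / 2)); last by ring.
  by field.
rewrite (@ge0_continuous_FTC2y _ (fun u : R => expR (- (u / 2)))
  (fun u : R => - 2 * expR (- (u / 2))) 0 0).
- exact: ltry.
- by move=> x _; exact: expR_ge0.
- exact: continuous_subspaceT.
- rewrite -[X in _ --> X](mulr0 (-2)); apply: cvgMr.
  apply/cvgrPdist_lt => e e0.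
  have := @cvgr_expR R => /cvgrPdist_lt /(_ e e0) [M [_ hM]].
  near=> x; apply: hM.
  near: x; exists (M * 2); split; first by rewrite num_real.
  by move=> x; rewrite ltr_pdivlMr.
- by move=> x _; have [] := dF x.
- by apply: cvg_at_right_filter; exact: is_derive_continuous (dF 0).
- by move=> x _; rewrite derive1E; have [_ ->] := dF x.
Unshelve. all: by end_near. Qed.

Lemma integrable_gamma x : 0 < x ->
  mu.-integrable `]0, +oo[ (EFin \o (fun u => u `^ (x - 1) * expR (- u))).
Proof.
move=> x0; have [C C0 hC] := powR_le_expR (x - 1).
have mD : measurable (`]0, +oo[%classic : set (measurableTypeR R)).
  exact: measurable_itv.
(* The majorant is u^(x - 1) restricted to ]0, 1[ plus C e^(-u/2): for u >= 1 half of the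
   exponential is spent on the power. *)
have i1 : mu.-integrable `]0, +oo[
    (EFin \o ((fun u => u `^ (x - 1)) \_ `]0, 1[)).
  have mE : measurable (`]0, 1[%classic : set (measurableTypeR R)).
    exact: measurable_itv.
  have := (integrable_mkcond _ mE).1 (integrable_powR x0 ltr01).
  by rewrite restrict_EFin; exact: integrableS.
have := integrable_EFinD mD i1 (integrable_EFinZ C mD integrable_expRN_half).
apply: le_integrable => //.
  apply/measurable_EFinP; apply: measurable_funM.
    by apply: measurable_funTS; exact: measurable_powR.
  apply: measurableT_comp => //; exact: measurableT_comp.
move=> u; rewrite /= in_itv/= andbT => u0.
have h0 : 0 <= ((fun u => u `^ (x - 1)) \_ `]0, 1[) u.
  by rewrite patchE; case: ifP => _ //; exact: powR_ge0.
rewrite lee_fin !ger0_norm ?addr_ge0 ?mulr_ge0 ?powR_ge0 ?expR_ge0//.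
have [u1|u1] := ltP u 1.
  rewrite ler_wpDr ?mulr_ge0 ?expR_ge0// patchE mem_set/= ?in_itv/= ?u0//.
  by rewrite ler_piMr ?powR_ge0// -expR0 ler_expR oppr_le0 ltW.
rewrite ler_wpDl//; have := ler_wpM2r (expR_ge0 (- u)) (hC u u1).
rewrite -mulrA -expRD => h; apply: (le_trans h).
by rewrite ler_wpM2l// ler_expR; lra.
Qed.

End ExponentialBounds.

(** * Gauss's product and Euler's integral *)

Section GaussProduct.
Variable R : realType.
Notation mu := (@lebesgue_measure R).
Implicit Types (q z : R[i]).

Definition gauss_prod n q : R[i] :=
  n`!%:R * rpow n%:R q / \prod_(k < n.+1) (q + k%:R).

Lemma re_gt0_neq0 q n : 0 < re q -> q + n%:R != 0.
Proof.
move=> q0; rewrite -cabs_gt0; apply: lt_le_trans (re_le_cabs _).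
by rewrite reD re_nat gtr0_norm ltr_wpDr.
Qed.

(** This is the Beta integral over ]0, n[ with p = n + 1, divided by n^n, which turns (n - u)^n into
    (1 - u/n)^n. *)
Lemma gauss_prodE n q : (0 < n)%N -> 0 < re q ->
  gauss_prod n q = cint mu `]0, n%:R[
    (fun u => rpow u (q - 1) * ((1 - u / n%:R) ^+ n)%:C).
Proof.
move=> n0 q0; have n0' : 0 < n%:R :> R by rewrite ltr0n.
have mI : measurable (`]0, n%:R[%classic : set (measurableTypeR R)).
  exact: measurable_itv.
have nn0 : (n%:R ^+ n)%:C != 0 :> R[i] by rewrite realC_eq0 expf_neq0// gt_eqF.
apply: (mulfI nn0).
transitivity (beta_integral q n.+1%:R n%:R).
  rewrite beta_integral_nat// /gauss_prod rpowD rpow_nat// realCX.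
  by ring.
have i1 : cintble mu `]0, n%:R[ (beta_kernel q n.+1%:R n%:R).
  exact: beta_kernel_intble.
have e u : `]0, n%:R[%classic u -> beta_kernel q n.+1%:R n%:R u =
    (n%:R ^+ n)%:C * (rpow u (q - 1) * ((1 - u / n%:R) ^+ n)%:C).
  rewrite /= in_itv/= => /andP[u0 un].
  rewrite /beta_kernel -natr1 addrK powR_mulrn ?subr_ge0 ?(ltW un)//.
  rewrite mulrCA -realCM -exprMn; congr (_ * (_ ^+ _)%:C).
  by field; rewrite gt_eqF.
rewrite -cintZ//; first by apply: eq_cint => u; exact: e.
have := cintbleZ ((n%:R ^+ n)%:C)^-1 mI i1.
by apply: eq_cintble => // u /e ->; rewrite mulrA mulVf ?mul1r.
Qed.

(** Dominated convergence: (1 - u/n)^n tends to e^(-u) and stays below it on ]0, n[. *)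
Lemma gauss_limit q : 0 < re q -> ccvg (gauss_prod ^~ q) (gamma_euler q).
Proof.
move=> q0.
pose D := (`]0, +oo[%classic : set (measurableTypeR R)).
have mD : measurable D by exact: measurable_itv.
pose F (n : nat) (u : R) : R[i] := if u \in `]0, n%:R[%classic
  then rpow u (q - 1) * ((1 - u / n%:R) ^+ n)%:C else 0.
have [_ c] : cintble mu D (fun u => cpow u%:C (q - 1) * (expR (- u))%:C) /\
    ccvg (fun n => cint mu D (F n)) (gamma_euler q).
  apply: (@cint_dct _ _ _ mu D F _ (fun u => u `^ (re q - 1) * expR (- u))) => //.
  - move=> n.
    have mf : cmeas (`]0, n%:R[ : set (measurableTypeR R))
        (fun u : R => rpow u (q - 1) * ((1 - u / n%:R) ^+ n)%:C).
      apply: cmeasM.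
        apply: ccont_cmeas; first exact: itv_open.
        move=> u; rewrite /= in_itv/= => /andP[u0 un].
        exact: is_cder_ccont (is_cder_rpow _ u0).
      apply: cmeas_real; apply: measurable_funX; apply: measurable_funB => //.
      exact: measurable_funM.
    have e : F n = (fun u => if u \in `]0, n%:R[%classic then
      rpow u (q - 1) * ((1 - u / n%:R) ^+ n)%:C else 0) by [].
    have mE : measurable (`]0, n%:R[ : set (measurableTypeR R)) by exact: measurable_itv.
    split.
      apply: measurable_funTS.
      have := mf.1 => /(measurable_restrictT _ mE).1.
      congr (measurable_fun _ _); apply/funext => u.
      by rewrite patchE /F; case: ifP.
    apply: measurable_funTS.
    have := mf.2 => /(measurable_restrictT _ mE).1.
    congr (measurable_fun _ _); apply/funext => u.
    by rewrite patchE /F; case: ifP.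
  - move=> u; rewrite /D/= in_itv/= andbT => u0.
    apply: (@eq_ccvg _ (fun n => if (u < n%:R) then
        rpow u (q - 1) * ((1 - u / n%:R) ^+ n)%:C else 0)).
      by move=> n _; rewrite /F mem_setE in_itv/= u0.
    rewrite cpow_real//.
    have h := ccvgM (ccvg_cst (rpow u (q - 1))) (ccvg_real (cvg_expn1B (ltW u0))).
    have nr : \forall n \near \oo, u < n%:R by exact: nbhs_infty_gtr.
    case: h => h1 h2; split.
      by apply: cvg_trans h1; apply: near_eq_cvg; apply: filterS nr => n ->.
    by apply: cvg_trans h2; apply: near_eq_cvg; apply: filterS nr => n ->.
  - exact: integrable_gamma.
  - move=> n u; rewrite /D/= in_itv/= andbT => u0.
    rewrite /F; case: ifPn => [|_]; last first.
      by rewrite cabs0 mulr_ge0 ?powR_ge0 ?expR_ge0.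
    rewrite inE/= in_itv/= u0/= => un.
    have n0 : (0 < n)%N by rewrite -(ltr0n R) (lt_trans u0).
    rewrite cabsM cabs_rpow// cabs_real reB ler_wpM2l ?powR_ge0//.
    rewrite ger0_norm ?expn1B_le ?(ltW un)// exprn_ge0// subr_ge0.
    by rewrite ler_pdivrMr ?mul1r ?ltW// ltr0n.
apply: eq_ccvg c => n n0; rewrite gauss_prodE//.
rewrite [LHS]cint_mkcond [RHS]cint_mkcond; apply: eq_cint => u _.
rewrite /F; case: ifPn => //; rewrite notin_setE /D/= in_itv/= andbT => /negP u0.
by case: ifPn => //; rewrite inE/= in_itv/= (negbTE u0).
Qed.

Lemma gauss_prodD1 n q : (0 < n)%N -> 0 < re q ->
  gauss_prod n (q + 1) = q * gauss_prod n q * (n%:R / (q + 1 + n%:R)).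
Proof.
move=> n0 q0; rewrite /gauss_prod rpowD rpow1 ?ltr0n// realC_nat.
rewrite big_ord_recr [in RHS]big_ord_recl/= addr0.
have -> : \prod_(i < n) (q + (bump 0 i)%:R) = \prod_(i < n) (q + 1 + i%:R).
  by apply: eq_bigr => i _; rewrite /bump/= add1n -natr1 addrAC addrA.
have q1 : 0 < re (q + 1) by rewrite reD ltr_wpDr//= ler01.
have nz : \prod_(i < n) (q + 1 + i%:R) != 0.
  by apply/prodf_neq0 => i _; exact: re_gt0_neq0.
have := re_gt0_neq0 n q1; have := re_gt0_neq0 0 q0; rewrite addr0.
by move=> h1 h2; field; rewrite h1 h2 nz.
Qed.

Lemma ccvg_natD (q p : R[i]) :
  ccvg (fun n => (q + n%:R) / (p + n%:R)) 1.
Proof.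
apply: ccvg_of_cabs.
have c0 : (2 * (cabs (q - p) / n%:R) : R) @[n --> \oo] --> (0 : R).
  rewrite -(mulr0 2); apply: cvgMr; rewrite -(mulr0 (cabs (q - p))); apply: cvgMr.
  by apply/gtr0_cvgV0; [near=> n; rewrite ltr0n; near: n; exact: nbhs_infty_gt|exact: cvgr_idn].
apply: (@squeeze_cvgr _ _ _ _ (fun=> 0) _ _ _ _ _ c0); last exact: cvg_cst.
near=> n.
have n0 : 0 < n%:R :> R by rewrite ltr0n; near: n; exact: nbhs_infty_gt.
have np : 2 * cabs p < n%:R by near: n; exact: nbhs_infty_gtr.
have h : n%:R / 2 <= cabs (p + n%:R).
  have := cabsB (p + n%:R) p; rewrite addrC addKr cabs_nat; lra.
have h0 : 0 < cabs (p + n%:R) by apply: lt_le_trans h; rewrite divr_gt0.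
have pn : p + n%:R != 0 by rewrite -cabs_gt0.
rewrite cabs_ge0/=.
have -> : (q + n%:R) / (p + n%:R) - 1 = (q - p) / (p + n%:R) by field.
rewrite cabsM cabsV mulrCA ler_wpM2l ?cabs_ge0//.
rewrite -[2]invrK -invfM lef_pV2 ?posrE ?mulr_gt0 ?invr_gt0//.
by rewrite mulrC.
Unshelve. all: by end_near. Qed.

(** Gauss's product satisfies the functional equation up to the factor n / (q + 1 + n), which tends
    to 1. *)
Lemma gamma_eulerD1 q : 0 < re q -> gamma_euler (q + 1) = q * gamma_euler q.
Proof.
move=> q0.
have q1 : 0 < re (q + 1) by rewrite reD ltr_wpDr//= ler01.
apply: ccvg_unique (gauss_limit q1) _.
have h := ccvgM (ccvgM (ccvg_cst q) (gauss_limit q0)) (ccvg_natD 0 (q + 1)).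
rewrite mulr1 in h; apply: eq_ccvg h => n n0.
by rewrite gauss_prodD1// add0r.
Qed.

End GaussProduct.

(** * Gamma and 1 / Gamma on the whole plane *)

Section GammaFunction.
Variable R : realType.
Implicit Types (q z : R[i]) (n k : nat).

Lemma cgamma_pos z : 0 < re z -> cgamma z = gamma_euler z.
Proof. by move=> z0; rewrite /cgamma z0 big_ord0 addr0 divr1. Qed.

(** Further steps of the continuation cancel by the functional equation, so any sufficient number of
    steps gives the same value; this allows z and z + 1 to be compared although their least numbers
    of steps may differ. *)
Lemma cgammaE n z : 0 < re z + n%:R ->
  cgamma z = gamma_euler (z + n%:R) / \prod_(i < n) (z + i%:R).
Proof.
have H k j : 0 < re z + k%:R ->
    gamma_euler (z + k%:R) / \prod_(i < k) (z + i%:R) =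
    gamma_euler (z + (k + j)%:R) / \prod_(i < (k + j)%N) (z + i%:R).
  move=> zk; elim: j => [|j ->]; first by rewrite addn0.
  have zj : 0 < re (z + (k + j)%:R) by rewrite reD re_nat natrD addrA ltr_wpDr.
  rewrite addnS -[(k + j).+1%:R]natr1 addrA gamma_eulerD1// big_ord_recr/= invfM.
  have := re_gt0_neq0 0 zj; rewrite addr0 => h.
  rewrite [X in _ = X * _]mulrC -!mulrA; congr (_ * _).
  by rewrite mulrCA divff// mulr1.
have [N zN ->] : exists2 N : nat, 0 < re z + N%:R & cgamma z =
    gamma_euler (z + N%:R) / \prod_(i < N) (z + i%:R).
  rewrite /cgamma; case: ifPn => [z0|]; first by exists 0%N; rewrite ?addr0.
  rewrite -leNgt => z0; eexists; last reflexivity.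
  by have := truncnS_gt (- re z); lra.
move=> zn; have [nN|Nn] := leqP n N.
  by rewrite (H n (N - n)%N zn) subnKC.
by rewrite (H N (n - N)%N zN) subnKC// ltnW.
Qed.

Lemma exists_nat_shift (x : R) : exists n : nat, 0 < x + n%:R.
Proof.
exists (Num.truncn `|x|).+1.
by have := truncnS_gt `|x|; have := ler_norm (- x); rewrite normrN; lra.
Qed.

(** In terms of the entire function 1 / Gamma the recurrence holds at the poles too, where both
    sides vanish. *)
Lemma rgammaD1 z : (cgamma z)^-1 = z * (cgamma (z + 1))^-1.
Proof.
have [n zn] := exists_nat_shift (re z).
have z1n : 0 < re (z + 1) + n%:R by rewrite reD /=; lra.
have zSn : 0 < re z + n.+1%:R by rewrite -natr1; lra.
rewrite (cgammaE zSn) (cgammaE z1n) !invf_div big_ord_recl/= addr0 mulrA.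
have -> : z + n.+1%:R = z + 1 + n%:R by rewrite -natr1 addrAC addrA.
congr (z * _ / _); apply: eq_bigr => i _.
by rewrite /bump/= add1n -natr1 addrAC addrA.
Qed.

Lemma cgammaD1 z : z != 0 -> cgamma (z + 1) = z * cgamma z.
Proof.
move=> z0; have := congr1 (@GRing.inv _) (rgammaD1 z).
by rewrite invrK invfM invrK => ->; rewrite mulrA divff// mul1r.
Qed.

Lemma rgamma_pole n : (cgamma (- n%:R : R[i]))^-1 = 0.
Proof.
elim: n => [|n IH]; first by rewrite rgammaD1 oppr0 mul0r.
by rewrite rgammaD1 -natr1 opprD addrNK IH mulr0.
Qed.

(** This is the effect of [n] ordinary derivatives on a power: the falling factorial of the exponent
    lowers the argument of 1 / Gamma by [n]. *)
Lemma rgamma_falling z n :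
  (cgamma (z + 1 - n%:R))^-1 = (cgamma (z + 1))^-1 * \prod_(i < n) (z - i%:R).
Proof.
elim: n => [|n IH]; first by rewrite big_ord0 subr0 mulr1.
have -> : z + 1 - n.+1%:R = z - n%:R by rewrite -natr1; ring.
rewrite rgammaD1 (_ : z - n%:R + 1 = z + 1 - n%:R); last by ring.
by rewrite IH big_ord_recr/=; ring.
Qed.

Lemma cgamma_rising z n : (forall i, (i < n)%N -> z + i%:R != 0) ->
  cgamma (z + n%:R) = cgamma z * \prod_(i < n) (z + i%:R).
Proof.
elim: n => [|n IH] zi; first by rewrite big_ord0 addr0 mulr1.
rewrite -natr1 addrA cgammaD1; last exact: zi.
rewrite IH; last by move=> i /ltnW; exact: zi.
by rewrite big_ord_recr/=; ring.
Qed.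

End GammaFunction.

(** * Bounds for products of the factors 1 + y^2 / (x + k)^2 *)

Section StirlingTelescope.
Variable R : realType.
Implicit Types (u x y : R) (n : nat).

(* An antiderivative of u |-> ln (1 + y^2 / u^2); its increments over unit intervals
   bound the logarithms of the factors of sine_prod, and they telescope. *)
Let Phi y u := u * ln (1 + y ^+ 2 / u ^+ 2) + 2 * y * atan (u / y).

Let d1 y u : 0 < 1 + y ^+ 2 / u ^+ 2.
Proof. by rewrite ltr_wpDr// divr_ge0 ?sqr_ge0. Qed.

Let is_derive_Phi y u : 0 < y -> 0 < u ->
  is_derive u 1 (Phi y) (ln (1 + y ^+ 2 / u ^+ 2)).
Proof.
move=> y0 u0.
have u2 : u ^+ 2 != 0 by rewrite expf_neq0// gt_eqF.
have hid : is_derive u 1 (id : R -> R) 1 by exact: is_derive_id.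
have hsq : is_derive u 1 (fun t : R => t ^+ 2) (2 * u).
  apply: is_derive_congr (is_deriveM hid hid) _ _ => //.
  by rewrite /GRing.scale/=; ring.
have hinv : is_derive u 1 (fun t : R => (t ^+ 2)^-1) (- (u ^+ 2) ^- 2 * (2 * u)).
  exact: (@is_deriveV _ (fun t : R => t ^+ 2)).
have harg : is_derive u 1 (fun t : R => 1 + y ^+ 2 * (t ^+ 2)^-1)
    (y ^+ 2 * (- (u ^+ 2) ^- 2 * (2 * u))).
  have hc : is_derive u 1 (fun=> 1 : R) (0 : R) by exact: is_derive_cst.
  apply: is_derive_congr (is_deriveD hc (is_deriveZ (y ^+ 2) hinv)) _ _ => //.
  by rewrite add0r.
have hln := @is_derive1_comp _ (@ln R) (fun t : R => 1 + y ^+ 2 * (t ^+ 2)^-1) u _ _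
  (is_derive1_ln (d1 y u)) harg.
have hdiv : is_derive u 1 (fun t : R => y^-1 * t) (y^-1).
  by apply: is_derive_congr (is_deriveZ y^-1 hid) _ _ => //; rewrite /GRing.scale/= mulr1.
have hat0 : is_derive (y^-1 * u) 1 (@atan R) ((1 + (y^-1 * u) ^+ 2)^-1).
  exact: is_derive1_atan.
have hat := @is_derive1_comp _ (@atan R) (fun t : R => y^-1 * t) u _ _ hat0 hdiv.
have := is_deriveD (is_deriveM hid hln) (is_deriveZ (2 * y) hat).
move=> h; apply: is_derive_congr h _ _ => [t|].
  by rewrite /Phi [t / y]mulrC.
rewrite /GRing.scale/=.
have : 1 + (y^-1 * u) ^+ 2 != 0 by rewrite gt_eqF// ltr_wpDr// sqr_ge0.
move=> hh; have dd : 1 + y ^+ 2 / u ^+ 2 != 0 by rewrite gt_eqF ?d1.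
have y0' : y != 0 by rewrite gt_eqF.
have u0' : u != 0 by rewrite gt_eqF.
rewrite [RHS](_ : _ = 0 + ln (1 + y ^+ 2 / u ^+ 2)); last by rewrite add0r.
rewrite mulr1 addrAC; congr (_ + _).
have e1 : u ^+ 2 + y ^+ 2 != 0 by rewrite gt_eqF// ltr_wpDr ?sqr_ge0// exprn_gt0.
have e2 : 1 + y ^+ 2 / u ^+ 2 = (u ^+ 2 + y ^+ 2) / u ^+ 2 by field.
have e3 : 1 + (y^-1 * u) ^+ 2 = (u ^+ 2 + y ^+ 2) / y ^+ 2 by field.
rewrite e2 e3; field.
by rewrite e1 y0' u0'.
Qed.

(** The mean value theorem writes the increment as ln (1 + y^2 / c^2) with c between u and u + 1,
    and this decreases in c. *)
Let step y u : 0 < y -> 0 < u ->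
  1 + y ^+ 2 / (u + 1) ^+ 2 <= expR (Phi y (u + 1) - Phi y u) <= 1 + y ^+ 2 / u ^+ 2.
Proof.
move=> y0 u0.
have D x : x \in `]u, u + 1[ -> is_derive x 1 (Phi y) (ln (1 + y ^+ 2 / x ^+ 2)).
  by rewrite in_itv/= => /andP[/(lt_trans u0) x0 _]; exact: is_derive_Phi.
have C : {within `[u, u + 1], continuous (Phi y)}.
  apply: derivable_within_continuous => t; rewrite in_itv/= => /andP[ut _].
  by have [] := is_derive_Phi y0 (lt_le_trans u0 ut).
have uu1 : u < u + 1 by rewrite ltrDl.
have [c] := MVT uu1 D C.
rewrite in_itv/= => /andP[uc cu] ->.
rewrite addrAC subrr add0r mulr1 lnK ?posrE//.
have c0 : 0 < c by exact: lt_trans uc.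
by rewrite !lerD2l !ler_wpM2l ?sqr_ge0// lef_pV2 ?posrE ?exprn_gt0 ?ltr_wpDr//
  ler_sqr ?nnegrE ?ltW// ltr_wpDr// ltW.
Qed.

Let prod_ge y x n : 0 < y -> 0 < x ->
  expR (Phi y (x + n%:R) - Phi y x) <= \prod_(k < n) (1 + y ^+ 2 / (x + k%:R) ^+ 2).
Proof.
move=> y0 x0; elim: n => [|n IH]; first by rewrite big_ord0 addr0 subrr expR0.
rewrite big_ord_recr/= -natr1 addrA.
have xn : 0 < x + n%:R by rewrite ltr_wpDr.
have /andP[_ h] := step y0 xn.
rewrite -(subrK (Phi y (x + n%:R)) (Phi y (x + n%:R + 1))) -addrA expRD mulrC.
by apply: ler_pM => //; exact: expR_ge0.
Qed.

Let prod_le y x n : 0 < y -> 0 < x ->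
  \prod_(k < n) (1 + y ^+ 2 / (x + k.+1%:R) ^+ 2) <= expR (Phi y (x + n%:R) - Phi y x).
Proof.
move=> y0 x0; elim: n => [|n IH]; first by rewrite big_ord0 addr0 subrr expR0.
have e : x + n.+1%:R = x + n%:R + 1 by rewrite -natr1 addrA.
rewrite big_ord_recr/= e.
have xn : 0 < x + n%:R by rewrite ltr_wpDr.
have /andP[h _] := step y0 xn.
have -> : Phi y (x + n%:R + 1) - Phi y x = (Phi y (x + n%:R) - Phi y x) +
  (Phi y (x + n%:R + 1) - Phi y (x + n%:R)) by ring.
rewrite expRD; apply: ler_pM => //; last exact: ltW.
by apply: prodr_ge0 => i _; exact: ltW.
Qed.

(** At x = 1 the infinite product is sinh (pi y) / (pi y), Euler's sine product at an imaginary
    point. By [cabs_gauss_prod_re] it measures how much smaller Gauss's product is at x + i y than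
    at x. *)
Definition sine_prod n x y := \prod_(k < n.+1) (1 + y ^+ 2 / (x + k%:R) ^+ 2).

Lemma sine_prod_norm n x y : sine_prod n x `|y| = sine_prod n x y.
Proof. by rewrite /sine_prod real_normK ?num_real. Qed.

Lemma sine_prod_ge1 n x y : 1 <= sine_prod n x y.
Proof.
rewrite /sine_prod; elim: n.+1 => [|k IH]; first by rewrite big_ord0.
by rewrite big_ord_recr/= mulr_ege1// lerDl divr_ge0 ?sqr_ge0.
Qed.

(** The telescoping upper bound pairs each factor with the preceding unit interval and so leaves out
    the one at k = 0, which appears separately. In [Phi] at x + n the logarithm contributes at most
    y^2 / (x + n) and the arctangent at most pi y, while [Phi] at x is nonnegative. *)
Lemma sine_prod_le n x y : 0 < x ->
  sine_prod n x y <=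
  (1 + y ^+ 2 / x ^+ 2) * expR (pi * `|y| + y ^+ 2 / (x + n%:R)).
Proof.
move=> x0; rewrite -sine_prod_norm -[y ^+ 2]real_normK ?num_real//.
have := normr_ge0 y; move: `|y| => {}y; rewrite le_eqVlt => /predU1P[<-|y0].
  rewrite mulr0 /sine_prod expr0n/= !mul0r !addr0 expR0 mulr1 big1// => i _.
  by rewrite mul0r addr0.
rewrite /sine_prod big_ord_recl/= addr0 ler_wpM2l//; first exact: ltW.
apply: (le_trans (prod_le n y0 x0)).
have P0 : 0 <= Phi y x.
  rewrite addr_ge0// mulr_ge0 ?ln_ge0 ?(ltW x0)//.
  - by rewrite lerDl divr_ge0 ?sqr_ge0.
  - by rewrite mulr_ge0// ltW.
  - by rewrite -(atan0 R) le_atan// divr_ge0// ltW.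
rewrite ler_expR.
have xn : 0 < x + n%:R by rewrite ltr_wpDr.
apply: (@le_trans _ _ (Phi y (x + n%:R))); first by rewrite gerBl.
rewrite /Phi [leRHS]addrC lerD//.
  have := @le_ln1Dx R (y ^+ 2 / (x + n%:R) ^+ 2).
  rewrite (lt_le_trans (ltrN10 R)) ?divr_ge0 ?sqr_ge0// => /(_ isT) h.
  apply: (le_trans (ler_wpM2l (ltW xn) h)).
  by rewrite le_eqVlt; apply/orP; left; apply/eqP; field; rewrite gt_eqF.
have := ltW (atan_ltpi2 ((x + n%:R) / y)).
move=> h; apply: (le_trans (ler_wpM2l _ h)); first by rewrite mulr_ge0// ltW.
by rewrite le_eqVlt; apply/orP; left; apply/eqP; field.
Qed.

(** The last factor bounds the exponential of [Phi] at x, by atan t <= t; at the upper end only the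
    arctangent term is kept, whose limit is pi y. *)
Lemma sine_prod_ge n x y : 0 < x -> 0 < y ->
  expR (2 * y * atan ((x + n.+1%:R) / y)) <=
  sine_prod n x y * (expR (2 * x) * (1 + y ^+ 2 / x ^+ 2) `^ x).
Proof.
move=> x0 y0.
have h := prod_ge n.+1 y0 x0.
have xn : 0 < x + n.+1%:R by rewrite ltr_wpDr.
apply: (@le_trans _ _ (expR (Phi y (x + n.+1%:R)))).
  rewrite ler_expR lerDr mulr_ge0 ?(ltW xn)// ln_ge0//.
  by rewrite lerDl divr_ge0 ?sqr_ge0.
rewrite -(subrK (Phi y x) (Phi y (x + n.+1%:R))) expRD.
apply: ler_pM => //; try exact: expR_ge0.
rewrite /powR (gt_eqF (d1 y x)) -expRD ler_expR [leRHS]addrC lerD2l.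
have e : 2 * x = 2 * y * (x / y) by field; rewrite gt_eqF.
rewrite e ler_wpM2l ?mulr_ge0 ?(ltW y0)//.
have [t0 t1] : 0 < x / y /\ True by split=> //; rewrite divr_gt0.
have D (t : R) : t \in `]0, x / y[ -> is_derive t 1 (@atan R) ((1 + t ^+ 2)^-1).
  by move=> _; exact: is_derive1_atan.
have C : {within `[0, x / y], continuous (@atan R)}.
  by apply: continuous_subspaceT => t; exact: continuous_atan.
have [c cI] := MVT t0 D C.
rewrite atan0 !subr0 => ->; rewrite ler_piMl ?(ltW t0)//.
by rewrite invf_le1 ?lerDl ?sqr_ge0// ltr_wpDr ?sqr_ge0.
Qed.

End StirlingTelescope.

(** * Growth and decay of Gamma on vertical lines *)

Section GammaBounds.
Variable R : realType.
Notation mu := (@lebesgue_measure R).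
Implicit Types (q : R[i]) (x y : R) (n : nat).

Lemma in_oo (a b u : R) : (u \in `]a, b[%classic) = (a < u < b).
Proof. by rewrite mem_setE in_itv. Qed.

Lemma realCB1 x : (x - 1)%:C = x%:C - 1. Proof. exact: realCB. Qed.

Lemma cabs_gauss_prod n q : (0 < n)%N -> cabs (gauss_prod n q) =
  n`!%:R * n%:R `^ re q / \prod_(k < n.+1) cabs (q + k%:R).
Proof.
move=> n0; rewrite /gauss_prod cabsM cabsV cabs_prod; congr (_ / _).
by rewrite cabsM cabs_nat cabs_rpow// ltr0n.
Qed.

(** The numerators have the same modulus, and |x + k + i y|^2 is (x + k)^2 times 1 + y^2 / (x +
    k)^2. *)
Lemma cabs_gauss_prod_re n q : 0 < re q ->
  cabs (gauss_prod n (re q)%:C) ^+ 2 =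
  cabs (gauss_prod n q) ^+ 2 * sine_prod n (re q) (im q).
Proof.
move=> q0; case: n => [|n].
  rewrite /gauss_prod /rpow ln0// !mulr0 !big_ord_recl !big_ord0 /sine_prod.
  rewrite big_ord_recl big_ord0 !mulr1 !addr0 cexp0 mulr1 !cabsM !cabsV cabs1 !mul1r.
  rewrite cabs_real !exprVn [in RHS]cabsE real_normK ?num_real//; field.
  rewrite gt_eqF//= gt_eqF// ltr_wpDr ?sqr_ge0// exprn_gt0//.
have S0 := lt_le_trans ltr01 (sine_prod_ge1 n.+1 (re q) (im q)).
have E : (\prod_(k < n.+2) cabs (q + k%:R)) ^+ 2 =
    (\prod_(k < n.+2) cabs ((re q)%:C + k%:R)) ^+ 2 * sine_prod n.+1 (re q) (im q).
  rewrite -!prodrXl -big_split/=; apply: eq_bigr => k _.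
  have xk : 0 < re q + k%:R by rewrite ltr_wpDr.
  rewrite cabsE !reD !imD re_nat im_nat addr0.
  rewrite -realC_nat -realCD cabs_real real_normK ?num_real//; field.
  by rewrite gt_eqF.
rewrite !cabs_gauss_prod//= !exprMn !exprVn E (invfM _ (sine_prod _ _ _)).
by rewrite -!mulrA mulVf ?mulr1// gt_eqF.
Qed.

Definition gamma_real x : R := \int[mu]_(u in `]0, +oo[) (u `^ (x - 1) * expR (- u)).

Lemma cabs_gauss_prod_le n q : (0 < n)%N -> 0 < re q ->
  cabs (gauss_prod n q) <= 2 * gamma_real (re q).
Proof.
move=> n0 q0; rewrite gauss_prodE//.
have mE : measurable (`]0, n%:R[%classic : set (measurableTypeR R)).
  exact: measurable_itv.
have mD : measurable (`]0, +oo[%classic : set (measurableTypeR R)).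
  exact: measurable_itv.
have sED : `]0, n%:R[%classic `<=` (`]0, +oo[%classic : set R).
  by apply: subset_itvl.
have iE := integrableS mD mE sED (integrable_gamma q0).
apply: (le_trans (cabs_cint_le mE _ iE _)).
- apply: cmeasM.
    apply: ccont_cmeas; first exact: itv_open.
    move=> u; rewrite /= in_itv/= => /andP[u0 un].
    exact: is_cder_ccont (is_cder_rpow _ u0).
  apply: cmeas_real; apply: measurable_funX; apply: measurable_funB => //.
  exact: measurable_funM.
- move=> u; rewrite /= in_itv/= => /andP[u0 un].
  rewrite cabsM cabs_rpow// cabs_real reB ler_wpM2l ?powR_ge0//.
  rewrite ger0_norm ?expn1B_le ?(ltW un)// exprn_ge0// subr_ge0.
  by rewrite ler_pdivrMr ?mul1r ?ltW// ltr0n.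
- rewrite ler_wpM2l// /gamma_real [leRHS]Rintegral_mkcond [leLHS]Rintegral_mkcond.
  apply: le_Rintegral => //.
  + by rewrite -restrict_EFin; exact/(integrable_mkcond _ mE).1.
  + by rewrite -restrict_EFin; apply: (integrable_mkcond _ mD).1; exact: integrable_gamma.
  + move=> u _; rewrite !patchE; case: ifPn => [|_].
      by rewrite inE => /sED uD; rewrite mem_set.
    by case: ifP => // _; rewrite mulr_ge0 ?powR_ge0 ?expR_ge0.
Qed.

Lemma gamma_real_ge0 x : 0 <= gamma_real x.
Proof. by apply: Rintegral_ge0 => u _; rewrite mulr_ge0 ?powR_ge0 ?expR_ge0. Qed.

(** u^(x - 1) is at most u^(x1 - 1) for u >= 1 and at most u^(x0 - 1) for u <= 1, which gives a
    bound uniform on a strip. *)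
Lemma gamma_real_le x x0 x1 : 0 < x0 -> x0 <= x -> x <= x1 ->
  gamma_real x <= gamma_real x0 + gamma_real x1.
Proof.
move=> x00 x0x xx1.
have mD : measurable (`]0, +oo[%classic : set (measurableTypeR R)).
  exact: measurable_itv.
have x0' := lt_le_trans x00 x0x; have x10 := lt_le_trans x0' xx1.
rewrite /gamma_real -RintegralD//; [|exact: integrable_gamma..].
apply: le_Rintegral => //; first exact: integrable_gamma.
  by apply: integrable_EFinD => //; exact: integrable_gamma.
move=> u; rewrite /= in_itv/= andbT => u0.
rewrite -mulrDl ler_wpM2r ?expR_ge0//.
have [u1|u1] := leP 1 u.
  rewrite ler_wpDl ?powR_ge0//; apply: ler_powR => //; lra.
by rewrite ler_wpDr ?powR_ge0//; apply: ger_powR; rewrite ?u0 ?(ltW u1)//; lra.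
Qed.

(** The left-hand side is the integral of u^(x - 1) (1 - u) over ]0, 1[, and 1 - u <= (1 - u/n)^n by
    Bernoulli's inequality. The bound does not depend on [n], so it survives the limit. *)
Lemma cabs_gauss_prod_ge n x : (0 < n)%N -> 0 < x ->
  (x * (x + 1))^-1 <= cabs (gauss_prod n x%:C).
Proof.
move=> n0 x0.
have mE : measurable (`]0, n%:R[%classic : set (measurableTypeR R)).
  exact: measurable_itv.
have mF : measurable (`]0, 1[%classic : set (measurableTypeR R)).
  exact: measurable_itv.
apply: le_trans (le_trans (ler_norm _) (re_le_cabs _)).
pose f (u : R) := u `^ (x - 1) * (1 - u).
pose g (u : R) := u `^ (x - 1) * (1 - u / n%:R) ^+ n.
have un1 (u : R) : 0 < u -> u < n%:R -> 0 <= 1 - u / n%:R.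
  by move=> u0 un; rewrite subr_ge0 ler_pdivrMr ?mul1r ?ltW// ltr0n.
have i1 : mu.-integrable `]0, 1[ (EFin \o f).
  have := integrable_beta x0 (ltr0n R 2) ltr01; apply: eq_integrable => // u.
  rewrite inE/= in_itv/= => /andP[u0 u1].
  by rewrite (_ : 2 - 1 = 1); [rewrite powRr1// subr_ge0 ltW|ring].
have g1 : mu.-integrable `]0, n%:R[ (EFin \o g).
  have sED : `]0, n%:R[%classic `<=` (`]0, +oo[%classic : set R).
    by apply: subset_itvl.
  have mD : measurable (`]0, +oo[%classic : set (measurableTypeR R)).
    exact: measurable_itv.
  have := integrableS mD mE sED (integrable_gamma x0).
  apply: le_integrable => //.
    apply/measurable_EFinP; apply: measurable_funM.
      by apply: measurable_funTS; exact: measurable_powR.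
    apply: measurable_funX; apply: measurable_funB => //; exact: measurable_funM.
  move=> u; rewrite /= in_itv/= => /andP[u0 un].
  have h0 := exprn_ge0 n (un1 u u0 un).
  rewrite lee_fin !ger0_norm ?mulr_ge0 ?powR_ge0 ?expR_ge0//.
  by rewrite ler_wpM2l ?powR_ge0// expn1B_le// ltW.
have -> : (x * (x + 1))^-1 = \int[mu]_(u in `]0, 1[) f u.
  transitivity (re (beta_integral x%:C 2 1)).
    rewrite (@beta_integral_nat _ x%:C 1 1)// (_ : 1`! = 1%N)// mul1r /rpow ln1 mulr0 cexp0 mul1r.
    have -> : \prod_(k < 2) (x%:C + k%:R) = (x * (x + 1))%:C :> R[i].
      by rewrite !big_ord_recl big_ord0 mulr1 /= addr0 realCM realCD.
    by rewrite -realCV.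
  apply: eq_Rintegral => u; rewrite in_oo => /andP[u0 u1].
  rewrite /beta_kernel -realCB1 !rpow_real// -!realCM /=.
  by rewrite (_ : 2 - 1 = 1); [rewrite powRr1// subr_ge0 ltW|ring].
have -> : re (gauss_prod n x%:C) = \int[mu]_(u in `]0, n%:R[) g u.
  rewrite gauss_prodE//; apply: eq_Rintegral => u; rewrite in_oo => /andP[u0 u1].
  by rewrite -realCB1 !rpow_real// -!realCM.
rewrite [leLHS]Rintegral_mkcond [leRHS]Rintegral_mkcond.
apply: le_Rintegral => //.
- by rewrite -restrict_EFin; exact/(integrable_mkcond _ mF).1.
- by rewrite -restrict_EFin; exact/(integrable_mkcond _ mE).1.
move=> u _; rewrite !patchE; case: ifPn => [|_].
  rewrite inE/= in_itv/= => /andP[u0 u1].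
  have un : u < n%:R by rewrite (lt_le_trans u1)// ler1n.
  rewrite mem_set/= ?in_itv/= ?u0// ler_wpM2l ?powR_ge0//.
  have := @bernoulli_ineq R (- (u / n%:R)) n.
  rewrite mulrN mulrCA divff ?mulr1 ?gt_eqF ?ltr0n//; apply.
  by rewrite lerN2 ler_pdivrMr ?mul1r ?ltW// ltr0n.
case: ifPn => //; rewrite inE/= in_itv/= => /andP[u0 un].
by rewrite mulr_ge0 ?powR_ge0// exprn_ge0// un1.
Qed.

(** Uniformity in [n] is the point: it excludes zeros of Gamma in the limit, and it dominates the
    approximations of 1 / Gamma on bounded rectangles, where the coarse term [im q ^+ 2 / x0] is
    harmless. *)
Lemma cabs_gauss_prodV_le n q x0 : (0 < n)%N -> 0 < x0 -> x0 <= re q ->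
  (cabs (gauss_prod n q))^-1 <= re q * (re q + 1) *
   ((1 + im q ^+ 2 / x0 ^+ 2) * expR (pi * `|im q| + im q ^+ 2 / x0)).
Proof.
move=> n0 x00 x0q.
have q0 := lt_le_trans x00 x0q.
have h := cabs_gauss_prod_re n q0.
have l := cabs_gauss_prod_ge n0 q0.
have xx : 0 < re q * (re q + 1) by rewrite mulr_gt0// ltr_wpDr.
have l0 : 0 < cabs (gauss_prod n (re q)%:C) by apply: lt_le_trans l; rewrite invr_gt0.
have s1 := sine_prod_ge1 n (re q) (im q).
have g0 : 0 < cabs (gauss_prod n q).
  rewrite lt_def cabs_ge0 andbT; apply: contra_ltN (exprn_gt0 2 l0) => /eqP g0.
  by rewrite h g0 expr0n/= mul0r.
have h2 : cabs (gauss_prod n (re q)%:C) <= cabs (gauss_prod n q) * sine_prod n (re q) (im q).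
  rewrite -ler_sqr ?nnegrE ?mulr_ge0 ?(ltW l0) ?(ltW g0)//; last by rewrite (le_trans ler01).
  rewrite h exprMn ler_wpM2l ?sqr_ge0// expr2 ler_peMl//.
  by rewrite (le_trans ler01).
have h3 := le_trans l h2.
apply: (@le_trans _ _ (re q * (re q + 1) * sine_prod n (re q) (im q))).
  move: h3; rewrite -(ler_pM2l xx) divff ?gt_eqF// => h3.
  by rewrite -(ler_pM2l g0) divff ?gt_eqF// mulrCA.
rewrite ler_wpM2l ?(ltW xx)//; apply: (le_trans (sine_prod_le _ _ q0)).
apply: ler_pM; rewrite ?expR_ge0 ?addr_ge0 ?divr_ge0 ?sqr_ge0//.
  by rewrite lerD2l ler_wpM2l ?sqr_ge0// lef_pV2 ?posrE ?exprn_gt0// ler_sqr ?nnegrE ?(ltW x00) ?(ltW q0).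
rewrite ler_expR lerD2l ler_wpM2l ?sqr_ge0// lef_pV2 ?posrE//; last by rewrite ltr_wpDr.
by rewrite (le_trans x0q)// lerDl.
Qed.

Lemma gauss_prod_neq0 n q : (0 < n)%N -> 0 < re q -> gauss_prod n q != 0.
Proof.
move=> n0 q0; rewrite /gauss_prod mulf_neq0 ?invr_eq0//.
  by rewrite mulf_neq0 ?rpow_neq0// -realC_nat realC_eq0 pnatr_eq0 -lt0n fact_gt0.
by apply/prodf_neq0 => i _; exact: re_gt0_neq0.
Qed.

Lemma cabs_gauss_limit q : 0 < re q ->
  cabs (gauss_prod n q) @[n --> \oo] --> cabs (gamma_euler q).
Proof. by move=> q0; exact: ccvg_cabs (gauss_limit q0). Qed.

Lemma cabs_gamma_le q : 0 < re q -> cabs (gamma_euler q) <= 2 * gamma_real (re q).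
Proof.
move=> q0.
apply: (ler_cvg_to (cabs_gauss_limit q0) (cvg_cst (2 * gamma_real (re q)))).
near=> n; apply: cabs_gauss_prod_le => //; near: n; exact: nbhs_infty_gt.
Unshelve. all: by end_near. Qed.

Lemma gamma_euler_real_ge x : 0 < x -> (x * (x + 1))^-1 <= cabs (gamma_euler x%:C).
Proof.
move=> x0; have q0 : 0 < re x%:C by [].
apply: (ler_cvg_to (cvg_cst ((x * (x + 1))^-1)) (cabs_gauss_limit q0)).
near=> n; apply: cabs_gauss_prod_ge => //; near: n; exact: nbhs_infty_gt.
Unshelve. all: by end_near. Qed.

Lemma gamma_euler_neq0 q : 0 < re q -> gamma_euler q != 0.
Proof.
move=> q0.
set M := re q * (re q + 1) * ((1 + im q ^+ 2 / re q ^+ 2) *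
  expR (pi * `|im q| + im q ^+ 2 / re q)).
have M0 : 0 < M by rewrite !mulr_gt0 ?expR_gt0// ltr_wpDr// divr_ge0 ?sqr_ge0.
rewrite -cabs_gt0; apply: (@lt_le_trans _ _ M^-1); first by rewrite invr_gt0.
apply: (ler_cvg_to (cvg_cst M^-1) (cabs_gauss_limit q0)).
near=> n; have n0 : (0 < n)%N by near: n; exact: nbhs_infty_gt.
rewrite -[leRHS]invrK lef_pV2 ?posrE ?invr_gt0 ?cabs_gt0 ?gauss_prod_neq0//.
exact: cabs_gauss_prodV_le.
Unshelve. all: by end_near. Qed.

Lemma cvg_sqr (u : nat -> R) (l : R) : u n @[n --> \oo] --> l ->
  u n ^+ 2 @[n --> \oo] --> l ^+ 2.
Proof. by move=> h; rewrite !expr2; apply: cvgM. Qed.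

Lemma cvg_xDn_atan x y : 0 < y ->
  expR (2 * y * atan ((x + n.+1%:R) / y)) @[n --> \oo] --> expR (pi * y).
Proof.
move=> y0; apply: (continuous_cvg _ (@continuous_expR R _)).
have -> : pi * y = 2 * y * (pi / 2) by field.
apply: cvgMr.
apply/cvgrPdist_lt => e e0; have /cvgrPdist_lt/(_ e e0)[M [_ hM]] := @cvgy_atan R.
near=> n; apply: hM; rewrite ltr_pdivlMr// -ltrBlDl -natr1.
have : M * y - x < n%:R by near: n; exact: nbhs_infty_gtr.
lra.
Unshelve. all: by end_near. Qed.

(** This is the limit of [sine_prod_ge], in which the arctangent tends to pi / 2. *)
Lemma gamma_decay_sqr q : 0 < re q ->
  cabs (gamma_euler q) ^+ 2 * expR (pi * `|im q|) <=
  cabs (gamma_euler (re q)%:C) ^+ 2 *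
    (expR (2 * re q) * (1 + im q ^+ 2 / re q ^+ 2) `^ re q).
Proof.
move=> q0; set E := expR (2 * re q) * _.
have E1 : 1 <= E.
  rewrite mulr_ege1//; first by rewrite -expR0 ler_expR mulr_ge0// ltW.
  apply: (@le_trans _ _ (1 `^ re q)); first by rewrite powR1.
  apply: ge0_ler_powR; rewrite ?nnegrE ?(ltW q0)//.
    by rewrite addr_ge0 ?divr_ge0 ?sqr_ge0.
  by rewrite lerDl divr_ge0 ?sqr_ge0.
have c1 := cabs_gauss_limit q0.
have c2 : cabs (gauss_prod n (re q)%:C) @[n --> \oo] --> cabs (gamma_euler (re q)%:C).
  exact: (cabs_gauss_limit (q := (re q)%:C)).
(* [sine_prod_ge] divides by y; on the real axis the claim reduces to 1 <= E. *)
have [y0|y0] := eqVneq (im q) 0.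
  have -> : q = (re q)%:C by apply: complexP => //=.
  by rewrite /= normr0 mulr0 expR0 mulr1 ler_peMr ?sqr_ge0.
have y0' : 0 < `|im q| by rewrite normr_gt0.
have c3 : cabs (gauss_prod n q) ^+ 2 * expR (2 * `|im q| * atan ((re q + n.+1%:R) / `|im q|))
    @[n --> \oo] --> cabs (gamma_euler q) ^+ 2 * expR (pi * `|im q|).
  exact: (cvgM (cvg_sqr c1) (cvg_xDn_atan _ y0')).
have c4 : cabs (gauss_prod n (re q)%:C) ^+ 2 * E @[n --> \oo] -->
    cabs (gamma_euler (re q)%:C) ^+ 2 * E.
  by apply: cvgMl; rewrite !expr2; apply: cvgM.
apply: (ler_cvg_to c3 c4); apply: nearW => n.
rewrite cabs_gauss_prod_re// -[leRHS]mulrA ler_wpM2l ?sqr_ge0//.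
apply: (le_trans (sine_prod_ge n q0 y0')).
by rewrite sine_prod_norm real_normK ?num_real.
Qed.

Lemma gamma_growth_sqr q : 0 < re q ->
  cabs (gamma_euler (re q)%:C) ^+ 2 <=
  cabs (gamma_euler q) ^+ 2 * ((1 + im q ^+ 2 / re q ^+ 2) * expR (pi * `|im q|)).
Proof.
move=> q0.
have c1 := cabs_gauss_limit q0.
have c2 : cabs (gauss_prod n (re q)%:C) @[n --> \oo] --> cabs (gamma_euler (re q)%:C).
  exact: (cabs_gauss_limit (q := (re q)%:C)).
have c3 : cabs (gauss_prod n q) ^+ 2 *
    ((1 + im q ^+ 2 / re q ^+ 2) * expR (pi * `|im q| + im q ^+ 2 / (re q + n%:R)))
    @[n --> \oo] --> cabs (gamma_euler q) ^+ 2 *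
    ((1 + im q ^+ 2 / re q ^+ 2) * expR (pi * `|im q|)).
  apply: (cvgM (cvg_sqr c1)).
  apply: cvgMr; apply: (continuous_cvg _ (@continuous_expR R _)).
  rewrite -[X in _ --> X]addr0; apply: cvgD; first exact: cvg_cst.
  rewrite -(mulr0 (im q ^+ 2)); apply: cvgMr; apply/gtr0_cvgV0.
    by apply: nearW => n; rewrite ltr_wpDr.
  apply/cvgryPge => M; near=> n.
  have : M - re q <= n%:R by near: n; exact: nbhs_infty_ger.
  lra.
have c4 : cabs (gauss_prod n (re q)%:C) ^+ 2 @[n --> \oo] -->
    cabs (gamma_euler (re q)%:C) ^+ 2.
  by rewrite !expr2; apply: cvgM.
apply: (ler_cvg_to c4 c3); apply: nearW => n.
by rewrite cabs_gauss_prod_re// ler_wpM2l ?sqr_ge0// sine_prod_le.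
Unshelve. all: by end_near. Qed.

Lemma poly_le_exp (e a K : R) : 0 < e -> 0 < a -> exists2 C : R, 1 <= C &
  forall y k, 0 <= y -> k <= K -> (1 + y / a) `^ k <= C * expR (e * y).
Proof.
move=> e0 a0; pose n := (Num.truncn `|K|).+1.
have n0 : 0 < n%:R :> R by rewrite ltr0n.
(* With this constant 1 + y/a <= D (1 + e y / n) <= D e^(e y / n), and the n-th power of this is the
   bound. *)
pose D := 1 + n%:R / (a * e).
have D1 : 1 <= D by rewrite lerDl divr_ge0// mulr_ge0 ?ltW.
exists (D ^+ n); first by rewrite exprn_ege1.
move=> y k y0 kK.
have y1 : 1 <= 1 + y / a by rewrite lerDl divr_ge0// ltW.
apply: (@le_trans _ _ ((1 + y / a) ^+ n)).
  rewrite -powR_mulrn ?(le_trans ler01)//; apply: ler_powR => //.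
  apply: (le_trans kK); apply: (le_trans (ler_norm _)).
  by rewrite ltW// truncnS_gt.
have -> : e * y = n%:R * (e / n%:R * y) by field; rewrite gt_eqF.
rewrite expRM_natl -exprMn lerXn2r ?nnegrE ?(le_trans ler01 y1)//.
  by rewrite mulr_ge0 ?expR_ge0 ?(le_trans ler01).
apply: (@le_trans _ _ (D * (1 + e / n%:R * y))); last first.
  by rewrite ler_wpM2l ?expR_ge1Dx ?(le_trans ler01).
have h : 0 <= e / n%:R * y by rewrite mulr_ge0// divr_ge0// ltW.
have -> : D * (1 + e / n%:R * y) = 1 + n%:R / (a * e) + e / n%:R * y + y / a.
  by rewrite /D; field; rewrite !gt_eqF.
have : 0 <= n%:R / (a * e) by rewrite divr_ge0// mulr_ge0 ?ltW.
lra.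
Qed.

(** Stirling's formula has a power of |im q| besides e^(- pi |im q| / 2); giving up [e] in the
    exponent absorbs that power uniformly on the strip. *)
Lemma gamma_vertical_bounds (e x0 x1 : R) : 0 < e -> 0 < x0 -> exists2 C : R, 0 < C &
  forall q, x0 <= re q -> re q <= x1 ->
    cabs (gamma_euler q) <= C * expR (- (pi / 2 - e) * `|im q|) /\
    (cabs (gamma_euler q))^-1 <= C * expR ((pi / 2 + e) * `|im q|).
Proof.
move=> e0 x00.
have [x01|x10] := leP x0 x1; last first.
  exists 1 => // q h1 h2; have := lt_le_trans x10 (le_trans h1 h2).
  by rewrite ltxx.
have x10 := lt_le_trans x00 x01.
(* Both claims are proved for squares. The decay then contains (1 + y^2/x^2)^x, at most (1 +
   y/x0)^(2 x), and the growth contains 1 + y^2/x^2, at most (1 + y/x0)^2; the former is absorbed at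
   rate e, the latter at rate 2 e. *)
have [C1 C11 hC1] := poly_le_exp (2 * x1) e0 x00.
have [C2 C21 hC2] := poly_le_exp 2 (mulr_gt0 (ltr0n R 2) e0) x00.
have C10 := lt_le_trans ltr01 C11; have C20 := lt_le_trans ltr01 C21.
pose G := 2 * (gamma_real x0 + gamma_real x1) + 1.
have G0 : 0 < G by rewrite ltr_wpDl// mulr_ge0// addr_ge0 ?gamma_real_ge0.
pose B1 := G * expR x1 * C1; pose B2 := x1 * (x1 + 1) * C2.
have B10 : 0 < B1 by rewrite /B1 !mulr_gt0 ?expR_gt0.
have B20 : 0 < B2 by rewrite /B2 !mulr_gt0// addr_gt0.
exists (B1 + B2); first by rewrite addr_gt0.
move=> q q0 q1.
have q0' := lt_le_trans x00 q0.
set y := `|im q|; have y0 : 0 <= y by exact: normr_ge0.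
have g0 : 0 < cabs (gamma_euler q) by rewrite cabs_gt0 gamma_euler_neq0.
have yx0 : 0 <= y / x0 by rewrite divr_ge0// ltW.
have key : 1 + im q ^+ 2 / re q ^+ 2 <= (1 + y / x0) ^+ 2.
  rewrite -real_normK ?num_real// -/y.
  apply: (@le_trans _ _ (1 + (y / x0) ^+ 2)); last by nra.
  rewrite lerD2l expr_div_n ler_wpM2l ?sqr_ge0//.
  by rewrite lef_pV2 ?posrE ?exprn_gt0// ler_sqr ?nnegrE ?(ltW x00) ?(ltW q0').
have key0 : 0 <= 1 + im q ^+ 2 / re q ^+ 2 by rewrite addr_ge0// divr_ge0 ?sqr_ge0.
have sq (a b : R) : 0 <= a -> 0 <= b -> a ^+ 2 <= b ^+ 2 -> a <= b.
  by move=> a0 b0; rewrite ler_sqr ?nnegrE.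
split.
- apply: (@le_trans _ _ (B1 * expR (- (pi / 2 - e) * y))); last first.
    by rewrite ler_wpM2r ?expR_ge0// lerDl ltW.
  apply: sq; rewrite ?cabs_ge0// ?(mulr_ge0 (ltW B10))// ?expR_ge0//.
  have d := gamma_decay_sqr q0'; rewrite -/y in d.
  rewrite -(ler_pM2r (expR_gt0 (pi * y))); apply: (le_trans d).
  have h1 : cabs (gamma_euler (re q)%:C) <= G.
    apply: (le_trans (cabs_gamma_le (q := (re q)%:C) q0')).
    apply: (@le_trans _ _ (2 * (gamma_real x0 + gamma_real x1))); last by rewrite lerDl.
    by rewrite ler_wpM2l// gamma_real_le.
  have h2 : expR (2 * re q) <= expR x1 ^+ 2.
    by rewrite -expRM_natl ler_expR ler_wpM2l.
  have h3 : (1 + im q ^+ 2 / re q ^+ 2) `^ re q <= C1 * expR (e * y).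
    apply: le_trans (hC1 y (2 * re q) y0 _); last by rewrite ler_wpM2l.
    rewrite powRrM powR_mulrn ?addr_ge0//.
    by apply: ge0_ler_powR; rewrite ?nnegrE ?(ltW q0')// exprn_ge0// addr_ge0.
  apply: (@le_trans _ _ (G ^+ 2 * (expR x1 ^+ 2 * (C1 * expR (e * y))))).
    apply: ler_pM; rewrite ?sqr_ge0 ?mulr_ge0 ?powR_ge0 ?expR_ge0//.
      by rewrite lerXn2r ?nnegrE ?cabs_ge0// ltW.
    by apply: ler_pM; rewrite ?powR_ge0 ?expR_ge0.
  have -> : (B1 * expR (- (pi / 2 - e) * y)) ^+ 2 * expR (pi * y) =
      G ^+ 2 * (expR x1 ^+ 2 * (C1 ^+ 2 * expR (2 * (e * y)))).
    have -> : expR (2 * (e * y)) = expR (- (pi / 2 - e) * y) ^+ 2 * expR (pi * y).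
      by rewrite -expRM_natl -expRD; congr expR; field.
    by rewrite /B1; ring.
  rewrite !ler_wpM2l ?sqr_ge0//; apply: ler_pM; rewrite ?expR_ge0 ?(ltW C10)//.
    by rewrite expr2 ler_peMr// ltW.
  by rewrite ler_expR; have : 0 <= e * y by [rewrite mulr_ge0// ltW]; lra.
- apply: (@le_trans _ _ (B2 * expR ((pi / 2 + e) * y))); last first.
    by rewrite ler_wpM2r ?expR_ge0// lerDr ltW.
  rewrite -[leLHS]mul1r ler_pdivrMr//.
  apply: sq; rewrite ?ler01// ?(mulr_ge0 (mulr_ge0 (ltW B20) _))// ?expR_ge0 ?cabs_ge0//.
  have g := gamma_growth_sqr q0'; rewrite -/y in g.
  have h1 : (x1 * (x1 + 1))^-1 <= cabs (gamma_euler (re q)%:C).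
    apply: le_trans (gamma_euler_real_ge q0').
    rewrite lef_pV2 ?posrE ?mulr_gt0 ?addr_gt0// ler_pM ?addr_ge0 ?(ltW q0')//.
    by rewrite lerD2r.
  have M0 : 0 < x1 * (x1 + 1) by rewrite mulr_gt0// addr_gt0.
  have h2 : 1 <= (x1 * (x1 + 1)) ^+ 2 * cabs (gamma_euler (re q)%:C) ^+ 2.
    rewrite -exprMn exprn_ege1//.
    by have := ler_wpM2l (ltW M0) h1; rewrite divff ?gt_eqF.
  have h3 : 1 + im q ^+ 2 / re q ^+ 2 <= C2 * expR (2 * e * y).
    apply: (le_trans key); have := hC2 y 2 y0 (lexx _).
    by rewrite powR_mulrn ?addr_ge0.
  rewrite expr1n; apply: (le_trans h2).
  have -> : (B2 * expR ((pi / 2 + e) * y) * cabs (gamma_euler q)) ^+ 2 =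
      (x1 * (x1 + 1)) ^+ 2 * (cabs (gamma_euler q) ^+ 2 *
       (C2 ^+ 2 * expR (2 * e * y) * expR (pi * y))).
    have : expR ((pi / 2 + e) * y) ^+ 2 = expR (2 * e * y) * expR (pi * y).
      by rewrite -expRM_natl -expRD; congr expR; field.
    by rewrite /B2 !exprMn => ->; ring.
  rewrite ler_wpM2l ?sqr_ge0//; apply: (le_trans g).
  rewrite ler_wpM2l ?sqr_ge0// ler_wpM2r ?expR_ge0//; apply: (le_trans h3).
  by rewrite ler_wpM2r ?expR_ge0// expr2 ler_peMr// ltW.
Qed.

End GammaBounds.

(** * Euler's formula for the Beta integral *)

Section BetaGamma.
Variable R : realType.
Notation mu := (@lebesgue_measure R).
Implicit Types (q : R[i]) (b x z : R) (n : nat).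

Lemma beta_integral_shift q b z n : 0 < re q -> 0 < b -> 0 < z ->
  (\prod_(k < n) (q + b%:C + k%:R)) * beta_integral q (b + n%:R) z =
  z%:C ^+ n * (\prod_(k < n) (b%:C + k%:R)) * beta_integral q b z.
Proof.
move=> q0 b0 z0; elim: n => [|n IH].
  by rewrite !big_ord0 addr0 expr0 !mul1r.
have bn : 0 < b + n%:R by rewrite ltr_wpDr.
have := beta_integral_rec q0 bn z0.
rewrite -addrA natr1 realCD addrA realC_nat => h.
rewrite !big_ord_recr/= -mulrA h realCM realCD realC_nat.
by rewrite mulrCA IH exprSr; ring.
Qed.

(** For large [n] the kernel concentrates at u = 0, where (z - u)^(b - 1) may be replaced by z^(b -
    1). With t = u / z the error is controlled by 0 <= (1 - t)^b - (1 - t) <= t, valid because b <=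
    1; the additional factor u raises re q by 1, which gains a factor of order 1/n. *)
Lemma beta_integral_gap q b z n : 0 < re q -> 0 < b -> b <= 1 -> 0 < z ->
  cabs (beta_integral q (b + n.+1%:R) z - (z `^ (b - 1))%:C * beta_integral q n.+2%:R z)
  <= 2 * (z `^ (b - 1) * re (beta_integral (re q + 1)%:C n.+1%:R z)).
Proof.
move=> q0 b0 b1 z0.
have mI : measurable (`]0, z[%classic : set (measurableTypeR R)).
  exact: measurable_itv.
have x1 : 0 < re q + 1 by rewrite addr_gt0.
have i1 := beta_kernel_intble q0 (ltr_wpDr (ler0n R n.+1) b0) z0.
have i2 := beta_kernel_intble q0 (ltr0n R n.+2) z0.
have i3 := integrable_beta x1 (ltr0n R n.+1) z0.
have i4 := integrable_EFinZ (z `^ (b - 1)) mI i3.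
have e3 : re (beta_integral (re q + 1)%:C n.+1%:R z) =
    \int[mu]_(u in `]0, z[) (u `^ (re q + 1 - 1) * (z - u) `^ (n.+1%:R - 1)).
  apply: eq_Rintegral => u; rewrite in_oo => /andP[u0 uz].
  by rewrite /beta_kernel -realCB1 rpow_real// -realCM.
rewrite e3 -RintegralZl// -(cintZ _ mI i2) -(cintB mI i1 (cintbleZ _ mI i2)).
apply: cabs_cint_le => //.
  by apply: cintble_meas; have := cintbleD mI i1 (cintbleZ (- (z `^ (b - 1))%:C) mI i2);
    apply: eq_cintble => // u _; rewrite mulNr.
move=> u; rewrite /= in_itv/= => /andP[u0 uz].
have zu : 0 < z - u by rewrite subr_gt0.
rewrite /beta_kernel mulrCA -mulrBr -realCM -realCB cabsM cabs_rpow// reB/= cabs_real.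
rewrite mulrCA addrK.
have -> : u `^ re q = u `^ (re q - 1) * u.
  by rewrite mulrC mulr_powRB1// ltW.
rewrite -mulrA ler_wpM2l ?powR_ge0//.
have -> : (z - u) `^ (b + n.+1%:R - 1) = (z - u) `^ b * (z - u) ^+ n.
  rewrite (_ : b + n.+1%:R - 1 = b + n%:R); last by rewrite -natr1; ring.
  by rewrite powRD ?(gt_eqF zu) ?implybT// powR_mulrn// ltW.
have -> : (z - u) `^ (n.+2%:R - 1) = (z - u) * (z - u) ^+ n.
  rewrite (_ : n.+2%:R - 1 = n.+1%:R); last by rewrite -natr1; ring.
  by rewrite powR_mulrn ?ltW// exprS.
have -> : (z - u) `^ (n.+1%:R - 1) = (z - u) ^+ n.
  rewrite (_ : n.+1%:R - 1 = n%:R); last by rewrite -natr1; ring.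
  by rewrite powR_mulrn ?ltW.
rewrite mulrA -mulrBl normrM [X in _ * X]ger0_norm ?exprn_ge0 ?(ltW zu)//.
rewrite mulrCA mulrA ler_wpM2r ?exprn_ge0 ?(ltW zu)//.
pose t := u / z.
have t0 : 0 < t by rewrite divr_gt0.
have t1 : t < 1 by rewrite ltr_pdivrMr// mul1r.
have -> : z - u = z * (1 - t) by rewrite /t; field; rewrite gt_eqF.
rewrite powRM ?subr_ge0 ?(ltW z0) ?(ltW t1)//.
have -> : z `^ b = z `^ (b - 1) * z by rewrite mulrC mulr_powRB1// ltW.
have -> : z `^ (b - 1) * z * (1 - t) `^ b - z `^ (b - 1) * (z * (1 - t)) =
  z `^ (b - 1) * (z * ((1 - t) `^ b - (1 - t))) by ring.
rewrite normrM ger0_norm ?powR_ge0// ler_wpM2l ?powR_ge0//.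
have ht : 1 - t <= (1 - t) `^ b.
  rewrite -[leLHS]powRr1 ?subr_ge0 ?(ltW t1)//; apply: ger_powR => //.
  by rewrite subr_gt0 t1 gerBl ltW.
have ht1 : (1 - t) `^ b <= 1.
  rewrite -[leRHS](powRr0 (1 - t)); apply: ger_powR; last exact: ltW.
  by rewrite subr_gt0 t1/= gerBl ltW.
rewrite normrM (gtr0_norm z0) ger0_norm ?subr_ge0//.
have -> : u = z * t by rewrite /t; field; rewrite gt_eqF.
by rewrite ler_pM2l//; lra.
Qed.

(* Both sides differ from the quotient of Gauss products by factors tending to 1. *)
Lemma beta_gammaE q b z : 0 < re q -> 0 < b -> b <= 1 -> 0 < z ->
  beta_integral q b z * gamma_euler (q + b%:C) =
  rpow z (q + b%:C - 1) * gamma_euler b%:C * gamma_euler q.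
Proof.
move=> q0 b0 b1 z0.
have qb0 : 0 < re (q + b%:C) by rewrite reD addr_gt0.
have x0 : 0 < re q + 1 by rewrite addr_gt0.
have zb0 := powR_gt0 (b - 1) z0.
have B0 n : (z `^ (b - 1))%:C * beta_integral q n.+2%:R z != 0.
  rewrite beta_integral_nat// mulf_neq0//; first by rewrite realC_eq0 gt_eqF.
  rewrite mulf_neq0//; last first.
    by rewrite invr_eq0; apply/prodf_neq0 => i _; exact: re_gt0_neq0.
  by rewrite mulf_neq0 ?rpow_neq0// pnatr_eq0 -lt0n fact_gt0.
(* By [beta_integral_gap] the distance of [r n] from 1 is at most 2 re q / (n + 1) times a
   convergent quotient of Gauss products. *)
pose r n := beta_integral q (b + n.+1%:R) z /
  ((z `^ (b - 1))%:C * beta_integral q n.+2%:R z).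
have r1 : ccvg r 1.
  apply: ccvg_of_cabs.
  have c0 : 2 * (re q / n.+1%:R * (cabs (gauss_prod n.+1 (re q)%:C) /
      cabs (gauss_prod n.+1 q))) @[n --> \oo] --> (0 : R).
    rewrite -(mulr0 2); apply: cvgMr.
    rewrite -(mul0r (cabs (gamma_euler (re q)%:C) / cabs (gamma_euler q))).
    apply: cvgM.
      by rewrite -(mulr0 (re q)); apply: cvgMr; exact: cvg_harmonic.
    apply: cvgM.
      rewrite (cvg_shiftS (fun n => cabs (gauss_prod n (re q)%:C))).
      exact: (cabs_gauss_limit (q := (re q)%:C)).
    apply: cvgV; first by rewrite cabs_eq0 gamma_euler_neq0.
    by rewrite (cvg_shiftS (fun n => cabs (gauss_prod n q))); exact: cabs_gauss_limit.
  apply: (@squeeze_cvgr _ _ _ _ (fun=> 0) _ _ _ _ _ c0); last exact: cvg_cst.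
  apply: nearW => n; rewrite cabs_ge0/=.
  have -> : r n - 1 = (beta_integral q (b + n.+1%:R) z -
    (z `^ (b - 1))%:C * beta_integral q n.+2%:R z) /
    ((z `^ (b - 1))%:C * beta_integral q n.+2%:R z).
    by rewrite mulrBl divff.
  rewrite cabsM cabsV ler_pdivrMr ?cabs_gt0//.
  apply: (le_trans (beta_integral_gap n q0 b0 b1 z0)).
  rewrite -[leRHS]mulrA ler_wpM2l// [cabs (_%:C * _)]cabsM [cabs (z `^ _)%:C]cabs_real.
  rewrite (gtr0_norm zb0) [leRHS]mulrCA ler_wpM2l ?(ltW zb0)//.
  rewrite le_eqVlt; apply/orP; left; apply/eqP.
  have -> : re (beta_integral (re q + 1)%:C n.+1%:R z) =
      n`!%:R * z `^ (re q + n.+1%:R) / \prod_(k < n.+1) (re q + k.+1%:R).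
    rewrite beta_integral_nat//.
    have -> : \prod_(k < n.+1) ((re q + 1)%:C + k%:R) =
        (\prod_(k < n.+1) (re q + k.+1%:R))%:C.
      rewrite (big_morph _ (@realCM R) (erefl _)); apply: eq_bigr => k _.
      by rewrite -realC_nat -realCD -natr1 addrAC addrA.
    rewrite -!realC_nat -realCD rpow_real// -!realCM -realCV -realCM/=.
    by rewrite -natr1 addrAC addrA.
  rewrite beta_integral_nat// cabsM cabsV cabs_prod cabsM cabs_nat cabs_rpow//.
  rewrite reD re_nat !cabs_gauss_prod//=.
  have -> : \prod_(k < n.+2) cabs ((re q)%:C + k%:R) =
      re q * \prod_(k < n.+1) (re q + k.+1%:R).
    rewrite big_ord_recl/= addr0 cabs_real gtr0_norm//; congr (_ * _).
    apply: eq_bigr => k _; rewrite -realC_nat -realCD cabs_real gtr0_norm//.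
    by rewrite ltr_wpDr.
  have p1 : \prod_(k < n.+1) (re q + k.+1%:R) != 0.
    by apply/prodf_neq0 => i _; rewrite gt_eqF// ltr_wpDr.
  have p2 : \prod_(k < n.+2) cabs (q + k%:R) != 0.
    by apply/prodf_neq0 => i _; rewrite cabs_eq0 re_gt0_neq0.
  have p3 : n.+1`!%:R != 0 :> R by rewrite pnatr_eq0 -lt0n fact_gt0.
  have p4 : n.+1%:R `^ re q != 0 :> R by rewrite gt_eqF// powR_gt0.
  have p5 : n.+1%:R != 0 :> R by rewrite pnatr_eq0.
  have -> : n`!%:R = n.+1`!%:R / n.+1%:R :> R.
    by rewrite factS natrM mulrC mulKf.
  field.
  by rewrite p1 p2 p3 p4 (gt_eqF q0) nat1r p5.
have bq : 0 < re (b%:C : R[i]) by [].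
have L := ccvgM (ccvgM (ccvgM (ccvgM (ccvg_cst (rpow z (q + b%:C - 1)))
  (ccvgS (gauss_limit bq))) (ccvgS (gauss_limit q0)))
  (ccvgS (ccvg_natD b%:C (q + b%:C)))) r1.
rewrite !mulr1 in L.
have L' := ccvgM (ccvg_cst (beta_integral q b z)) (ccvgS (gauss_limit qb0)).
(* The identity is exact for each [n], because [beta_integral_shift] relates the Beta integrals at b
   and at b + n + 1; only the last two factors on the left differ from 1, and both tend to it. *)
suff E n : rpow z (q + b%:C - 1) * gauss_prod n.+1 b%:C * gauss_prod n.+1 q *
    ((b%:C + n.+1%:R) / (q + b%:C + n.+1%:R)) * r n =
    beta_integral q b z * gauss_prod n.+1 (q + b%:C).
  by apply: (ccvg_unique L'); apply: eq_ccvg L => n _; rewrite E.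
have S := beta_integral_shift n.+1 q0 b0 z0.
have rE : beta_integral q (b + n.+1%:R) z =
    r n * ((z `^ (b - 1))%:C * beta_integral q n.+2%:R z) by rewrite divfK.
rewrite rE beta_integral_nat// in S.
have zN : z%:C ^+ n.+1 != 0 :> R[i] by rewrite expf_neq0// realC_eq0 gt_eqF.
have p1 : \prod_(k < n.+1) (b%:C + k%:R) != 0 :> R[i].
  by apply/prodf_neq0 => i _; exact: re_gt0_neq0.
have p2 : \prod_(k < n.+2) (q + k%:R) != 0.
  by apply/prodf_neq0 => i _; exact: re_gt0_neq0.
have p3 : \prod_(k < n.+1) (q + b%:C + k%:R) != 0.
  by apply/prodf_neq0 => i _; exact: re_gt0_neq0.
have p4 := re_gt0_neq0 n.+1 qb0.
have p5 := re_gt0_neq0 n.+1 bq.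
apply: (mulfI (mulf_neq0 zN p1)); rewrite [RHS]mulrA -S.
rewrite (rpowD z q n.+1%:R) rpow_nat// /gauss_prod.
have -> : (z `^ (b - 1))%:C = rpow z (b%:C - 1) by rewrite -realCB1 rpow_real.
have -> : rpow z (q + b%:C - 1) = rpow z q * rpow z (b%:C - 1).
  by rewrite -rpowD addrA.
rewrite (rpowD n.+1%:R q b%:C).
rewrite [\prod_(k < n.+2) (b%:C + _)]big_ord_recr/=.
rewrite [\prod_(k < n.+2) (q + b%:C + _)]big_ord_recr/=.
move: p1 p2 p3 p4 p5.
move: (\prod_(k < n.+1) (b%:C + _)) (\prod_(k < n.+2) (q + _)) => X1 X2.
move: (\prod_(k < n.+1) (q + b%:C + _)) (q + b%:C + n.+1%:R) (b%:C + n.+1%:R) => X3 X4 X5.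
move=> p1 p2 p3 p4 p5; field.
by rewrite p1 p2 p3 p4 p5.
Qed.

End BetaGamma.

(** * Superpositions of powers *)

Lemma mulf_cancel_aux (F : fieldType) (a z t f p : F) : z != 0 ->
  a * z * (t * f * (p / z)) = t * (a * f) * p.
Proof. by move=> z0; field. Qed.

Section PowerSuperposition.
Context d (T : measurableType d) (R : realType).
Variable mu : {sigma_finite_measure set T -> \bar R}.
Notation leb := (@lebesgue_measure R).
Implicit Types (Th c : T -> R[i]) (z b : R) (k n : nat).

(* Finiteness for every z > 0 gives bounds locally uniform in z, so that superp can
   be differentiated under the integral sign any number of times. *)
Definition admissible Th c : Prop :=
  [/\ cmeas setT Th, cmeas setT c &
   forall z k, 0 < z -> mu.-integrable setT
     (EFin \o (fun t => cabs (Th t) * (1 + cabs (c t)) ^+ k * z `^ re (c t)))].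

Definition superp Th c z : R[i] := cint mu setT (fun t => Th t * rpow z (c t)).

Let wt Th c z k t := cabs (Th t) * (1 + cabs (c t)) ^+ k * z `^ re (c t).

Let wt_ge0 Th c z k t : 0 <= wt Th c z k t.
Proof. by rewrite /wt !mulr_ge0 ?cabs_ge0 ?exprn_ge0 ?addr_ge0 ?cabs_ge0 ?powR_ge0. Qed.

Lemma cmeas_rpow z c : cmeas setT c -> cmeas setT (fun t => rpow z (c t)).
Proof. by move=> mc; apply: cmeas_cexp; apply: cmeasM => //; exact: cmeas_cst. Qed.

Lemma superp_intble Th c z : admissible Th c -> 0 < z ->
  cintble mu setT (fun t => Th t * rpow z (c t)).
Proof.
move=> [mT mc ad] z0; apply: (cintble_le measurableT _ (ad z 0%N z0)).
  by apply: cmeasM => //; exact: cmeas_rpow.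
by move=> t _; rewrite cabsM cabs_rpow// expr0 mulr1.
Qed.

(** The power [k] in [admissible] makes the class closed under weights of polynomial growth in [c]:
    a derivative contributes a factor [c], and the operator a polynomial in [c]. *)
Lemma admissible_le Th c Th' (s : R[i]) (C : R) j : admissible Th c ->
  cmeas setT Th' ->
  (forall t, cabs (Th' t) <= C * cabs (Th t) * (1 + cabs (c t)) ^+ j) ->
  admissible Th' (fun t => c t + s).
Proof.
move=> [mT mc ad] mT' hT'; split => //.
  by apply: cmeasD => //; exact: cmeas_cst.
move=> z k z0.
have := integrable_EFinZ (C * (1 + cabs s) ^+ k * z `^ re s) measurableT
  (ad z (j + k)%N z0).
apply: le_integrable => //.
  apply/measurable_EFinP; apply: measurable_funM.
    apply: measurable_funM; first exact: cmeas_cabs.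
    apply: measurable_funX; apply: measurable_funD => //.
    by apply: cmeas_cabs; apply: cmeasD => //; exact: cmeas_cst.
  apply: measurableT_comp; first exact: measurable_powRr.
  by have [] := cmeasD mc (cmeas_cst setT s).
move=> t _; rewrite lee_fin ger0_norm; last exact: (wt_ge0 Th' (fun t => c t + s)).
apply: (le_trans _ (ler_norm _)).
rewrite reD powRD; last by rewrite (gt_eqF z0) implybT.
have h1 : (1 + cabs (c t + s)) ^+ k <= (1 + cabs s) ^+ k * (1 + cabs (c t)) ^+ k.
  rewrite -exprMn lerXn2r ?nnegrE ?mulr_ge0 ?addr_ge0 ?cabs_ge0//.
  have := cabsD (c t) s; have := cabs_ge0 (c t); have := cabs_ge0 s; nra.
apply: (@le_trans _ _ ((C * cabs (Th t) * (1 + cabs (c t)) ^+ j) *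
   ((1 + cabs s) ^+ k * (1 + cabs (c t)) ^+ k) * (z `^ re (c t) * z `^ re s))).
  rewrite ler_wpM2r ?mulr_ge0 ?powR_ge0//.
  by apply: ler_pM; rewrite ?cabs_ge0 ?exprn_ge0 ?addr_ge0 ?cabs_ge0.
by rewrite exprD le_eqVlt; apply/orP; left; apply/eqP; ring.
Qed.

Lemma admissibleM Th c (P : T -> R[i]) (C : R) j : admissible Th c ->
  cmeas setT P -> (forall t, cabs (P t) <= C * (1 + cabs (c t)) ^+ j) ->
  admissible (fun t => Th t * P t) c.
Proof.
move=> ad mP hP.
have -> : c = (fun t => c t + 0) by apply/funext => t; rewrite addr0.
apply: (@admissible_le Th c _ 0 C j ad).
  by apply: cmeasM => //; case: ad.
by move=> t; rewrite cabsM [leRHS]mulrAC [leRHS]mulrC ler_wpM2l ?cabs_ge0.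
Qed.

Lemma admissibleZ (k : R[i]) Th c : admissible Th c -> admissible (fun t => k * Th t) c.
Proof.
move=> h; have := @admissibleM Th c (fun=> k) (cabs k) 0 h (cmeas_cst _ _) _.
have -> : (fun t => Th t * k) = (fun t => k * Th t) by apply/funext => t; rewrite mulrC.
by apply => t; rewrite expr0 mulr1.
Qed.

Lemma admissible_shift Th c (s : R[i]) : admissible Th c ->
  admissible Th (fun t => c t + s).
Proof.
move=> ad; apply: (@admissible_le Th c _ s 1 0 ad); first by case: ad.
by move=> t; rewrite expr0 mulr1 mul1r.
Qed.

(** For x in ]z / 2, 2 z[ the power of x is bounded by the sum of its values at the two ends,
    whatever the sign of the exponent, and admissibility at these two points makes the sum
    integrable. *)
Lemma superp_der Th c z : admissible Th c -> 0 < z ->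
  is_cder (superp Th c) z (superp (fun t => Th t * c t) (fun t => c t - 1) z).
Proof.
move=> ad z0; have [mT mc adi] := ad.
have z2 : 0 < z / 2 by rewrite divr_gt0.
have zz : 0 < 2 * z by rewrite mulr_gt0.
have adc : admissible (fun t => Th t * c t) (fun t => c t - 1).
  apply: admissible_shift; apply: (admissibleM (C := 1) (j := 1) ad) => // t.
  by rewrite mul1r expr1 lerDr.
have [mTc _ adci] := adc.
apply: (@is_cder_cint _ _ _ mu (fun x t => Th t * rpow x (c t))
  (fun x t => Th t * c t * rpow x (c t - 1)) z (z / 2) (2 * z)
  (fun t => wt (fun t => Th t * c t) (fun t => c t - 1) (z / 2) 0 t +
            wt (fun t => Th t * c t) (fun t => c t - 1) (2 * z) 0 t)).
- by rewrite in_itv/=; apply/andP; split; lra.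
- move=> x; rewrite in_itv/= => /andP[x1 _].
  by apply: superp_intble => //; exact: lt_trans x1.
- move=> x t; rewrite in_itv/= => /andP[x1 _].
  by rewrite -mulrA; apply: is_cderZ; apply: is_cder_rpow; exact: lt_trans x1.
- by apply: integrable_EFinD => //; exact: adci.
- move=> x t; rewrite in_itv/= => /andP[x1 x2].
  rewrite /wt expr0 mulr1 -mulrDr [leLHS]cabsM ler_wpM2l ?cabs_ge0//.
  rewrite cabs_rpow ?(lt_trans z2)//.
  by apply: powR_between => //; exact: ltW.
Qed.

Definition falling (c : T -> R[i]) n t : R[i] := \prod_(i < n) (c t - i%:R).

Lemma falling_admissible Th c n : admissible Th c ->
  admissible (fun t => Th t * falling c n t) (fun t => c t - n%:R).
Proof.
move=> ad; have [mT mc _] := ad; apply: admissible_shift.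
apply: (admissibleM (C := \prod_(i < n) (1 + i%:R)) (j := n) ad).
  by apply: cmeas_prod => i; apply: cmeasD => //; exact: cmeas_cst.
move=> t; rewrite /falling cabs_prod.
have -> : \prod_(i < n) (1 + i%:R) * (1 + cabs (c t)) ^+ n =
    \prod_(i < n) ((1 + i%:R) * (1 + cabs (c t))).
  by rewrite big_split/= prodr_const card_ord.
apply: ler_prod => i _; rewrite cabs_ge0/=.
have := cabsB (c t) i%:R; rewrite cabs_nat; have := cabs_ge0 (c t).
have := ler0n R i; nra.
Qed.

Lemma superp_chain Th c n z : admissible Th c -> 0 < z ->
  is_cder (superp (fun t => Th t * falling c n t) (fun t => c t - n%:R)) z
   (superp (fun t => Th t * falling c n.+1 t) (fun t => c t - n.+1%:R) z).
Proof.
move=> ad z0; apply: is_cder_eq (superp_der (falling_admissible n ad) z0) _.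
apply: eq_cint => t _.
rewrite /falling big_ord_recr/= mulrA; congr (_ * rpow _ _).
by rewrite -natr1 opprD addrA.
Qed.

Lemma superp_cdiffn Th c n : admissible Th c ->
  cdiffn n (superp Th c) /\ forall k, (k <= n)%N -> forall z, 0 < z ->
    cderiven k (superp Th c) z =
    superp (fun t => Th t * falling c k t) (fun t => c t - k%:R) z.
Proof.
move=> ad.
apply: (@cderiven_chain _ _ _ (fun k z =>
  superp (fun t => Th t * falling c k t) (fun t => c t - k%:R) z)).
  move=> z z0; apply: eq_cint => t _.
  by rewrite /falling big_ord0 mulr1 subr0.
by move=> k _ z z0; exact: superp_chain.
Qed.

Lemma superpZ (k0 : R[i]) Th c z : admissible Th c -> 0 < z ->
  superp (fun t => k0 * Th t) c z = k0 * superp Th c z.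
Proof.
move=> ad z0; rewrite -cintZ//; last exact: superp_intble.
by apply: eq_cint => t _; rewrite mulrA.
Qed.

(** The operator z^i d^i/dz^i multiplies z^x by the falling factorial of x, so the right-hand side
    is the multiplier of [euler_op]; the powers of [al] in the system turn the argument of the
    polynomial into x / al. *)
Lemma charpoly_horner (al : R) d' (a : nat -> R) (x : R[i]) : al != 0 ->
  (charpoly al d' a).[x / al%:C] =
  \sum_(0 <= i < d'.+1) (a i / al ^+ i)%:C * \prod_(j < i) (x - j%:R).
Proof.
move=> al0; rewrite /charpoly hornerD hornerC horner_sum [RHS]big_nat_recl//.
rewrite big_ord0 expr0 divr1 mulr1; congr (_ + _); rewrite big_add1/=.
apply: eq_bigr => i _; rewrite hornerZ horner_prod realCM -mulrA; congr (_ * _).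
have -> : ((al ^+ i.+1)^-1)%:C = \prod_(j < i.+1) (al%:C)^-1 :> R[i].
  by rewrite prodr_const card_ord realCV realCX exprVn.
rewrite big_mkord -big_split/=; apply: eq_bigr => j _.
by rewrite hornerD hornerN hornerC hornerX realCM realC_nat realCV -mulrBl mulrC.
Qed.

Lemma superp_euler_op (al : R) d' (a : nat -> R) Th c z : al != 0 ->
  admissible Th c -> 0 < z ->
  euler_op al d' a (superp Th c) z =
  superp (fun t => Th t * (charpoly al d' a).[c t / al%:C]) c z.
Proof.
move=> al0 ad z0; rewrite /euler_op.
have [_ dE] := superp_cdiffn d' ad.
transitivity (\sum_(0 <= i < d'.+1) cint mu setT
    (fun t => Th t * ((a i / al ^+ i)%:C * falling c i t) * rpow z (c t))).
  rewrite !big_mkord; apply: eq_bigr => i _; rewrite dE//; last by rewrite -ltnS.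
  rewrite -cintZ//; last exact: superp_intble (falling_admissible i ad) z0.
  apply: eq_cint => t _; rewrite rpowD rpowN rpow_nat// realCM realCX.
  have : z%:C ^+ i != 0 by rewrite expf_neq0// realC_eq0 gt_eqF.
  exact: mulf_cancel_aux.
have ii i : cintble mu setT
    (fun t => Th t * ((a i / al ^+ i)%:C * falling c i t) * rpow z (c t)).
  have := cintbleZ ((a i / al ^+ i * z ^+ i)%:C) measurableT
    (superp_intble (falling_admissible i ad) z0).
  apply: eq_cintble => // t _; rewrite rpowD rpowN rpow_nat// realCM realCX.
  have : z%:C ^+ i != 0 by rewrite expf_neq0// realC_eq0 gt_eqF.
  exact: mulf_cancel_aux.
have -> : superp (fun t => Th t * (charpoly al d' a).[c t / al%:C]) c z =
  cint mu setT (fun t => \sum_(0 <= i < d'.+1)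
    Th t * ((a i / al ^+ i)%:C * falling c i t) * rpow z (c t)).
  by apply: eq_cint => t _; rewrite charpoly_horner// mulr_sumr mulr_suml.
(* Integrability of the partial sums and additivity are carried through the same induction. *)
have [_ ->//] : cintble mu setT (fun t => \sum_(0 <= i < d'.+1)
    Th t * ((a i / al ^+ i)%:C * falling c i t) * rpow z (c t)) /\
  \sum_(0 <= i < d'.+1) cint mu setT
    (fun t => Th t * ((a i / al ^+ i)%:C * falling c i t) * rpow z (c t)) =
  cint mu setT (fun t => \sum_(0 <= i < d'.+1)
    Th t * ((a i / al ^+ i)%:C * falling c i t) * rpow z (c t)).
elim: d'.+1 => [|k [ik ek]].
  under eq_fun do rewrite big_nil; rewrite big_nil; split.
    by split; exact: integrable0.
  by apply: complexP; rewrite /= /Rintegral integral0.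
have e : (fun t => \sum_(0 <= i < k.+1)
    Th t * ((a i / al ^+ i)%:C * falling c i t) * rpow z (c t)) =
  (fun t => (\sum_(0 <= i < k)
    Th t * ((a i / al ^+ i)%:C * falling c i t) * rpow z (c t)) +
    Th t * ((a k / al ^+ k)%:C * falling c k t) * rpow z (c t)).
  by apply/funext => t; rewrite big_nat_recr.
rewrite e big_nat_recr//= ek -cintD//; split => //.
exact: cintbleD.
Qed.

End PowerSuperposition.

(** * Riemann-Liouville derivatives of superpositions *)

Section FractionalDerivative.
Context d (T : measurableType d) (R : realType).
Variable mu : {sigma_finite_measure set T -> \bar R}.
Notation leb := (@lebesgue_measure R).
Implicit Types (Th c : T -> R[i]) (z b : R) (k n : nat).

Lemma cmeas_gamma_euler (q : T -> R[i]) : cmeas setT q ->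
  (forall t, 0 < re (q t)) -> cmeas setT (fun t => gamma_euler (q t)).
Proof.
move=> mq q0; apply: (cmeas_cvg (F := fun n t => gauss_prod n (q t))).
  move=> n; apply: cmeasM.
    by apply: cmeasM; [exact: cmeas_cst|exact: cmeas_rpow].
  apply: cmeasV; apply: cmeas_prod => i; apply: cmeasD => //; exact: cmeas_cst.
by move=> t _; exact: gauss_limit.
Qed.

Lemma gamma_quotientE (q : R[i]) b z : 0 < re q -> 0 < b -> b <= 1 -> 0 < z ->
  (cgamma b%:C)^-1 * beta_integral q b z =
  rpow z (q + b%:C - 1) * (cgamma q / cgamma (q + b%:C)).
Proof.
move=> q0 b0 b1 z0.
have qb : 0 < re (q + b%:C) by rewrite reD addr_gt0.
have h := beta_gammaE q0 b0 b1 z0.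
rewrite !cgamma_pos//.
have g1 : gamma_euler (b%:C : R[i]) != 0 by apply: gamma_euler_neq0.
have g2 := gamma_euler_neq0 qb.
have -> : beta_integral q b z = rpow z (q + b%:C - 1) * gamma_euler b%:C *
  gamma_euler q / gamma_euler (q + b%:C) by rewrite -h mulfK.
by move: (rpow _ _) => X; field; rewrite g1 g2.
Qed.

(** By the Beta formula at z = 1 the quotient is 1 / Gamma(b) times the integral of u^q (1 - u)^(b -
    1), where |u^q| <= u^c0; the bound is therefore uniform in the imaginary part. *)
Lemma gamma_quotient_le (c0 b : R) : -1 < c0 -> 0 < b -> b <= 1 ->
  exists C : R, forall q : R[i], c0 <= re q ->
    cabs (cgamma (q + 1) / cgamma (q + 1 + b%:C)) <= C.
Proof.
move=> c1 b0 b1.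
have c10 : 0 < c0 + 1 by lra.
exists (cabs (cgamma (b%:C : R[i]))^-1 *
  (2 * \int[leb]_(u in `]0, 1[) (u `^ (c0 + 1 - 1) * (1 - u) `^ (b - 1)))).
move=> q qc.
have q0 : 0 < re (q + 1) by rewrite reD /=; lra.
have h := gamma_quotientE q0 b0 b1 ltr01.
have e1 : rpow 1 (q + 1 + b%:C - 1) = 1 :> R[i] by rewrite /rpow ln1 mulr0 cexp0.
rewrite e1 mul1r in h; rewrite -h cabsM ler_wpM2l ?cabs_ge0//.
have mI : measurable (`]0, 1[%classic : set (measurableTypeR R)).
  exact: measurable_itv.
apply: cabs_cint_le => //.
- exact: beta_kernel_meas.
- exact: integrable_beta.
move=> u; rewrite /= in_itv/= => /andP[u0 u1].
rewrite cabs_beta_kernel// ler_wpM2r ?powR_ge0// reD/= !addrK.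
by apply: ger_powR => //; rewrite u0 ltW.
Qed.

Definition frac_int_coef b c Th t : R[i] :=
  Th t * (cgamma (c t + 1) / cgamma (c t + 1 + b%:C)).

Lemma frac_int_admissible Th c b (c0 : R) : admissible mu Th c -> 0 < b -> b <= 1 ->
  -1 < c0 -> (forall t, c0 <= re (c t)) ->
  admissible mu (frac_int_coef b c Th) (fun t => c t + b%:C).
Proof.
move=> ad b0 b1 c1 c0c; have [mT mc _] := ad.
have [C hC] := gamma_quotient_le c1 b0 b1.
apply: admissible_shift; apply: (@admissibleM _ _ _ _ Th c _ C 0 ad).
  have q0 t : 0 < re (c t + 1) by rewrite reD /=; have := c0c t; lra.
  have qb t : 0 < re (c t + 1 + b%:C) by rewrite reD/= ltr_wpDr ?q0// ltW.
  have e : (fun t => cgamma (c t + 1) / cgamma (c t + 1 + b%:C)) =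
    (fun t => gamma_euler (c t + 1) / gamma_euler (c t + 1 + b%:C)).
    by apply/funext => t; rewrite !cgamma_pos.
  rewrite e; apply: cmeasM; last apply: cmeasV; apply: cmeas_gamma_euler => //.
    by apply: cmeasD => //; exact: cmeas_cst.
  by apply: cmeasD; [apply: cmeasD => //|]; exact: cmeas_cst.
by move=> t; rewrite expr0 mulr1; exact: hC.
Qed.

Lemma RL_integral_superp Th c b (c0 : R) z : admissible mu Th c -> 0 < b -> b <= 1 ->
  -1 < c0 -> (forall t, c0 <= re (c t)) -> 0 < z ->
  cintegrable `]0, z[%classic (fun u => ((z - u) `^ (b - 1))%:C * superp mu Th c u) /\
  RL_integral b (superp mu Th c) z =
  superp mu (frac_int_coef b c Th) (fun t => c t + b%:C) z.
Proof.
move=> ad b0 b1 c1 c0c z0; have [mT mc adi] := ad.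
have mI : measurable (`]0, z[%classic : set (measurableTypeR R)).
  exact: measurable_itv.
have c10 : 0 < c0 + 1 by lra.
pose w (u : measurableTypeR R) : R :=
  if u \in (`]0, z[%classic : set R) then (z - u) `^ (b - 1) else 0.
pose F (p : measurableTypeR R * T) : R[i] := (w p.1)%:C * (Th p.2 * rpow p.1 (c p.2)).
(* For u < z the power u^(re c) is at most (u/z)^c0 z^(re c). This separates the variables, and c0 >
   -1 makes the first factor integrable at 0. *)
pose g (u : measurableTypeR R) : R := w u * (u / z) `^ c0.
pose h (t : T) : R := cabs (Th t) * z `^ re (c t).
have mw : measurable_fun setT w.
  have := (measurable_restrictT (fun u : measurableTypeR R => (z - u) `^ (b - 1)) mI).1.
  rewrite /restrict => H.
  have -> : w = (fun u : measurableTypeR R => if u \in (`]0, z[%classic : set R)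
     then (z - u) `^ (b - 1) else point).
    by [].
  apply: H; apply: measurable_funTS.
  by apply: (measurableT_comp (measurable_powR _)); exact: measurable_funB.
have mF : cmeas setT F.
  apply: cmeasM.
    by apply: cmeas_real; exact: (measurableT_comp mw).
  apply: cmeasM.
    by split; [apply: (measurableT_comp mT.1)|apply: (measurableT_comp mT.2)].
  apply: cmeas_cexp; apply: cmeasM.
    by split; [apply: (measurableT_comp mc.1)|apply: (measurableT_comp mc.2)].
  by apply: cmeas_real; apply: measurableT_comp; [exact: measurable_ln|exact: measurable_fst].
have ig : leb.-integrable setT (EFin \o g).
  have := integrable_EFinZ (z `^ c0)^-1 mI (integrable_beta c10 b0 z0).
  move/(integrable_mkcond _ mI); apply: eq_integrable => // u _.
  rewrite /= patchE /g /w in_oo; case: ifPn => [/andP[u0 uz]|_]; last by rewrite mul0r.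
  congr EFin; rewrite addrK powRM ?invr_ge0 ?ltW//.
  have -> : z^-1 `^ c0 = (z `^ c0)^-1.
    by rewrite -(powR_inv1 (ltW z0)) -powRrM mulN1r powRN.
  by ring.
have ih : mu.-integrable setT (EFin \o h).
  by have := adi z 0%N z0; apply: eq_integrable => // t _; rewrite /= expr0 mulr1.
have Fgh u t : cabs (F (u, t)) <= g u * h t.
  rewrite /F /g /h /= cabsM /w in_oo; case: ifPn => [/andP[u0 uz]|_]; last first.
    by rewrite cabs0 !mul0r.
  rewrite cabs_real ger0_norm ?powR_ge0// -mulrA ler_wpM2l ?powR_ge0//.
  rewrite cabsM cabs_rpow// mulrCA ler_wpM2l ?cabs_ge0//.
  have -> : u `^ re (c t) = (u / z) `^ re (c t) * z `^ re (c t).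
    by rewrite -powRM ?divr_ge0 ?ltW// divfK// gt_eqF.
  rewrite ler_wpM2r ?powR_ge0//; apply: ger_powR => //.
  by rewrite divr_gt0//= ler_pdivrMr// mul1r ltW.
have [i1 _ e1] := cint_Fubini mF ig ih Fgh.
have inner u : 0 < u -> u < z -> cint mu setT (fun t => F (u, t)) =
    ((z - u) `^ (b - 1))%:C * superp mu Th c u.
  move=> u0 uz; rewrite /superp -cintZ//; last exact: superp_intble.
  by apply: eq_cint => t _; rewrite /F/= /w in_oo u0 uz.
have inner0 u : ~~ (0 < u < z) -> cint mu setT (fun t => F (u, t)) = 0.
  move=> uz; rewrite (_ : (fun t => F (u, t)) = fun=> 0).
    by apply: complexP; rewrite /= /Rintegral integral0.
  by apply/funext => t; rewrite /F/= /w in_oo (negbTE uz) mul0r.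
have outer u : cint mu setT (fun t => F (u, t)) =
    if u \in (`]0, z[%classic : set R) then
    ((z - u) `^ (b - 1))%:C * superp mu Th c u else 0.
  by rewrite in_oo; case: ifPn => [/andP[u0 uz]|]; [exact: inner|exact: inner0].
have outerE : (fun u : measurableTypeR R => cint mu setT (fun t => F (u, t))) =
    (fun u => if u \in (`]0, z[%classic : set R) then
    ((z - u) `^ (b - 1))%:C * superp mu Th c u else 0).
  by apply/funext => u; exact: outer.
rewrite outerE in i1 e1.
split; first exact/(cintble_mkcond _ _ mI).
rewrite /RL_integral -[cintegral _ _]/(cint leb _ _) cint_mkcond e1.
rewrite /superp -cintZ//; last first.
  rewrite -outerE in i1.
  by have [_ i2 _] := cint_Fubini mF ig ih Fgh.
apply: eq_cint => t _.
have ct0 : 0 < re (c t + 1) by rewrite reD /=; have := c0c t; lra.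
have -> : cint leb setT (fun u => F (u, t)) = Th t * beta_integral (c t + 1) b z.
  rewrite /beta_integral -cintZ//; last exact: beta_kernel_intble.
  rewrite [RHS]cint_mkcond; apply: eq_cint => u _.
  rewrite /F /w/= in_oo; case: ifPn => [/andP[u0 uz]|_]; last by rewrite mul0r.
  by rewrite /beta_kernel addrK; ring.
rewrite mulrCA gamma_quotientE// /frac_int_coef.
by rewrite (_ : c t + 1 + b%:C - 1 = c t + b%:C); ring.
Qed.

Definition frac_der_coef (al : R) c Th t : R[i] :=
  Th t * (cgamma (c t + 1) / cgamma (c t + 1 - al%:C)).

(* The second alternative of [has_RL_derivative], for a given n *)
Definition RL_derivative_at n (al : R) (f g : R -> R[i]) : Prop :=
  [/\ forall z : R, 0 < z ->
       cintegrable `]0, z[%classic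
         (fun s : R => ((z - s) `^ (n%:R - al - 1))%:C * f s),
     cdiffn n (RL_integral (n%:R - al) f) &
     forall z : R, 0 < z -> g z = cderiven n (RL_integral (n%:R - al) f) z].

(** The integral of order b = n - al raises the exponents by b and yields Gamma(c + 1) / Gamma(c + 1
    + b); [n] derivatives lower the argument of 1 / Gamma by n, which leaves c + 1 - al. *)
Lemma superp_RL_derivative_at n Th c (al c0 : R) : (0 < n)%N -> n%:R - 1 < al < n%:R ->
  admissible mu Th c -> -1 < c0 -> (forall t, c0 <= re (c t)) ->
  RL_derivative_at n al (superp mu Th c)
    (superp mu (frac_der_coef al c Th) (fun t => c t - al%:C)).
Proof.
move=> n0 /andP[na1 na2] ad c1 c0c.
have b0 : 0 < n%:R - al by lra.
have b1 : n%:R - al <= 1 by lra.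
have ad' := frac_int_admissible ad b0 b1 c1 c0c.
have [dS dE] := superp_cdiffn n ad'.
have E z : 0 < z -> superp mu (frac_int_coef (n%:R - al) c Th)
    (fun t => c t + (n%:R - al)%:C) z = RL_integral (n%:R - al) (superp mu Th c) z.
  by move=> z0; have [_ ->] := RL_integral_superp ad b0 b1 c1 c0c z0.
have [dI dIE] := cdiffn_congr E dS.
split.
- by move=> z z0; have [] := RL_integral_superp ad b0 b1 c1 c0c z0.
- exact: dI.
- move=> z z0; rewrite dIE// dE//; apply: eq_cint => t _.
  rewrite /frac_der_coef /frac_int_coef realCB realC_nat.
  have -> : c t + 1 - al%:C = (c t + (n%:R - al%:C)) + 1 - n%:R by ring.
  rewrite rgamma_falling /falling.
  have -> : c t + 1 + (n%:R - al%:C) = c t + (n%:R - al%:C) + 1 by ring.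
  have -> : c t + (n%:R - al%:C) - n%:R = c t - al%:C by ring.
  by rewrite !mulrA.
Qed.

Lemma superp_RL_derivative Th c (al c0 : R) : 0 < al -> admissible mu Th c ->
  -1 < c0 -> (forall t, c0 <= re (c t)) ->
  has_RL_derivative al (superp mu Th c)
    (superp mu (frac_der_coef al c Th) (fun t => c t - al%:C)).
Proof.
move=> al0 ad c1 c0c.
pose n := (Num.truncn al).+1.
have n0 : (0 < n)%N by [].
have := truncn_itv (ltW al0) => /andP[na na'].
(* An integer order is an ordinary derivative, whose falling factorial is again Gamma(c + 1) /
   Gamma(c + 1 - al). *)
have [e|ne] := eqVneq al (Num.truncn al)%:R.
  left; exists (Num.truncn al); have [dS dE] := superp_cdiffn (Num.truncn al) ad.
  split=> //; first by rewrite -(ltr0n R) -e.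
  move=> z z0; rewrite dE//; apply: eq_cint => t _.
  have alC : al%:C = (Num.truncn al)%:R :> R[i] by rewrite {1}e realC_nat.
  rewrite /frac_der_coef alC rgamma_falling.
  have g1 : cgamma (c t + 1) != 0.
    have ct0 : 0 < re (c t + 1) by rewrite reD /=; have := c0c t; lra.
    by rewrite cgamma_pos// gamma_euler_neq0.
  by rewrite [cgamma _ * _]mulrA divff// mul1r.
right; exists n.
have nal : n%:R - 1 < al < n%:R.
  rewrite na' andbT /n -natr1 addrK lt_def na andbT//.
have [h1 h2 h3] := superp_RL_derivative_at n0 nal ad c1 c0c.
by split.
Qed.

End FractionalDerivative.

(** * Shifting a line of integration *)

Section ContourShift.
Variable R : realType.
Notation leb := (@lebesgue_measure R).
Implicit Types (F G : R -> R -> R[i]) (x t T : R).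

Lemma ccontM (f g : R -> R[i]) x : ccont f x -> ccont g x -> ccont (fun t => f t * g t) x.
Proof.
move=> [f1 f2] [g1 g2]; split.
  have -> : (fun t => re (f t * g t)) = (fun t => re (f t) * re (g t) - im (f t) * im (g t)).
    by apply/funext => t; rewrite reM.
  by apply: cvgB; apply: cvgM.
have -> : (fun t => im (f t * g t)) = (fun t => re (f t) * im (g t) + im (f t) * re (g t)).
  by apply/funext => t; rewrite imM.
by apply: cvgD; apply: cvgM.
Qed.

Lemma ccontD (f g : R -> R[i]) x : ccont f x -> ccont g x -> ccont (fun t => f t + g t) x.
Proof.
move=> [f1 f2] [g1 g2]; split.
  have -> : (fun t => re (f t + g t)) = (fun t => re (f t) + re (g t)).
    by apply/funext => t; rewrite reD.
  exact: cvgD.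
have -> : (fun t => im (f t + g t)) = (fun t => im (f t) + im (g t)).
  by apply/funext => t; rewrite imD.
exact: cvgD.
Qed.

Lemma ccont_cst (k : R[i]) x : ccont (fun=> k) x.
Proof. by split; exact: cvg_cst. Qed.

Lemma is_cderV (f : R -> R[i]) x a : f x != 0 -> is_cder f x a ->
  is_cder (fun t => (f t)^-1) x (- a / f x ^+ 2).
Proof.
move=> fx0 [f1 f2].
have n0 : re (f x) ^+ 2 + im (f x) ^+ 2 != 0 by rewrite -cabsE expf_neq0// cabs_eq0.
have hN : is_derive x 1 (fun t => re (f t) * re (f t) + im (f t) * im (f t))
    (2 * (re (f x) * re a + im (f x) * im a)).
  apply: is_derive_congr (is_deriveD (is_deriveM f1 f1) (is_deriveM f2 f2)) _ _ => //.
  by rewrite /GRing.scale/=; ring.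
have n0' : re (f x) * re (f x) + im (f x) * im (f x) != 0 by rewrite -!expr2.
have hV := @is_deriveV _ (fun t => re (f t) * re (f t) + im (f t) * im (f t)) x _ 1 n0' hN.
split.
- apply: is_derive_congr (is_deriveM f1 hV) _ _ => [t|]; first by rewrite reV !expr2.
  rewrite /GRing.scale/= reM reN imN reV imV expr2 reM imM.
  move: n0'; rewrite -!expr2 => n0'; field; rewrite n0/=.
  by rewrite (_ : _ + _ = (re (f x) ^+ 2 + im (f x) ^+ 2) ^+ 2) ?expf_neq0//; ring.
- apply: is_derive_congr (is_deriveN (is_deriveM f2 hV)) _ _ => [t|].
    by rewrite imV !expr2.
  rewrite /GRing.scale/= imM reN imN reV imV expr2 reM imM.
  move: n0'; rewrite -!expr2 => n0'; field; rewrite n0/=.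
  by rewrite (_ : _ + _ = (re (f x) ^+ 2 + im (f x) ^+ 2) ^+ 2) ?expf_neq0//; ring.
Qed.

Variables (x0 x1 : R).

(* F x t stands for a holomorphic function of x + i t on the strip x0 < x < x1. *)
Definition strip_hol F : Prop := exists F' : R -> R -> R[i],
  [/\ forall x t, x \in `]x0, x1[ ->
        is_cder (F ^~ t) x (F' x t) /\ is_cder (F x) t ('i%C * F' x t),
      forall x t, x \in `]x0, x1[ -> ccont (F' x) t &
      forall T, exists M : R, forall x t, x \in `]x0, x1[ -> `|t| <= T ->
        cabs (F x t) <= M /\ cabs (F' x t) <= M].

Lemma strip_holM F G : strip_hol F -> strip_hol G -> strip_hol (fun x t => F x t * G x t).
Proof.
move=> [F' [dF cF bF]] [G' [dG cG bG]].
exists (fun x t => F' x t * G x t + F x t * G' x t); split.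
- move=> x t xI; have [f1 f2] := dF x t xI; have [g1 g2] := dG x t xI; split.
    exact: is_cderM f1 g1.
  by apply: is_cder_eq (is_cderM f2 g2) _; ring.
- move=> x t xI; have [_ f2] := dF x t xI; have [_ g2] := dG x t xI.
  by apply: ccontD; apply: ccontM; [exact: cF|exact: is_cder_ccont g2|
    exact: is_cder_ccont f2|exact: cG].
- move=> T; have [M1 h1] := bF T; have [M2 h2] := bG T.
  exists (M1 * M2 + M1 * M2) => x t xI tT.
  have [f1 f2] := h1 x t xI tT; have [g1 g2] := h2 x t xI tT.
  have M10 := le_trans (cabs_ge0 _) f1; have M20 := le_trans (cabs_ge0 _) g1.
  split.
    rewrite cabsM; apply: (@le_trans _ _ (M1 * M2)); last by rewrite lerDl mulr_ge0.
    by apply: ler_pM; rewrite ?cabs_ge0.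
  apply: (le_trans (cabsD _ _)); rewrite !cabsM.
  by apply: lerD; apply: ler_pM; rewrite ?cabs_ge0.
Qed.

Lemma is_cder_affine (k l : R[i]) x t :
  is_cder (fun y => k * (y +i* t) + l) x k /\
  is_cder (fun y => k * (x +i* y) + l) t ('i%C * k).
Proof.
have idR (y : R) : is_derive y 1 (fun u : R => u) 1 by exact: is_derive_id.
have cR (y c : R) : is_derive y 1 (fun=> c) (0 : R) by exact: is_derive_cst.
have h1 : is_cder (fun y => y +i* t) x 1 by split => /=; [exact: idR|exact: cR].
have h2 : is_cder (fun y => x +i* y) t 'i%C by split => /=; [exact: cR|exact: idR].
split.
- by apply: is_cder_eq (is_cderD (is_cderZ k h1) (is_cder_cst l x)) _; rewrite mulr1 addr0.
- by apply: is_cder_eq (is_cderD (is_cderZ k h2) (is_cder_cst l t)) _; rewrite addr0 mulrC.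
Qed.

Lemma cabs_affine_le (k l : R[i]) x t T : x \in `]x0, x1[ -> `|t| <= T ->
  cabs (k * (x +i* t) + l) <= cabs k * (`|x0| + `|x1| + T) + cabs l.
Proof.
rewrite in_itv/= => /andP[a1 a2] tT.
apply: (le_trans (cabsD _ _)); rewrite lerD2r cabsM ler_wpM2l ?cabs_ge0//.
apply: (le_trans (cabs_le_re_im _)) => /=; rewrite lerD//.
by rewrite ler_norml; have := ler_norm (- x0); have := ler_norm x1;
  rewrite normrN; have := normr_ge0 x0; have := normr_ge0 x1; lra.
Qed.

Lemma strip_hol_affine (k l : R[i]) : strip_hol (fun x t => k * (x +i* t) + l).
Proof.
exists (fun _ _ => k); split.
- by move=> x t _; exact: is_cder_affine.
- by move=> x t _; exact: ccont_cst.
- move=> T; exists (cabs k * (`|x0| + `|x1| + T) + cabs l + cabs k) => x t xI tT.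
  have h := cabs_affine_le k l xI tT; split.
    by apply: (le_trans h); rewrite lerDl cabs_ge0.
  by rewrite lerDr (le_trans _ h)// cabs_ge0.
Qed.

Lemma strip_hol_cexp (k l : R[i]) : strip_hol (fun x t => cexp (k * (x +i* t) + l)).
Proof.
exists (fun x t => k * cexp (k * (x +i* t) + l)); split.
- move=> x t _; have [h1 h2] := is_cder_affine k l x t; split.
    exact: is_cder_cexp h1.
  by apply: is_cder_eq (is_cder_cexp h2) _; rewrite mulrA.
- move=> x t _; have [_ h2] := is_cder_affine k l x t.
  by apply: ccontM; [exact: ccont_cst|exact: is_cder_ccont (is_cder_cexp h2)].
- move=> T; pose M := expR (cabs k * (`|x0| + `|x1| + T) + cabs l).
  exists (M + cabs k * M) => x t xI tT.
  have h : cabs (cexp (k * (x +i* t) + l)) <= M.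
    rewrite cabs_cexp ler_expR; apply: le_trans (cabs_affine_le k l xI tT).
    exact: le_trans (ler_norm _) (re_le_cabs _).
  have M0 : 0 <= M by exact: expR_ge0.
  split; first by apply: (le_trans h); rewrite lerDl mulr_ge0 ?cabs_ge0.
  by rewrite cabsM ler_wpDl// ler_wpM2l ?cabs_ge0.
Qed.

Lemma strip_hol_inv (k l : R[i]) (e : R) : 0 < e ->
  (forall x t, x \in `]x0, x1[ -> e <= cabs (k * (x +i* t) + l)) ->
  strip_hol (fun x t => (k * (x +i* t) + l)^-1).
Proof.
move=> e0 he.
have nz x t : x \in `]x0, x1[ -> k * (x +i* t) + l != 0.
  by move=> xI; rewrite -cabs_gt0 (lt_le_trans e0)// he.
exists (fun x t => - k / (k * (x +i* t) + l) ^+ 2); split.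
- move=> x t xI; have [h1 h2] := is_cder_affine k l x t; split.
    by apply: is_cderV => //; exact: nz.
  by apply: is_cder_eq (is_cderV (nz x t xI) h2) _; ring.
- move=> x t xI; have [_ h2] := is_cder_affine k l x t.
  have h3 := is_cder_ccont (is_cderV (nz x t xI) h2).
  have h4 := is_cderV (mulf_neq0 (nz x t xI) (nz x t xI)) (is_cderM h2 h2).
  have -> : (fun t => - k / (k * (x +i* t) + l) ^+ 2) =
    (fun t => - k * ((k * (x +i* t) + l) * (k * (x +i* t) + l))^-1).
    by apply/funext => y; rewrite expr2.
  by apply: ccontM; [exact: ccont_cst|exact: is_cder_ccont h4].
- move=> T; exists (e^-1 + cabs k * e ^- 2) => x t xI tT.
  have h := he x t xI.
  have h0 := lt_le_trans e0 h.
  split.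
    have h2 : 0 <= cabs k * e ^- 2 by rewrite mulr_ge0 ?cabs_ge0// invr_ge0 exprn_ge0// ltW.
    by rewrite cabsV ler_wpDr// lef_pV2 ?posrE.
  rewrite cabsM cabsN cabsV cabsX ler_wpDl ?invr_ge0 ?(ltW e0)//.
  rewrite ler_wpM2l ?cabs_ge0// lef_pV2 ?posrE ?exprn_gt0//.
  by rewrite lerXn2r ?nnegrE ?cabs_ge0 ?(ltW e0).
Qed.

Lemma strip_hol_prod (I : eqType) (r : seq I) (F : I -> R -> R -> R[i]) :
  (forall i, i \in r -> strip_hol (F i)) -> strip_hol (fun x t => \prod_(i <- r) F i x t).
Proof.
elim: r => [_|i r IH h].
  have := strip_hol_affine 0 1; congr strip_hol; apply/funext => x; apply/funext => t.
  by rewrite big_nil mul0r add0r.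
have := strip_holM (h i (mem_head _ _)) (IH (fun j hj => h j (mem_behead (s := i :: r) hj))).
by congr strip_hol; apply/funext => x; apply/funext => t; rewrite big_cons.
Qed.

Let mI (a b : R) : measurable (`]a, b[%classic : set (measurableTypeR R)).
Proof. exact: measurable_itv. Qed.

Lemma integrable_oo_cst (a b M : R) : leb.-integrable `]a, b[ (EFin \o (fun=> M)).
Proof.
apply: measurable_bounded_integrable => //.
- by rewrite /= lebesgue_measure_itv/=; case: ifP => _; rewrite ?ltry.
- exact: bounded_cst.
Qed.

Lemma Rintegral_oo_cst (a b M : R) : a <= b ->
  \int[leb]_(u in `]a, b[) M = M * (b - a).
Proof.
move=> ab; rewrite Rintegral_cst//= lebesgue_measure_itv/= lte_fin.
by case: ltgtP ab => // -> _; rewrite subrr.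
Qed.

Lemma strip_hol_slice F x T : strip_hol F -> x \in `]x0, x1[ ->
  cintble leb `]- T, T[ (F x).
Proof.
move=> [F' [dF cF bF]] xI; have [M hM] := bF T.
apply: (cintble_le (mI _ _) _ (integrable_oo_cst _ _ M)).
  apply: ccont_cmeas; first exact: itv_open.
  by move=> t _; have [_ h] := dF x t xI; exact: is_cder_ccont h.
move=> t; rewrite /= in_itv/= => /andP[t1 t2]; apply: (hM x t xI _).1.
by rewrite ler_norml !ltW.
Qed.

(** By the Cauchy-Riemann equations the x-derivative of the integrand is - i times its t-derivative,
    so the differentiated integral is a difference of boundary values. *)
Lemma strip_hol_der F T x : strip_hol F -> 0 < T -> x \in `]x0, x1[ ->
  is_cder (fun y => cint leb `]- T, T[ (F y)) x (- 'i%C * (F x T - F x (- T))).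
Proof.
move=> hF T0 xI; have [F' [dF cF bF]] := hF; have [M hM] := bF T.
pose P (H : R -> R -> R[i]) y (t : measurableTypeR R) : R[i] :=
  if t \in (`]- T, T[%classic : set R) then H y t else 0.
have tT t : t \in (`]- T, T[%classic : set R) -> `|t| <= T.
  by rewrite in_oo ler_norml => /andP[t1 t2]; rewrite !ltW.
have M0 : 0 <= M.
  have T0' : `|0 : R| <= T by rewrite normr0 ltW.
  by have [h _] := hM x 0 xI T0'; exact: le_trans (cabs_ge0 _) h.
have d : is_cder (fun y => cint leb setT (P F y)) x (cint leb setT (P F' x)).
  apply: (@is_cder_cint _ _ _ leb (P F) (P F') x x0 x1
    (fun t => if t \in (`]- T, T[%classic : set R) then M else 0)) => //.
  - move=> y yI; apply/(cintble_mkcond _ _ (mI _ _)); exact: strip_hol_slice.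
  - move=> y t yI; rewrite /P; case: ifP => _; first by have [] := dF y t yI.
    exact: is_cder_cst.
  - have := integrable_oo_cst (- T) T M; move/(integrable_mkcond _ (mI _ _)).
    by apply: eq_integrable => // t _; rewrite patchE /=; case: ifP.
  - move=> y t yI; rewrite /P; case: ifPn => [/tT tT'|]; last by rewrite cabs0.
    by have [] := hM y t yI tT'.
have e1 y : cint leb setT (P F y) = cint leb `]- T, T[ (F y).
  by rewrite [RHS]cint_mkcond.
have e2 : cint leb setT (P F' x) = - 'i%C * (F x T - F x (- T)).
  have iF' : cintble leb `]- T, T[ (F' x).
    apply: (cintble_le (mI _ _) _ (integrable_oo_cst _ _ M)).
      by apply: ccont_cmeas; [exact: itv_open|move=> t _; exact: cF].
    move=> t; rewrite /= in_itv/= => /andP[t1 t2]; apply: (hM x t xI _).2.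
    by rewrite ler_norml !ltW.
  have NT : - T < T by rewrite gtrN.
  have cont t : ccont (F x) t by have [_ h] := dF x t xI; exact: is_cder_ccont h.
  have lim0 t : cabs (F x s - F x t) @[s --> t] --> (0 : R).
    have [c1 c2] := cont t.
    have e0 : cabs (F x t - F x t) = 0 by rewrite subrr cabs0.
    rewrite -[X in _ --> X]e0.
    apply: (continuous_cvg _ (@sqrt_continuous R _)).
    apply: cvgD; rewrite !expr2; apply: cvgM;
      (under [X in X @ _ --> _]funext do rewrite ?reB ?imB);
      rewrite ?reB ?imB; by apply: cvgB => //; exact: cvg_cst.
  have <- : cint leb `]- T, T[ (fun t => 'i%C * F' x t) = F x T - F x (- T).
    apply: (@cFTC_oo _ _ (F x) _ _ _ _ NT).
    + by move=> t _; have [] := dF x t xI.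
    + by move=> t _; apply: ccontM; [exact: ccont_cst|exact: cF].
    + exact: cintbleZ.
    + by apply: cvg_at_right_filter; exact: lim0.
    + by apply: cvg_at_left_filter; exact: lim0.
  rewrite cintZ// mulrA mulNr -expr2 sqr_i opprK mul1r [RHS]cint_mkcond.
  by [].
rewrite -e2; have [d1 d2] := d; split.
- by apply: is_derive_congr d1 _ _ => // y; rewrite -e1.
- by apply: is_derive_congr d2 _ _ => // y; rewrite -e1.
Qed.

(** Integrating [strip_hol_der] over x gives Cauchy's theorem on the rectangle by the fundamental
    theorem of calculus alone. *)
Lemma strip_hol_rectangle F T a b : strip_hol F -> 0 < T -> a < b ->
  a \in `]x0, x1[ -> b \in `]x0, x1[ ->
  cint leb `]- T, T[ (F b) - cint leb `]- T, T[ (F a) =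
  cint leb `]a, b[ (fun x => - 'i%C * (F x T - F x (- T))).
Proof.
move=> hF T0 ab aI bI; have [F' [dF cF bF]] := hF.
have sub x : x \in `]a, b[ -> x \in `]x0, x1[.
  by move: aI bI; rewrite !in_itv/= => /andP[? ?] /andP[? ?] /andP[? ?]; apply/andP; split; lra.
have cont x t : x \in `]x0, x1[ -> ccont (F ^~ t) x.
  by move=> xI; have [h _] := dF x t xI; exact: is_cder_ccont h.
have contf x : x \in `]x0, x1[ -> ccont (fun x => - 'i%C * (F x T - F x (- T))) x.
  move=> xI; apply: ccontM; first exact: ccont_cst.
  apply: ccontD; first exact: cont.
  have -> : (fun t => - F t (- T)) = (fun t => (-1) * F t (- T)).
    by apply/funext => t; rewrite mulN1r.
  by apply: ccontM; [exact: ccont_cst|exact: cont].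
have lim0 x : x \in `]x0, x1[ ->
   cabs (cint leb `]- T, T[ (F s) - cint leb `]- T, T[ (F x)) @[s --> x] --> (0 : R).
  move=> xI; have [c1 c2] := is_cder_ccont (strip_hol_der hF T0 xI).
  have e0 : cabs (cint leb `]- T, T[ (F x) - cint leb `]- T, T[ (F x)) = 0.
    by rewrite subrr cabs0.
  rewrite -[X in _ --> X]e0.
  apply: (continuous_cvg _ (@sqrt_continuous R _)).
  apply: cvgD; rewrite !expr2; apply: cvgM;
    (under [X in X @ _ --> _]funext do rewrite ?reB ?imB);
    rewrite ?reB ?imB; by apply: cvgB => //; exact: cvg_cst.
symmetry; apply: (@cFTC_oo _ _ (fun x => cint leb `]- T, T[ (F x)) _ _ _ _ ab).
- by move=> x /sub; exact: strip_hol_der.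
- by move=> x /sub; exact: contf.
- have [M hM] := bF T.
  apply: (cintble_le (mI _ _) _ (integrable_oo_cst a b (M + M))).
    by apply: ccont_cmeas; [exact: itv_open|move=> x /sub; exact: contf].
  move=> x /sub xI; rewrite cabsM cabsN cabs_i mul1r.
  have h0 : `|T| <= T by rewrite gtr0_norm.
  have h1 : `|- T| <= T by rewrite normrN.
  by apply: (le_trans (cabsB _ _)); rewrite lerD// (hM x _ xI _).1.
- by apply: cvg_at_right_filter; exact: lim0.
- by apply: cvg_at_left_filter; exact: lim0.
Qed.

End ContourShift.

(** * Translation of a vertical line for limits of holomorphic functions *)

Section ContourShift.
Variable R : realType.
Notation leb := (@lebesgue_measure R).

Lemma integrable_oneDsqrV : leb.-integrable setT (EFin \o (fun t : R => (1 + t ^+ 2)^-1)).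
Proof.
have ge0 (t : R) : 0 <= (1 + t ^+ 2)^-1 by rewrite invr_ge0 addr_ge0// sqr_ge0.
apply/integrableP; split.
  apply/measurable_EFinP; apply: measurable_fun_inv_ge0 => [t|].
    by rewrite addr_ge0// sqr_ge0.
  by apply: measurable_funD => //; apply: measurable_funX.
under eq_integral do rewrite /= ger0_norm//.
rewrite ge0_symfun_integralT//; last 2 first.
- by move=> x; exact: (@continuous_oneDsqrV R).
- by move=> x /=; rewrite sqrrN.
have -> : (\int[leb]_(x in [set x | (0 <= x)%R]) ((1 + x ^+ 2)^-1)%:E
   = (pi / 2)%:E)%E.
  by rewrite -(integral0y_oneDsqr R) set_itvcy.
by rewrite -EFinM ltry.
Qed.

Let mI (a b : R) : measurable (`]a, b[%classic : set (measurableTypeR R)).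
Proof. exact: measurable_itv. Qed.

Variables (x0 x1 : R) (F : R -> R -> R[i]) (Fn : nat -> R -> R -> R[i]).
Hypothesis Fn_hol : forall n, strip_hol x0 x1 (Fn n).
Hypothesis Fn_cvg : forall x t, x \in `]x0, x1[ -> ccvg (fun n => Fn n x t) (F x t).
Hypothesis Fn_bound : forall T : R, exists M : R, forall n x t, x \in `]x0, x1[ ->
  `|t| <= T -> cabs (Fn n x t) <= M.

(** The rectangle identity contains no derivative, so it passes from the approximations [Fn] to
    their limit by bounded convergence on the sides. *)
Lemma lim_rectangle (T a b : R) : 0 < T -> a < b ->
  a \in `]x0, x1[ -> b \in `]x0, x1[ ->
  cint leb `]- T, T[ (F b) - cint leb `]- T, T[ (F a) =
  cint leb `]a, b[ (fun x => - 'i%C * (F x T - F x (- T))).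
Proof.
move=> T0 ab aI bI; have [M hM] := Fn_bound T.
have tT t : t \in `]- T, T[ -> `|t| <= T.
  by rewrite in_itv/= => /andP[? ?]; rewrite ler_norml !ltW.
have sub x : x \in `]a, b[ -> x \in `]x0, x1[.
  by move: aI bI; rewrite !in_itv/= => /andP[? ?] /andP[? ?] /andP[? ?]; apply/andP; split; lra.
have slice x : x \in `]x0, x1[ ->
    ccvg (fun n => cint leb `]- T, T[ (Fn n x)) (cint leb `]- T, T[ (F x)).
  move=> xI.
  apply: (cint_dct (mI _ _) _ _ (integrable_oo_cst _ _ M) _).2.
  - by move=> n; exact: cintble_meas (strip_hol_slice T (Fn_hol n) xI).
  - by move=> t _; exact: Fn_cvg.
  - by move=> n t /tT tT'; exact: hM.
have h1 := ccvgD (slice b bI) (ccvgN (slice a aI)).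
have TT : `|T| <= T by rewrite gtr0_norm.
have NTT : `|- T| <= T by rewrite normrN gtr0_norm.
have h2 : ccvg (fun n => cint leb `]a, b[ (fun x => - 'i%C * (Fn n x T - Fn n x (- T))))
   (cint leb `]a, b[ (fun x => - 'i%C * (F x T - F x (- T)))).
  apply: (cint_dct (mI _ _) _ _ (integrable_oo_cst _ _ (M + M)) _).2.
  - move=> n; have [F' [dF _ _]] := Fn_hol n.
    have cont x t : x \in `]x0, x1[ -> ccont (Fn n ^~ t) x.
      by move=> xI; have [h _] := dF x t xI; exact: is_cder_ccont h.
    apply: cmeasM; first exact: cmeas_cst.
    apply: cmeasD; last apply: cmeasN.
      by apply: ccont_cmeas; [exact: itv_open|move=> x /sub; exact: cont].
    by apply: ccont_cmeas; [exact: itv_open|move=> x /sub; exact: cont].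
  - move=> x /sub xI; apply: ccvgM; first exact: ccvg_cst.
    by apply: ccvgD; [exact: Fn_cvg|apply: ccvgN; exact: Fn_cvg].
  - move=> n x /sub xI; rewrite cabsM cabsN cabs_i mul1r.
    by apply: (le_trans (cabsB _ _)); rewrite lerD// hM.
apply: (ccvg_unique h1); move: h2; congr ccvg; apply/funext => n.
by rewrite -(strip_hol_rectangle (Fn_hol n)).
Qed.

(** The majorant C / (1 + t^2) serves twice: it is integrable along the vertical lines, and it makes
    the horizontal sides vanish as the height grows. *)
Lemma contour_shift (a b C : R) : a < b ->
  a \in `]x0, x1[ -> b \in `]x0, x1[ ->
  (forall x t, x \in `[a, b] -> cabs (F x t) <= C / (1 + t ^+ 2)) ->
  cint leb setT (F a) = cint leb setT (F b).
Proof.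
move=> ab aI bI hC.
have sub x : x \in `[a, b] -> x \in `]x0, x1[.
  by move: aI bI; rewrite !in_itv/= => /andP[? ?] /andP[? ?] /andP[? ?]; apply/andP; split; lra.
have C0 : 0 <= C.
  have := hC a 0; rewrite expr0n addr0 divr1 in_itv/= lexx (ltW ab) => /(_ isT).
  exact: le_trans (cabs_ge0 _).
have gint : leb.-integrable setT (EFin \o (fun t : R => C * (1 + t ^+ 2)^-1)).
  by apply: integrable_EFinZ => //; exact: integrable_oneDsqrV.
have measF x : x \in `]x0, x1[ -> cmeas setT (F x).
  move=> xI; apply: (@cmeas_cvg _ _ _ _ (fun n => Fn n x)) => [n|t _]; last exact: Fn_cvg.
  have [F' [dF _ _]] := Fn_hol n.
  apply: ccont_cmeas; first exact: openT.
  by move=> t _; have [_ h] := dF x t xI; exact: is_cder_ccont h.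
have lim x : x \in `[a, b] -> ccvg (fun n => cint leb `]- n.+1%:R, n.+1%:R[ (F x))
    (cint leb setT (F x)).
  move=> xI.
  pose G n t := if t \in (`]- n.+1%:R, n.+1%:R[%classic : set R) then F x t else 0.
  have -> : (fun n => cint leb `]- n.+1%:R, n.+1%:R[ (F x)) = (fun n => cint leb setT (G n)).
    by apply/funext => n; rewrite cint_mkcond.
  apply: (@cint_dct _ _ _ leb setT G (F x) (fun t => C * (1 + t ^+ 2)^-1) _ _ _ gint _).2 => //.
  - move=> n; have [m1 m2] := cmeasS (E := (`]- n.+1%:R, n.+1%:R[%classic : set (measurableTypeR R)))
      measurableT (@subsetT _ _) (measF x (sub x xI)).
    split.
      have := (measurable_restrictT _ (mI _ _)).1 m1; congr measurable_fun.
      by apply/funext => t; rewrite /G patchE; case: ifP.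
    have := (measurable_restrictT _ (mI _ _)).1 m2; congr measurable_fun.
    by apply/funext => t; rewrite /G patchE; case: ifP.
  - move=> t _; have e : \forall n \near \oo, F x t = G n t.
      near=> n; rewrite /G ifT// in_oo -ltr_norml.
      near: n; have := nbhs_infty_ger (`|t|); apply: filterS => n h.
      by rewrite (le_lt_trans h)// ltr_nat.
    split; (apply: cvg_near_cst; near=> n; congr (_ _); symmetry; near: n; exact: e).
  - move=> n t _; rewrite /G; case: ifP => _; first exact: hC.
    by rewrite cabs0 mulr_ge0// invr_ge0 addr_ge0// sqr_ge0.
apply/eqP; rewrite eq_sym -subr_eq0; apply/eqP.
have aab : a \in `[a, b] by rewrite in_itv/= lexx ltW.
have bab : b \in `[a, b] by rewrite in_itv/= lexx ltW.
have h1 := ccvgD (lim b bab) (ccvgN (lim a aab)).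
apply: (ccvg_unique h1); apply: ccvg_of_cabs.
(* The 4 is the factor 2 of [cabs_cint_le] times the two horizontal sides, on each of which [F] is
   at most C / (n + 1). *)
have bd n : cabs (cint leb `]- n.+1%:R, n.+1%:R[ (F b) -
    cint leb `]- n.+1%:R, n.+1%:R[ (F a) - 0) <= 4 * C * (b - a) * n.+1%:R^-1.
  rewrite subr0 lim_rectangle//.
  have bd1 x t : x \in `[a, b] -> `|t| = n.+1%:R -> cabs (F x t) <= C * n.+1%:R^-1.
    move=> xI tE; apply: (le_trans (hC x t xI)); rewrite ler_wpM2l//.
    have n1 : (1 : R) <= n.+1%:R by rewrite ler1n.
    rewrite -[t ^+ 2]real_normK ?num_real// tE.
    by rewrite lef_pV2 ?posrE; nra.
  have sub' x : x \in `]a, b[ -> x \in `[a, b].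
    by rewrite !in_itv/= => /andP[? ?]; rewrite !ltW.
  have := @cabs_cint_le _ _ _ leb `]a, b[%classic (fun x => - 'i%C * (F x n.+1%:R - F x (- n.+1%:R)))
    (fun=> C * n.+1%:R^-1 + C * n.+1%:R^-1) (mI _ _) _ (integrable_oo_cst _ _ _) _.
  rewrite (Rintegral_oo_cst _ (ltW ab)) => h; apply: (le_trans (h _ _)).
  - apply: cmeasM; first exact: cmeas_cst.
    have mx t : cmeas `]a, b[ (F ^~ t).
      apply: (@cmeas_cvg _ _ _ _ (fun n x => Fn n x t)) => [k|x /sub' /sub xI]; last exact: Fn_cvg.
      have [F' [dF _ _]] := Fn_hol k.
      apply: ccont_cmeas; first exact: itv_open.
      by move=> x /sub' /sub xI; have [h' _] := dF x t xI; exact: is_cder_ccont h'.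
    by apply: cmeasD; [exact: mx|apply: cmeasN; exact: mx].
  - move=> x /sub' xI; rewrite cabsM cabsN cabs_i mul1r.
    by apply: (le_trans (cabsB _ _)); rewrite lerD// bd1 ?normrN// ger0_norm.
  - by rewrite le_eqVlt; apply/orP; left; apply/eqP; ring.
apply: (@squeeze_cvgr _ _ _ _ (fun=> 0) (fun n => 4 * C * (b - a) * n.+1%:R^-1)).
- by near=> n; rewrite cabs_ge0/= bd.
- exact: cvg_cst.
- by rewrite -[X in _ --> X](mulr0 (4 * C * (b - a))); apply: cvgMr; exact: cvg_harmonic.
Unshelve. all: by end_near. Qed.

End ContourShift.

(** * Mellin-Barnes integrals *)

Section FoxKernel.
Variable R : realType.
Notation leb := (@lebesgue_measure R).

(** The integrand of the H-function without the power w^s; the parameter (1, 2 al) of the upper list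
    yields the Gamma function in the denominator. *)
Definition fox_kernel (al : R) (bs : seq R[i]) (s : R[i]) : R[i] :=
  (\prod_(b <- bs) cgamma (b - s)) / cgamma (1 - (2 * al)%:C * s).

Lemma re_affineN (b : R[i]) x t : re (b - (x +i* t)) = re b - x.
Proof. by rewrite reB. Qed.

Lemma im_affineN (b : R[i]) x t : im (b - (x +i* t)) = im b - t.
Proof. by rewrite imB. Qed.

Lemma re_affineM (k : R) (x t : R) : re (1 - k%:C * (x +i* t)) = 1 - k * x.
Proof. by rewrite reB reM/= mul0r subr0. Qed.

Lemma im_affineM (k : R) (x t : R) : im (1 - k%:C * (x +i* t)) = - (k * t).
Proof. by rewrite imB imM/= mul0r addr0 sub0r. Qed.

(** On the strip all arguments have real part at least 1, so they are values of Euler's integral;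
    the imaginary parts of the parameters only cost a constant factor. *)
Lemma prod_gamma_decay (bs : seq R[i]) (x0 x1 e : R) : 0 < e -> e < pi / 2 ->
  (forall b, b \in bs -> x1 + 1 <= re b) ->
  exists2 C : R, 0 < C & forall x t, x \in `]x0, x1[ ->
    cabs (\prod_(b <- bs) cgamma (b - (x +i* t))) <=
    C * expR (- ((pi / 2 - e) * (size bs)%:R * `|t|)).
Proof.
move=> e0 e1; elim: bs => [|b bs IH] hb.
  exists 1 => // x t _; rewrite big_nil cabs1/= mulr0 mul0r oppr0 expR0 mulr1//.
have [C C0 hC] := IH (fun b' h => hb b' (mem_behead (s := b :: bs) h)).
have [C' C'0 hC'] := gamma_vertical_bounds (re b - x0) e0 (ltr01 : 0 < (1 : R)).
exists (C' * expR ((pi / 2 - e) * `|im b|) * C).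
  by rewrite !mulr_gt0// expR_gt0.
move=> x t xI; have := xI; rewrite in_itv/= => /andP[xx0 xx1].
have hbb := hb b (mem_head _ _).
have r0 : 1 <= re (b - (x +i* t)) by rewrite re_affineN; lra.
have r1 : re (b - (x +i* t)) <= re b - x0 by rewrite re_affineN; lra.
have [h _] := hC' _ r0 r1.
rewrite big_cons cabsM cgamma_pos ?(lt_le_trans _ r0)//.
have -> : C' * expR ((pi / 2 - e) * `|im b|) * C * expR (- ((pi / 2 - e) * (size (b :: bs))%:R * `|t|)) =
  (C' * expR ((pi / 2 - e) * (`|im b| - `|t|))) * (C * expR (- ((pi / 2 - e) * (size bs)%:R * `|t|))).
  transitivity (C' * C * (expR ((pi / 2 - e) * `|im b|) *
      expR (- ((pi / 2 - e) * (size (b :: bs))%:R * `|t|)))); first by ring.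
  transitivity (C' * C * (expR ((pi / 2 - e) * (`|im b| - `|t|)) *
      expR (- ((pi / 2 - e) * (size bs)%:R * `|t|)))); last by ring.
  by rewrite -!expRD; congr (_ * expR _); rewrite /= -[in LHS]natr1; ring.
apply: ler_pM; rewrite ?cabs_ge0//; last exact: hC.
apply: (le_trans h); rewrite ler_pM2l// ler_expR mulNr -mulrN ler_wpM2l ?subr_ge0 ?(ltW e1)//.
rewrite im_affineN; have := ler_normB (im b) (im b - t).
by rewrite opprB addrC subrK; lra.
Qed.

Variables (al : R) (bs : seq R[i]) (x0 x1 : R).
Hypothesis al0 : 0 < al.
Hypothesis al_bs : 2 * al < (size bs)%:R.
Hypothesis x10 : x1 <= 0.
Hypothesis x1bs : forall b, b \in bs -> x1 + 1 <= re b.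

Lemma fox_kernel_decay : exists C d : R, [/\ 0 < C, 0 < d & forall x t, x \in `]x0, x1[ ->
  cabs (fox_kernel al bs (x +i* t)) <= C * expR (- (d * `|t|))].
Proof.
have al0' : 0 < al := al0; have x10' : x1 <= 0 := x10.
have pi0 : 0 < pi :> R by exact: pi_gt0.
have [m albs mE] : exists2 m : R, 2 * al < m & m = (size bs)%:R by exists (size bs)%:R.
(* The net rate of decay is (pi/2) (m - 2 al) - e (m + 2 al); this [e] gives up exactly half of the
   first term. *)
pose e : R := pi * (m - 2 * al) / (4 * (m + 2 * al)).
have m0 : 0 < m + 2 * al by lra.
have e0 : 0 < e by rewrite divr_gt0 ?mulr_gt0//; lra.
have e1 : e < pi / 2.
  rewrite ltr_pdivrMr ?mulr_gt0//; nra.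
have [C1 C10] := prod_gamma_decay x0 e0 e1 x1bs; rewrite -mE => h1.
have [C2 C20 h2] := gamma_vertical_bounds (1 - 2 * al * x0) e0 (ltr01 : 0 < (1 : R)).
exists (C1 * C2), (pi / 4 * (m - 2 * al)); split.
- by rewrite mulr_gt0.
- by rewrite mulr_gt0//; lra.
move=> x t xI; have := xI; rewrite in_itv/= => /andP[xx0 xx1].
have r0 : 1 <= re (1 - (2 * al)%:C * (x +i* t)) by rewrite re_affineM; nra.
have r1 : re (1 - (2 * al)%:C * (x +i* t)) <= 1 - 2 * al * x0 by rewrite re_affineM; nra.
have [_ h] := h2 _ r0 r1.
rewrite /fox_kernel cabsM cabsV [cgamma (1 - _)]cgamma_pos ?(lt_le_trans _ r0)//.
have -> : C1 * C2 * expR (- (pi / 4 * (m - 2 * al) * `|t|)) =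
  (C1 * expR (- ((pi / 2 - e) * m * `|t|))) * (C2 * expR ((pi / 2 + e) * (2 * al * `|t|))).
  rewrite [RHS]mulrACA -expRD; congr (_ * expR _).
  by rewrite /e; field; rewrite gt_eqF.
apply: ler_pM; rewrite ?cabs_ge0 ?invr_ge0 ?cabs_ge0//; first exact: h1.
apply: (le_trans h); rewrite im_affineM normrN normrM ger0_norm//.
by rewrite mulr_ge0// ltW.
Qed.

(** The condition keeps the linear factors of the denominator at distance at least 1 from 0. The
    reciprocal in [strip_hol_gaussV] is a polynomial times an exponential and has no poles to
    avoid. *)
Lemma strip_hol_gauss n (k l : R[i]) : (forall x t, x \in `]x0, x1[ ->
    1 <= re (k * (x +i* t) + l)) ->
  strip_hol x0 x1 (fun x t => gauss_prod n (k * (x +i* t) + l)).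
Proof.
move=> h.
have h1 := strip_hol_affine x0 x1 0 (n`!%:R).
have h2 := strip_hol_cexp x0 x1 ((ln n%:R)%:C * k) ((ln n%:R)%:C * l).
have h3 : strip_hol x0 x1 (fun x t => \prod_(i <- index_enum 'I_n.+1) (k * (x +i* t) + (l + (i : nat)%:R))^-1).
  apply: strip_hol_prod => i _; apply: (strip_hol_inv (ltr01 : 0 < (1 : R))) => x t xI.
  apply: le_trans (re_le_cabs _); rewrite (le_trans _ (ler_norm _))// addrA reD re_nat.
  by have := h x t xI; have := ler0n R i; lra.
have := strip_holM h1 (strip_holM h2 h3); congr strip_hol.
apply/funext => x; apply/funext => t; rewrite mul0r add0r /gauss_prod -[RHS]mulrA; congr (_ * _); congr (_ * _).
  by rewrite /rpow; congr cexp; ring.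
by rewrite prodfV; congr (_^-1); apply: eq_bigr => i _; rewrite addrA.
Qed.

Lemma strip_hol_gaussV n (k l : R[i]) :
  strip_hol x0 x1 (fun x t => (gauss_prod n (k * (x +i* t) + l))^-1).
Proof.
have h1 := strip_hol_affine x0 x1 0 (n`!%:R)^-1.
have h2 := strip_hol_cexp x0 x1 (- (ln n%:R)%:C * k) (- (ln n%:R)%:C * l).
have h3 : strip_hol x0 x1 (fun x t => \prod_(i <- index_enum 'I_n.+1) (k * (x +i* t) + (l + (i : nat)%:R))).
  by apply: strip_hol_prod => i _; exact: strip_hol_affine.
have := strip_holM h1 (strip_holM h2 h3); congr strip_hol.
apply/funext => x; apply/funext => t; rewrite mul0r add0r /gauss_prod invfM invrK invfM -[RHS]mulrA; congr (_ * _); congr (_ * _).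
  by rewrite /rpow -cexpN; congr cexp; ring.
by apply: eq_bigr => i _; rewrite addrA.
Qed.

(** The factor e^(s l) is w^s with l = ln w; its modulus is bounded on a strip of finite width, so
    it does not affect the decay. *)
Lemma contour_shift_fox (l : R) (a b : R) : a < b ->
  a \in `]x0, x1[ -> b \in `]x0, x1[ ->
  cint leb setT (fun t => fox_kernel al bs (a +i* t) * cexp ((a +i* t) * l%:C)) =
  cint leb setT (fun t => fox_kernel al bs (b +i* t) * cexp ((b +i* t) * l%:C)).
Proof.
move=> ab aI bI.
have al0' : 0 < al := al0; have x10' : x1 <= 0 := x10.
pose F x t := fox_kernel al bs (x +i* t) * cexp ((x +i* t) * l%:C).
(* The index is n + 1 because the uniform bounds on Gauss products are stated for positive index. *)
pose Fn n x t := (\prod_(b <- bs) gauss_prod n.+1 ((-1) * (x +i* t) + b)) *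
  (gauss_prod n.+1 (- (2 * al)%:C * (x +i* t) + 1))^-1 * cexp (l%:C * (x +i* t) + 0).
have rb x t b' : x \in `]x0, x1[ -> b' \in bs -> 1 <= re ((-1) * (x +i* t) + b').
  rewrite in_itv/= => /andP[xx0 xx1] /x1bs hb'.
  by rewrite mulN1r addrC re_affineN; lra.
have aE x t : - (2 * al)%:C * (x +i* t) + 1 = 1 - (2 * al)%:C * (x +i* t).
  by rewrite mulNr addrC.
have ra x t : x \in `]x0, x1[ -> 1 <= re (- (2 * al)%:C * (x +i* t) + 1).
  by move=> xI; rewrite aE re_affineM; move: xI; rewrite in_itv/= => /andP[xx0 xx1]; nra.
have p1 (y : R) : 1 <= y -> 0 < y by exact: lt_le_trans.
have [C [d [C0 d0 hC]]] := fox_kernel_decay.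
(* Trades the exponential decay for the majorant of [contour_shift]: 1 + t^2 <= (1 + |t|)^2 <= C3
   e^(d |t|). *)
have [C3 C31 hC3] := @poly_le_exp R d 1 2 d0 ltr01.
have exl x t : x \in `]x0, x1[ -> cabs (cexp (l%:C * (x +i* t) + 0)) <=
    expR (`|l| * (`|x0| + `|x1|)).
  rewrite in_itv/= => /andP[xx0 xx1].
  rewrite addr0 cabs_cexp ler_expR reM/= mul0r subr0.
  apply: (le_trans (ler_norm _)); rewrite normrM ler_wpM2l//.
  by rewrite ler_norml; have := ler_norm (- x0); have := ler_norm x1;
    rewrite normrN; have := normr_ge0 x0; have := normr_ge0 x1; lra.
have FE x t : F x t = (\prod_(b <- bs) cgamma ((-1) * (x +i* t) + b)) *
    (cgamma (- (2 * al)%:C * (x +i* t) + 1))^-1 * cexp (l%:C * (x +i* t) + 0).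
  have PE : \prod_(b <- bs) cgamma (b - (x +i* t)) = \prod_(b <- bs) cgamma ((-1) * (x +i* t) + b).
    by apply: eq_bigr => i _; rewrite mulN1r addrC.
  by rewrite /F /fox_kernel PE -aE addr0 [l%:C * _]mulrC.
apply: (@contour_shift R x0 x1 F Fn _ _ _ a b
   (C * C3 * expR (`|l| * (`|x0| + `|x1|)))) => //.
- move=> n; apply: strip_holM; last exact: strip_hol_cexp.
  apply: strip_holM; last exact: strip_hol_gaussV.
  apply: strip_hol_prod => b' b'I; apply: strip_hol_gauss => x t xI; exact: rb.
- move=> x t xI; rewrite FE; apply: ccvgM; last exact: ccvg_cst.
  apply: ccvgM.
    have : forall r, {subset r <= bs} -> ccvg (fun n => \prod_(b <- r) gauss_prod n.+1 ((-1) * (x +i* t) + b))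
        (\prod_(b <- r) cgamma ((-1) * (x +i* t) + b)).
      elim => [_|b' r IH sub].
        by under eq_fun do rewrite big_nil; rewrite big_nil; exact: ccvg_cst.
      under eq_fun do rewrite big_cons; rewrite big_cons.
      have rb' := rb x t b' xI (sub _ (mem_head _ _)).
      apply: ccvgM; first by rewrite cgamma_pos ?p1//; exact: ccvgS (gauss_limit (p1 _ rb')).
      by apply: IH => i iI; apply: sub; rewrite inE iI orbT.
    exact.
  rewrite cgamma_pos ?p1 ?ra//; apply: ccvgV; first by apply: gamma_euler_neq0; rewrite p1 ?ra.
  exact: ccvgS (gauss_limit (p1 _ (ra x t xI))).
- move=> T.
  (* Bounds for the real part and for the squared imaginary part of 1 - 2 al s on the rectangle. *)
  pose B := 1 - 2 * al * x0; pose I2 := (2 * al * T) ^+ 2.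
  exists ((\prod_(b <- bs) (2 * (gamma_real 1 + gamma_real (re b - x0)))) *
    (B * (B + 1) * ((1 + I2 / 1 ^+ 2) * expR (pi * (2 * al * T) + I2 / 1))) * expR (`|l| * (`|x0| + `|x1|))).
  move=> n x t xI tT; rewrite [cabs (Fn n x t)]cabsM [cabs (_ / _)]cabsM.
  have := xI; rewrite in_itv/= => /andP[xx0 xx1].
  apply: ler_pM; rewrite ?mulr_ge0 ?cabs_ge0//; last exact: exl.
  apply: ler_pM; rewrite ?cabs_ge0//.
    rewrite cabs_prod !big_seq; apply: ler_prod => b' b'I; rewrite cabs_ge0/=.
    have rb' := rb x t b' xI b'I.
    apply: (le_trans (cabs_gauss_prod_le _ (p1 _ rb'))) => //.
    rewrite ler_wpM2l//; apply: gamma_real_le => //.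
    by rewrite mulN1r addrC re_affineN; lra.
  rewrite cabsV; apply: (le_trans (cabs_gauss_prodV_le _ ltr01 (ra x t xI))) => //.
  have r1 := ra x t xI.
  have imE : im (- (2 * al)%:C * (x +i* t) + 1) = - (2 * al * t).
    by rewrite aE im_affineM.
  have rB : re (- (2 * al)%:C * (x +i* t) + 1) <= B.
    by rewrite aE re_affineM /B; nra.
  have imB' : `|im (- (2 * al)%:C * (x +i* t) + 1)| <= 2 * al * T.
    by rewrite imE normrN normrM ger0_norm ?ler_wpM2l// mulr_ge0// ltW.
  have imB2 : im (- (2 * al)%:C * (x +i* t) + 1) ^+ 2 <= I2.
    rewrite -[im _ ^+ 2]real_normK ?num_real// /I2.
    by rewrite lerXn2r ?nnegrE// (le_trans _ imB').
  move: {imE} r1 rB imB' imB2; move: (re _) (im _) => r i r1 rB imB' imB2.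
  have i0 := sqr_ge0 i; have r0 : 0 <= r by exact: le_trans r1.
  rewrite expr1n !divr1; apply: ler_pM; rewrite ?mulr_ge0 ?addr_ge0 ?expR_ge0//.
    by apply: ler_pM; rewrite ?addr_ge0 ?lerD2r.
  apply: ler_pM; rewrite ?addr_ge0 ?expR_ge0 ?lerD2l//.
  by rewrite ler_expR lerD// ler_wpM2l// pi_ge0.
- move=> x t xI.
  have xI' : x \in `]x0, x1[.
    by move: aI bI xI; rewrite !in_itv/= => /andP[? ?] /andP[? ?] /andP[? ?]; apply/andP; split; lra.
  rewrite /F cabsM.
  have t0 : 0 < 1 + t ^+ 2 by rewrite ltr_pwDl// sqr_ge0.
  rewrite mulrAC; apply: ler_pM; rewrite ?cabs_ge0//; last first.
    by rewrite mulrC -[_ * (_ +i* _)]addr0; exact: exl.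
  apply: (le_trans (hC x t xI')); rewrite -[leRHS]mulrA ler_wpM2l ?(ltW C0)//.
  rewrite ler_pdivlMr// expRN mulrC ler_pdivrMr ?expR_gt0//.
  apply: le_trans (hC3 `|t| 2 (normr_ge0 t) (lexx _)).
  rewrite divr1 powR_mulrn ?addr_ge0// -[t ^+ 2]real_normK ?num_real//.
  by have := normr_ge0 t; nra.
Qed.

End FoxKernel.

Lemma mulf_cancel2_aux (F : fieldType) (p n q r s : F) : n != 0 -> s != 0 ->
  p / n * r * (n / q) = s * (p / q * (r / s)).
Proof.
move=> n0 s0; transitivity ((n / n) * (p * r * q^-1)); first by ring.
transitivity ((s / s) * (p * r * q^-1)); last by ring.
by rewrite !divff.
Qed.

Lemma prodr_scale (F : comNzRingType) (I : Type) (c : F) (f : I -> F) (r : seq I) :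
  \prod_(j <- r) (c * f j) = c ^+ size r * \prod_(j <- r) f j.
Proof. by rewrite big_split/= big_const_seq count_predT iter_mulr_1. Qed.

(** * The H-function as a superposition of powers *)

Section FoxSuperposition.
Variable R : realType.
Notation leb := (@lebesgue_measure R).

(** For w = z^(-2 al) / A the power w^s splits into A^(-s), which joins the coefficient, and z^(-2
    al s), which gives the exponent [fox_exp]; here s = g + i t. *)
Definition fox_coef (al A : R) (bs : seq R[i]) (g : R) (t : R) : R[i] :=
  fox_kernel al bs (g +i* t) * rpow A (- (g +i* t)).

Definition fox_exp (al g t : R) : R[i] := - ((2 * al)%:C * (g +i* t)).

Lemma cmeas_line (g : R) : cmeas setT (fun t : measurableTypeR R => g +i* t).
Proof. by split => //=; exact: measurable_cst. Qed.

Lemma cmeas_fox_kernel (al : R) (bs : seq R[i]) (g : R) : 0 < al -> g <= 0 ->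
  (forall b, b \in bs -> g < re b) ->
  cmeas setT (fun t : measurableTypeR R => fox_kernel al bs (g +i* t)).
Proof.
move=> al0 g0 hb; apply: cmeasM.
  elim: bs hb => [_|b bs IH hb].
    by under eq_fun do rewrite big_nil; exact: cmeas_cst.
  under eq_fun do rewrite big_cons.
  apply: cmeasM; last by apply: IH => b' b'I; apply: hb; rewrite inE b'I orbT.
  have rb t : 0 < re (b - (g +i* t)) by rewrite re_affineN subr_gt0 hb ?mem_head.
  have -> : (fun t => cgamma (b - (g +i* t))) = (fun t => gamma_euler (b - (g +i* t))).
    by apply/funext => t; rewrite cgamma_pos.
  apply: cmeas_gamma_euler => //.
  by apply: cmeasD; [exact: cmeas_cst|apply: cmeasN; exact: cmeas_line].
apply: cmeasV.
have rb t : 0 < re (1 - (2 * al)%:C * (g +i* t)) by rewrite re_affineM; nra.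
have -> : (fun t => cgamma (1 - (2 * al)%:C * (g +i* t))) =
    (fun t => gamma_euler (1 - (2 * al)%:C * (g +i* t))).
  by apply/funext => t; rewrite cgamma_pos.
apply: cmeas_gamma_euler => //.
apply: cmeasD; [exact: cmeas_cst|apply: cmeasN; apply: cmeasM; [exact: cmeas_cst|exact: cmeas_line]].
Qed.

Lemma re_fox_exp al g t : re (fox_exp al g t) = - (2 * al * g).
Proof. by rewrite reN reM/= mul0r subr0. Qed.

Variables (al A : R).
Hypotheses (al_gt0 : 0 < al) (A_gt0 : 0 < A).

Lemma fox_admissible (bs : seq R[i]) (g : R) : 2 * al < (size bs)%:R -> g + 1 <= 0 ->
  (forall b, b \in bs -> g + 2 <= re b) ->
  admissible leb (fox_coef al A bs g) (fox_exp al g).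
Proof.
move=> albs g1 hb; have al0 := al_gt0; have A0 := A_gt0.
have mc : cmeas setT (fox_exp al g : measurableTypeR R -> R[i]).
  by apply: cmeasN; apply: cmeasM; [exact: cmeas_cst|exact: cmeas_line].
have mT : cmeas setT (fox_coef al A bs g : measurableTypeR R -> R[i]).
  apply: cmeasM.
    by apply: cmeas_fox_kernel => //; [lra|move=> b /hb; lra].
  by apply: cmeas_rpow; apply: cmeasN; exact: cmeas_line.
split=> // z k z0.
have hb' b : b \in bs -> g + 1 + 1 <= re b by move=> /hb; lra.
have [C [d [C0 d0 hC]]] := @fox_kernel_decay R al bs (g - 1) (g + 1) al0 albs g1 hb'.
(* Of the k + 2 powers, k pay for the weight (1 + |c|)^k and 2 for the integrable majorant 1 / (1 +
   t^2). *)
have [C3 C31 hC3] := @poly_le_exp R d 1 k.+2%:R d0 ltr01.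
pose K := 1 + 2 * al * (`|g| + 1); have n0 := normr_ge0 g.
have K0 : 0 <= K by rewrite /K; nra.
pose M := C * A `^ (- g) * K ^+ k * z `^ (- (2 * al * g)) * C3.
have M0 : 0 <= M.
  by rewrite /M !mulr_ge0 ?powR_ge0 ?exprn_ge0 ?(ltW C0)// (le_trans _ C31).
have gint : leb.-integrable setT (EFin \o (fun t : R => M * (1 + t ^+ 2)^-1)).
  by apply: integrable_EFinZ => //; exact: integrable_oneDsqrV.
apply: (le_integrable measurableT _ _ gint).
  apply/measurable_EFinP; apply: measurable_funM; last first.
    under eq_fun do rewrite re_fox_exp; exact: measurable_cst.
  apply: measurable_funM; first exact: cmeas_cabs.
  apply: measurable_funX; apply: measurable_funD => //; exact: cmeas_cabs.
move=> t _.
have t0 : 0 < 1 + t ^+ 2 by rewrite ltr_pwDl// sqr_ge0.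
rewrite /= lee_fin ger0_norm; last first.
  by rewrite !mulr_ge0 ?powR_ge0 ?exprn_ge0 ?addr_ge0 ?cabs_ge0.
rewrite ger0_norm; last by rewrite mulr_ge0// invr_ge0 (ltW t0).
have gI : g \in `](g - 1), (g + 1)[ by rewrite in_itv/=; apply/andP; split; lra.
have h1 := hC g t gI.
have cle : 1 + cabs (fox_exp al g t) <= K * (1 + `|t|).
  have : cabs (fox_exp al g t) <= 2 * al * (`|g| + `|t|).
    rewrite cabsN cabsM cabs_real ger0_norm ?mulr_ge0 ?(ltW al0)//.
    by rewrite ler_wpM2l ?mulr_ge0 ?(ltW al0)// (le_trans (cabs_le_re_im _)).
  have t1 := normr_ge0 t; have := mulr_ge0 (mulr_ge0 (ltW al0) n0) t1; rewrite /K; nra.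
have t1 : 0 <= 1 + `|t| by rewrite addr_ge0.
have h2 : (1 + cabs (fox_exp al g t)) ^+ k <= K ^+ k * (1 + `|t|) ^+ k.
  by rewrite -exprMn lerXn2r ?nnegrE ?addr_ge0 ?cabs_ge0// mulr_ge0.
have h3 : (1 + `|t|) ^+ k * (1 + t ^+ 2) <= C3 * expR (d * `|t|).
  apply: le_trans (hC3 `|t| k.+2%:R (normr_ge0 t) (lexx _)).
  rewrite divr1 powR_mulrn// -[k.+2]addn2 exprD ler_wpM2l ?exprn_ge0//.
  by rewrite -[t ^+ 2]real_normK ?num_real//; have := normr_ge0 t; nra.
have cT : cabs (fox_coef al A bs g t) <= C * expR (- (d * `|t|)) * A `^ (- g).
  by rewrite [cabs _]cabsM cabs_rpow// reN/= ler_wpM2r ?powR_ge0.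
rewrite mul0r subr0.
apply: (@le_trans _ _ (C * expR (- (d * `|t|)) * A `^ (- g) * (K ^+ k * (1 + `|t|) ^+ k) *
   z `^ (- (2 * al * g)))).
  rewrite ler_wpM2r ?powR_ge0//.
  by apply: ler_pM => //; rewrite ?cabs_ge0 ?exprn_ge0 ?addr_ge0 ?cabs_ge0.
rewrite ler_pdivlMr//.
have -> : C * expR (- (d * `|t|)) * A `^ (- g) * (K ^+ k * (1 + `|t|) ^+ k) *
   z `^ (- (2 * al * g)) * (1 + t ^+ 2) =
   (C * A `^ (- g) * K ^+ k * z `^ (- (2 * al * g))) *
   (expR (- (d * `|t|)) * ((1 + `|t|) ^+ k * (1 + t ^+ 2))) by ring.
rewrite /M ler_wpM2l//.
  by rewrite !mulr_ge0 ?powR_ge0 ?exprn_ge0 ?(ltW C0).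
by rewrite expRN mulrC ler_pdivrMr ?expR_gt0.
Qed.

Lemma fox_superp_shift (bs : seq R[i]) (g g' z : R) : 2 * al < (size bs)%:R -> 0 < z ->
  g < g' -> g' + 1 <= 0 -> (forall b, b \in bs -> g' + 2 <= re b) ->
  superp leb (fox_coef al A bs g) (fox_exp al g) z =
  superp leb (fox_coef al A bs g') (fox_exp al g') z.
Proof.
move=> albs z0 gg g1 hb.
have hb' b : b \in bs -> g' + 1 + 1 <= re b by move=> /hb; lra.
have E h : superp leb (fox_coef al A bs h) (fox_exp al h) z =
   cint leb setT (fun t => fox_kernel al bs (h +i* t) *
     cexp ((h +i* t) * (- ln A - 2 * al * ln z)%:C)).
  apply: eq_cint => t _; rewrite /fox_coef -mulrA; congr (_ * _).
  rewrite /rpow -cexpD; congr cexp; rewrite /fox_exp !realCB !realCN !realCM; ring.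
by rewrite !E; apply: (@contour_shift_fox R al bs (g - 1) (g' + 1) al_gt0 albs g1 hb') => //;
  rewrite in_itv/=; apply/andP; split; lra.
Qed.

(** Lowering the exponent by [al] is the substitution of s + 1/2 for s: Gamma(b - s) is Gamma(b +
    1/2 - (s + 1/2)), Gamma(c + 1) cancels the old denominator, Gamma(c + 1 - al) is the new one,
    and A^(-s) releases a factor sqrt A. *)
Lemma fox_frac_der (bs : seq R[i]) (g t : R) : g <= 0 ->
  frac_der_coef al (fox_exp al g) (fox_coef al A bs g) t =
  (Num.sqrt A)%:C * fox_coef al A [seq b + (1 / 2 : R)%:C | b <- bs] (g + 1 / 2) t.
Proof.
move=> g0; have al0 := al_gt0.
have half : (g + 1 / 2) +i* t = (g +i* t) + (1 / 2 : R)%:C.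
  by apply: complexP; rewrite ?reD ?imD/= ?addr0.
have h2 : (2 * al)%:C * (1 / 2 : R)%:C = al%:C :> R[i].
  by rewrite -realCM; congr (_%:C); field.
have nz : cgamma (fox_exp al g t + 1) != 0.
  have r0 : 0 < re (fox_exp al g t + 1) by rewrite reD re_fox_exp/=; nra.
  by rewrite cgamma_pos// gamma_euler_neq0.
rewrite /frac_der_coef /fox_coef /fox_kernel half big_map.
have -> : \prod_(j <- bs) cgamma (j + (1 / 2 : R)%:C - ((g +i* t) + (1 / 2 : R)%:C)) =
   \prod_(b <- bs) cgamma (b - (g +i* t)).
  by apply: eq_bigr => b _; congr cgamma; ring.
have -> : 1 - (2 * al)%:C * ((g +i* t) + (1 / 2 : R)%:C) = fox_exp al g t + 1 - al%:C.
  by rewrite mulrDr h2 /fox_exp; ring.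
have -> : 1 - (2 * al)%:C * (g +i* t) = fox_exp al g t + 1 by rewrite /fox_exp addrC.
have -> : rpow A (- ((g +i* t) + (1 / 2 : R)%:C)) = rpow A (- (g +i* t)) / (Num.sqrt A)%:C.
  rewrite opprD rpowD [rpow A (- (1 / 2 : R)%:C)]rpowN rpow_real//.
  by rewrite (_ : 1 / 2 = 2^-1) ?powR12_sqrt ?mul1r// ltW.
have sA : (Num.sqrt A)%:C != 0 :> R[i] by rewrite realC_eq0 sqrtr_eq0 -ltNge.
exact: mulf_cancel2_aux.
Qed.

(** Since c / al = - 2 s, the linear factor c / al - r is 2 (- r/2 - s): it contributes one power of
    2 and raises the parameter - r/2 of a Gamma factor to 1 - r/2. *)
Lemma fox_charpoly (d : nat) (a : nat -> R) (s : d.-tuple R[i]) (bs cs : seq R[i]) (g t : R) :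
  charpoly al d a = (a d)%:C *: \prod_(r <- s) ('X - r%:P) ->
  (forall r, r \in s -> g < re (- r / 2)) ->
  perm_eq bs ([seq - r / 2 | r <- s] ++ cs) ->
  fox_coef al A bs g t * (charpoly al d a).[fox_exp al g t / al%:C] =
  (2 ^+ d * a d)%:C * fox_coef al A ([seq 1 - r / 2 | r <- s] ++ cs) g t.
Proof.
move=> -> hs pbs; have al0 := al_gt0.
rewrite hornerZ horner_prod /fox_coef /fox_kernel (perm_big _ pbs)/= !big_cat/= !big_map.
have -> : \prod_(j <- s) ('X - j%:P).[fox_exp al g t / al%:C] =
    2 ^+ d * \prod_(j <- s) (- j / 2 - (g +i* t)).
  have a0 : al%:C != 0 :> R[i] by rewrite realC_eq0 gt_eqF.
  rewrite -[d in 2 ^+ d](size_tuple s) -prodr_scale; apply: eq_bigr => r _.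
  rewrite !hornerE /fox_exp realCM.
  by field; rewrite a0.
have -> : \prod_(j <- s) cgamma (1 - j / 2 - (g +i* t)) =
  \prod_(j <- s) (- j / 2 - (g +i* t)) * \prod_(j <- s) cgamma (- j / 2 - (g +i* t)).
  rewrite -big_split/= !big_seq; apply: eq_bigr => r /hs rs.
  rewrite -cgammaD1; last first.
    have : 0 < re (- r / 2 - (g +i* t)) by rewrite re_affineN subr_gt0.
    by move=> /(re_gt0_neq0 0); rewrite addr0.
  by congr cgamma; ring.
have -> : (2 ^+ d * a d)%:C = 2 ^+ d * (a d)%:C :> R[i] by rewrite realCM realCX realC_nat.
by ring.
Qed.

End FoxSuperposition.

(** * Vertical lines as contours of the H-function *)

Section VerticalLine.
Variable R : realType.
Notation leb := (@lebesgue_measure R).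
Implicit Types (g t T : R) (p : R[i]).

Lemma line_velocity g t : cvelocity (fun y : R => g +i* y) t = 'i%C.
Proof.
by rewrite /cvelocity /cderiven /= derive1_cst derive1_id.
Qed.

Lemma line_contour g : contour g (fun t : R => g +i* t).
Proof.
split => /=.
- by move=> t t' [].
- by move=> t; split; [exact: derivable_cst|exact: derivable_id].
- split.
    rewrite (_ : derive1 _ = fun=> 0); first by move=> t; exact: cvg_cst.
    by apply/funext => t; rewrite derive1_cst.
  rewrite (_ : derive1 _ = fun=> (1 : R)); first by move=> t; exact: cvg_cst.
  by apply/funext => t; rewrite derive1_id.
- by split; exact: cvg_cst.
- by split; exact: cvg_id.
Qed.

(** With u = g - re p < 0 the integrand is u / (u^2 + (t - im p)^2), the derivative of atan ((t - im
    p) / u), which runs from pi / 2 down to - pi / 2. *)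
Lemma line_right_of g p : g < re p -> right_of (fun t : R => g +i* t) p.
Proof.
move=> gp; split.
  by move=> t; apply/eqP => h; move: gp; rewrite -h /= ltxx.
pose u := g - re p; have u0 : u < 0 by rewrite subr_lt0.
have un0 : u != 0 by rewrite lt_eqF.
pose f (t : R) := u / (u ^+ 2 + (t - im p) ^+ 2).
pose F (t : R) := atan ((t - im p) / u).
have fE t : im (cvelocity (fun y : R => g +i* y) t / ((g +i* t) - p)) = f t.
  rewrite line_velocity imM reV imV reB imB /= -/u mul0r add0r mul1r.
  by [].
have n0 t : u ^+ 2 + (t - im p) ^+ 2 != 0.
  by rewrite gt_eqF// ltr_pwDl ?sqr_ge0// exprn_even_gt0.
have dF t : is_derive t 1 F (f t).
  have d1 : is_derive t 1 (fun y : R => (y - im p) / u) u^-1.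
    have d0 : is_derive t 1 (fun y : R => y - im p) (1 - 0 : R).
      exact: is_deriveB (is_derive_id t 1) (is_derive_cst _ t 1).
    apply: is_derive_congr (is_deriveM d0 (is_derive_cst u^-1 t 1)) _ _ => //.
    by rewrite /GRing.scale/= mulr0 add0r subr0 mulr1.
  apply: is_derive_congr (is_derive1_comp (is_derive1_atan _) d1) _ _ => //.
  rewrite /f -[RHS]mul1r.
  have n0' : 1 + ((t - im p) / u) ^+ 2 != 0.
    by rewrite gt_eqF// ltr_pwDl// sqr_ge0.
  by field; rewrite un0 n0.
have intE T : 0 < T -> \int[leb]_(t in `[- T, T])
     im (cvelocity (fun y : R => g +i* y) t / ((g +i* t) - p)) = F T - F (- T).
  move=> T0.
  have NT : - T < T by rewrite gtrN.
  under eq_Rintegral do rewrite fE.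
  rewrite /Rintegral (@continuous_FTC2 _ f F)//=.
  + apply: continuous_subspaceT => t.
    apply: cvgM; first exact: cvg_cst.
    apply: cvgV; first exact: n0.
    apply: cvgD; first exact: cvg_cst.
    by rewrite expr2; apply: cvgM; (apply: cvgB; [exact: cvg_id|exact: cvg_cst]).
  + have cF t : {for t, continuous F} by exact: is_derive_continuous (dF t).
    split.
    * by move=> t _; have := dF t; case.
    * by apply: cvg_at_right_filter; exact: cF.
    * by apply: cvg_at_left_filter; exact: cF.
  + by move=> t _; rewrite derive1E; exact: derive_val.
have lim : (F T - F (- T)) @[T --> +oo] --> - (pi : R).
  have -> : - (pi : R) = - (pi / 2) - pi / 2 by field.
  have k0 : 0 < (- u)^-1 by rewrite invr_gt0 oppr_gt0.
  have to_oo (c : R) : ((T + c) * (- u)^-1) @[T --> +oo] --> +oo.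
    apply/cvgryPge => M; near=> T.
    rewrite ler_pdivlMr ?oppr_gt0// -lerBlDr.
    by near: T; apply: nbhs_pinfty_ge; rewrite num_real.
  have -> : (fun T => F T - F (- T)) =
      (fun T => - atan ((T - im p) * (- u)^-1) - atan ((T + im p) * (- u)^-1)).
    apply/funext => T; rewrite /F invrN !mulrN.
    have -> : (- T - im p) / u = - ((T + im p) / u) by field.
    by rewrite !atanN !opprK addrC.
  by apply: cvgB; first apply: cvgN; (apply: cvg_comp; [exact: to_oo|exact: cvgy_atan]).
apply: cvg_trans lim; apply: near_eq_cvg.
near=> T; rewrite intE//.
Unshelve. all: by end_near. Qed.

Variables (al A : R) (bs : seq R[i]) (g : R).
Hypotheses (al_gt0 : 0 < al) (A_gt0 : 0 < A) (al_bs : 2 * al < (size bs)%:R)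
  (g1 : g + 1 <= 0) (hb : forall b, b \in bs -> g + 2 <= re b).

(** The factor i is the velocity of the line. As l = 0, only the poles on the right have to be
    separated. *)
Lemma line_is_foxH (z : R) : 0 < z ->
  is_foxH (size bs) 0 [:: (1, 2 * al)] [seq (b, 1) | b <- bs]
    (z `^ (- (2 * al)) / A)%:C
    ((0 +i* (2 * pi))^-1 * 'i%C * superp leb (fox_coef al A bs g) (fox_exp al g) z).
Proof.
move=> z0; have al0 := al_gt0; have A0 := A_gt0.
have w0 : 0 < z `^ (- (2 * al)) / A by rewrite divr_gt0// powR_gt0.
have adm := fox_admissible al0 A0 al_bs g1 hb.
have int0 := superp_intble adm z0.
have E (t : R) : foxH_integrand (size bs) 0 [:: (1, 2 * al)] [seq (b, 1) | b <- bs]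
    (z `^ (- (2 * al)) / A)%:C (g +i* t) * cvelocity (fun y : R => g +i* y) t =
    'i%C * (fox_coef al A bs g t * rpow z (fox_exp al g t)).
  rewrite line_velocity [LHS]mulrC; congr (_ * _).
  rewrite /foxH_integrand [take (size bs) _]take_oversize ?size_map//.
  rewrite [drop (size bs) _]drop_oversize ?size_map// take0 drop0 !big_nil.
  rewrite big_seq1 big_map /= !mulr1 /fox_coef /fox_kernel.
  under eq_bigr do rewrite mul1r.
  rewrite -[RHS]mulrA; congr (_ * _).
  rewrite cpow_real// rpowM ?invr_gt0 ?powR_gt0// mulrC; congr (_ * _).
    by rewrite /rpow lnV ?posrE// realCN; congr cexp; ring.
  by rewrite rpow_powR// /fox_exp realCN mulNr.
split.
- by rewrite realC_eq0 gt_eqF.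
- by rewrite size_map.
- by rewrite addn0 lt0n; apply/eqP => h; move: al_bs; rewrite h; lra.
- by rewrite /= mulr_gt0//=; apply/allP => b /mapP[b' _ ->] /=.
- exists g, (fun t => g +i* t); split.
  + exact: line_contour.
  + split=> [b|a]; last by [].
    rewrite take_oversize ?size_map// => /mapP[b' b'I ->] k /=.
    apply: line_right_of; rewrite divr1 reD re_nat.
    by have := hb b'I; have := ler0n R k; lra.
  + apply: (@eq_cintble _ _ R leb setT (fun t => 'i%C * (fox_coef al A bs g t * rpow z (fox_exp al g t)))) => //.
    by apply: cintbleZ.
  + have -> : cintegral setT (fun t => foxH_integrand (size bs) 0 [:: (1, 2 * al)]
        [seq (b, 1) | b <- bs] (z `^ (- (2 * al)) / A)%:C (g +i* t) *
        cvelocity (fun y : R => g +i* y) t) =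
       cint leb setT (fun t => 'i%C * (fox_coef al A bs g t * rpow z (fox_exp al g t))).
      by apply: (@eq_cint _ _ R leb setT) => t _; rewrite E.
    by rewrite cintZ// mulrA.
Qed.

End VerticalLine.

(** * Dependence of the system on values at z > 0 only *)

Section Congruence.
Variable R : realType.
Notation leb := (@lebesgue_measure R).
Implicit Types (f g : R -> R[i]) (al z : R).

Let mI (a b : R) : measurable (`]a, b[%classic : set (measurableTypeR R)).
Proof. exact: measurable_itv. Qed.

Lemma RL_derivative_at_congr n al f f' g g' : (forall z, 0 < z -> f z = f' z) ->
  (forall z, 0 < z -> g z = g' z) ->
  RL_derivative_at n al f g -> RL_derivative_at n al f' g'.
Proof.
move=> ff gg [h1 h2 h3].
have E z t : `]0, z[%classic t -> ((z - t) `^ (n%:R - al - 1))%:C * f t =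
    ((z - t) `^ (n%:R - al - 1))%:C * f' t.
  by rewrite /= in_itv/= => /andP[t0 _]; rewrite ff.
have EI z : RL_integral (n%:R - al) f z = RL_integral (n%:R - al) f' z.
  by rewrite /RL_integral; congr (_ * _); apply: (@eq_cint _ _ R leb) => t; exact: E.
have [d1 d2] := cdiffn_congr (fun z _ => EI z) h2.
split => //.
- by move=> z z0; apply: (eq_cintble (mI _ _) _ (h1 z z0)) => t; exact: E.
- by move=> z z0; rewrite -gg// h3// d2.
Qed.

Lemma has_RL_derivative_congr al f f' g g' : (forall z, 0 < z -> f z = f' z) ->
  (forall z, 0 < z -> g z = g' z) ->
  has_RL_derivative al f g -> has_RL_derivative al f' g'.
Proof.
move=> ff gg [[n [n0 aln h1 h2]]|[n [n0 aln h1 h2 h3]]].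
  have [d1 d2] := cdiffn_congr ff h1.
  by left; exists n; split => // z z0; rewrite -gg// h2// d2.
right; exists n.
by have [] := @RL_derivative_at_congr n al f f' g g' ff gg (And3 h1 h2 h3).
Qed.

Lemma euler_op_congr al d (a : nat -> R) f f' z : (forall z, 0 < z -> f z = f' z) ->
  cdiffn d f -> 0 < z -> euler_op al d a f z = euler_op al d a f' z.
Proof.
move=> ff df z0; have [_ d2] := cdiffn_congr ff df.
by apply: eq_big_nat => k /andP[_ kd]; rewrite d2.
Qed.

Lemma is_solution_congr al m1 m2 (a b : nat -> R) f f' g g' :
  (forall z, 0 < z -> f z = f' z) -> (forall z, 0 < z -> g z = g' z) ->
  is_solution al m1 m2 a b f g -> is_solution al m1 m2 a b f' g'.
Proof.
move=> ff gg [h1 h2 h3 h4]; split.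
- exact: (cdiffn_congr gg h1).1.
- exact: (cdiffn_congr ff h2).1.
- by apply: has_RL_derivative_congr h3 => // z z0; apply: euler_op_congr.
- by apply: has_RL_derivative_congr h4 => // z z0; apply: euler_op_congr.
Qed.

End Congruence.

Lemma perm_fox_coef (R : realType) (al A : R) (bs cs : seq R[i]) (g t : R) :
  perm_eq bs cs -> fox_coef al A bs g t = fox_coef al A cs g t.
Proof. by move=> h; rewrite /fox_coef /fox_kernel (perm_big _ h). Qed.

(** * Solutions by H-functions *)

Section FoxSolution.
Variables (R : realType) (m1 m2 : nat) (al : R) (a b : nat -> R).
Variables (s1 : m1.-tuple R[i]) (s2 : m2.-tuple R[i]).
Notation leb := (@lebesgue_measure R).

Definition fox_params (x y : R) : seq R[i] :=
  [seq x%:C - t / 2 | t <- s1] ++ [seq y%:C - t / 2 | t <- s2].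

Lemma size_fox_params x y : size (fox_params x y) = (m1 + m2)%N.
Proof. by rewrite size_cat !size_map !size_tuple. Qed.

Lemma shifted_fox_params x y : shifted x s1 ++ shifted y s2 = [seq (t, 1) | t <- fox_params x y].
Proof. by rewrite /fox_params map_cat -!map_comp. Qed.

Lemma fox_params_half x y :
  [seq t + (1 / 2 : R)%:C | t <- fox_params x y] = fox_params (x + 1 / 2) (y + 1 / 2).
Proof.
rewrite /fox_params map_cat -!map_comp; congr (_ ++ _); apply: eq_map => t /=;
  by rewrite realCD addrAC.
Qed.

(* The line of integration lies so far to the left that all Gamma factors of the
   integrands below are given by Euler's integral. *)
Lemma exists_left_line : exists g : R, g + 2 <= 0 /\
  forall x y t, 0 <= x -> 0 <= y -> t \in fox_params x y -> g + 3 <= re t.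
Proof.
have [M hM] : exists M : R, 0 <= M /\ forall t, t \in (s1 : seq R[i]) ++ s2 -> `|re (t / 2)| <= M.
  elim: (_ ++ _) => [|t l [M [M0 IH]]]; first by exists 0.
  exists (M + `|re (t / 2)|); split; first by rewrite addr_ge0.
  move=> u; rewrite inE => /orP[/eqP ->|/IH h]; first by rewrite lerDr.
  by rewrite (le_trans h)// lerDl.
(* For x, y >= 0 all parameters have real part at least - M. The margin 3 is the 2 that
   [fox_admissible] asks for on a line plus the 1 by which the line will be moved. *)
exists (- (M + 3)); case: hM => M0 hM; split; first by lra.
move=> x y t x0 y0; rewrite mem_cat => /orP[] /mapP[u uI ->]; rewrite reB /=.
  have := hM u; rewrite mem_cat uI => /(_ isT); rewrite ler_norml => /andP[]; lra.
have := hM u; rewrite mem_cat uI orbT => /(_ isT); rewrite ler_norml => /andP[]; lra.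
Qed.

Hypotheses (al_gt0 : 0 < al) (ab_gt0 : 0 < a m1 * b m2).
Hypothesis al_lt : al < (m1 + m2)%:R / 2.
Hypothesis Pa : charpoly al m1 a = (a m1)%:C *: \prod_(s <- s1) ('X - s%:P).
Hypothesis Pb : charpoly al m2 b = (b m2)%:C *: \prod_(s <- s2) ('X - s%:P).

Let A : R := 2 ^+ (m1 + m2) * (a m1 * b m2).

Lemma fox_const_pos : 0 < A.
Proof. by rewrite mulr_gt0// exprn_gt0. Qed.

(** The constant in front of psi. Together with the sign in front of phi it has to convert the
    factor sqrt A of each fractional derivative into the leading constants 2^m1 a_m1 and 2^m2 b_m2
    of the operators, as [fox_ratio1] and [fox_ratio2] check. *)
Let kappa : R := 2 `^ ((m2%:R - m1%:R) / 2) * Num.sqrt (b m2 / a m1).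

Lemma sqrt_fox_const :
  Num.sqrt A = 2 `^ ((m1 + m2)%:R / 2) * Num.sqrt (a m1 * b m2).
Proof.
rewrite /A sqrtrM ?exprn_ge0//; congr (_ * _).
by rewrite -powR12_sqrt ?exprn_ge0// -powR_mulrn// -powRrM.
Qed.

(** Balance of constants in the first equation. [a m1] and [b m2] have the same sign because their
    product is positive, so the sign of [b m2] turns |a_m1| into a_m1. *)
Lemma fox_ratio1 : Num.sg (b m2) * Num.sqrt A = kappa * (2 ^+ m1 * a m1).
Proof.
have ab := ab_gt0.
have a0 : a m1 != 0 by apply: contraTneq ab => ->; rewrite mul0r ltxx.
have b0 : b m2 != 0 by apply: contraTneq ab => ->; rewrite mulr0 ltxx.
have sgE : Num.sg (b m2) = Num.sg (a m1).
  have : Num.sg (a m1 * b m2) = 1 by rewrite gtr0_sg.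
  by rewrite sgrM; case: (sgrP (a m1)) a0 => // _ _; case: (sgrP (b m2)) b0 => // _ _; lra.
rewrite sqrt_fox_const sgE /kappa.
have -> : 2 `^ ((m1 + m2)%:R / 2) = 2 `^ ((m2%:R - m1%:R) / 2) * 2 ^+ m1 :> R.
  rewrite -powR_mulrn// -powRD; last by rewrite pnatr_eq0 implybT.
  by congr (_ `^ _); rewrite natrD; field.
have -> : Num.sqrt (a m1 * b m2) = `|a m1| * Num.sqrt (b m2 / a m1).
  rewrite -sqrtr_sqr -sqrtrM ?sqr_ge0//; congr (Num.sqrt _); field; exact: a0.
transitivity (2 `^ ((m2%:R - m1%:R) / 2) * Num.sqrt (b m2 / a m1) *
  (2 ^+ m1 * (Num.sg (a m1) * `|a m1|))); first by ring.
by rewrite -numEsg.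
Qed.

Lemma fox_ratio2 : kappa * Num.sqrt A = Num.sg (b m2) * (2 ^+ m2 * b m2).
Proof.
have ab := ab_gt0.
have a0 : a m1 != 0 by apply: contraTneq ab => ->; rewrite mul0r ltxx.
have -> : Num.sg (b m2) * (2 ^+ m2 * b m2) = 2 ^+ m2 * `|b m2|.
  by rewrite mulrCA; congr (_ * _); rewrite normrEsg.
rewrite sqrt_fox_const /kappa mulrACA; congr (_ * _).
  rewrite -[RHS]powR_mulrn// -powRD; last by rewrite pnatr_eq0 implybT.
  by congr (_ `^ _); rewrite natrD; field.
have ba : 0 <= b m2 / a m1.
  have -> : b m2 / a m1 = a m1 * b m2 * (a m1) ^- 2 by field; exact: a0.
  by rewrite mulr_ge0 ?(ltW ab)// invr_ge0 sqr_ge0.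
rewrite -sqrtrM// -sqrtr_sqr; congr (Num.sqrt _); field; exact: a0.
Qed.

(** In the second equation both sides reach the parameters (1/2, 1), but the derivative of psi
    arrives on the line g + 1 while the operator leaves phi on the line g; [fox_superp_shift]
    identifies the two. *)
Lemma fox_solution (g : R) (k1 : R[i]) : g + 2 <= 0 ->
  (forall x y t, 0 <= x -> 0 <= y -> t \in fox_params x y -> g + 3 <= re t) ->
  is_solution al m1 m2 a b
    (fun z => k1 * (Num.sg (b m2))%:C *
       superp leb (fox_coef al A (fox_params (1 / 2) 0) g) (fox_exp al g) z)
    (fun z => k1 * kappa%:C *
       superp leb (fox_coef al A (fox_params 0 (1 / 2)) (g + 1 / 2)) (fox_exp al (g + 1 / 2)) z).
Proof.
move=> g2 hb; have al0 := al_gt0; have A0 := fox_const_pos.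
have half0 : 0 <= 1 / 2 :> R by lra.
have albs x y : 2 * al < (size (fox_params x y))%:R.
  by rewrite size_fox_params; have := al_lt; lra.
have adm x y h : 0 <= x -> 0 <= y -> g <= h -> h <= g + 1 ->
    admissible leb (fox_coef al A (fox_params x y) h) (fox_exp al h).
  move=> x0 y0 h0 h1; apply: fox_admissible => //; first by lra.
  by move=> t /(hb _ _ _ x0 y0); lra.
have adm1 : admissible leb (fox_coef al A (fox_params (1 / 2) 0) g) (fox_exp al g).
  by apply: adm => //; lra.
have adm2 : admissible leb (fox_coef al A (fox_params 0 (1 / 2)) (g + 1 / 2)) (fox_exp al (g + 1 / 2)).
  by apply: adm => //; lra.
pose u1 := k1 * (Num.sg (b m2))%:C; pose u2 := k1 * kappa%:C.
pose T1 t := u1 * fox_coef al A (fox_params (1 / 2) 0) g t.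
pose T2 t := u2 * fox_coef al A (fox_params 0 (1 / 2)) (g + 1 / 2) t.
have a1 : admissible leb T1 (fox_exp al g) by exact: admissibleZ.
have a2 : admissible leb T2 (fox_exp al (g + 1 / 2)) by exact: admissibleZ.
apply: (@is_solution_congr _ _ _ _ _ _ (superp leb T1 (fox_exp al g)) _
   (superp leb T2 (fox_exp al (g + 1 / 2)))).
- by move=> z z0; rewrite superpZ.
- by move=> z z0; rewrite superpZ.
have al_n0 : al != 0 by rewrite gt_eqF.
have ge0 h : g <= h -> h <= g + 1 -> forall t : R, 0 <= re (fox_exp al h t).
  by move=> h0 h1 t; rewrite re_fox_exp; nra.
have rl1 := superp_RL_derivative al0 a1 (ltrN10 _) (ge0 g (lexx _) ltac:(lra)).
have rl2 := superp_RL_derivative al0 a2 (ltrN10 _) (ge0 (g + 1 / 2) ltac:(lra) ltac:(lra)).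
have expE h : (fun t => fox_exp al h t - al%:C) = fox_exp al (h + 1 / 2).
  apply/funext => t; rewrite /fox_exp.
  have -> : (h + 1 / 2) +i* t = (h +i* t) + (1 / 2 : R)%:C.
    by apply: complexP; rewrite ?reD ?imD/= ?addr0.
  have h2 : (2 * al)%:C * (1 / 2 : R)%:C = al%:C :> R[i].
    by rewrite -realCM; congr (_%:C); field.
  by rewrite mulrDr h2 opprD.
have hlt h t x y : 0 <= x -> 0 <= y -> h <= g + 1 -> t \in fox_params x y -> h < re t.
  by move=> x0 y0 h1 /(hb _ _ _ x0 y0); lra.
split.
- exact: (superp_cdiffn m1 a2).1.
- exact: (superp_cdiffn m2 a1).1.
- apply: (has_RL_derivative_congr (fun _ _ => erefl)) rl1 => z z0.
  rewrite superp_euler_op// expE; apply: eq_cint => t _; congr (_ * _).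
  rewrite /T2 -(mulrA u2).
  rewrite (@fox_charpoly _ al A al0 m1 a s1 _ [seq (1 / 2 : R)%:C - r / 2 | r <- s2]) //.
  + transitivity (u1 * frac_der_coef al (fox_exp al g) (fox_coef al A (fox_params (1 / 2) 0) g) t).
      by rewrite /frac_der_coef /T1 -!mulrA.
    rewrite fox_frac_der//; last by lra.
    rewrite fox_params_half add0r (mulrA u1) (mulrA u2).
    have -> : u1 * (Num.sqrt A)%:C = u2 * (2 ^+ m1 * a m1)%:C.
      by rewrite /u1 /u2 -!mulrA -!realCM fox_ratio1.
    congr (_ * fox_coef _ _ (_ ++ _) _ _); apply: eq_map => r.
    by have -> : 1 / 2 + 1 / 2 = 1 :> R by field.
  + move=> r rs; have := hb 0 0 (- r / 2) (lexx _) (lexx _).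
    rewrite mem_cat; have -> : - r / 2 \in [seq 0%:C - t / 2 | t <- s1].
      by apply/mapP; exists r => //; rewrite sub0r mulNr.
    by move=> /(_ isT); lra.
  + rewrite /fox_params; apply/seq.permP => P; congr (count _ (_ ++ _)); apply: eq_map => r.
    by rewrite sub0r mulNr.
- apply: (has_RL_derivative_congr (fun _ _ => erefl)) rl2 => z z0.
  rewrite superp_euler_op// expE.
  have T2E : frac_der_coef al (fox_exp al (g + 1 / 2)) T2 =
      (fun t => (u1 * (2 ^+ m2 * b m2)%:C) * fox_coef al A (fox_params (1 / 2) 1) (g + 1) t).
    apply/funext => t.
    transitivity (u2 *
        frac_der_coef al (fox_exp al (g + 1 / 2)) (fox_coef al A (fox_params 0 (1 / 2)) (g + 1 / 2)) t).
      by rewrite /frac_der_coef /T2 -!mulrA.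
    rewrite fox_frac_der//; last by lra.
    rewrite fox_params_half add0r (mulrA u2).
    have -> : u2 * (Num.sqrt A)%:C = u1 * (2 ^+ m2 * b m2)%:C.
      by rewrite /u1 /u2 -!mulrA -!realCM fox_ratio2.
    have -> : 1 / 2 + 1 / 2 = 1 :> R by field.
    by have -> : g + 1 / 2 + 1 / 2 = g + 1 by field.
  have T1E : (fun t => T1 t * (charpoly al m2 b).[fox_exp al g t / al%:C]) =
      (fun t => (u1 * (2 ^+ m2 * b m2)%:C) * fox_coef al A (fox_params (1 / 2) 1) g t).
    apply/funext => t; rewrite /T1 -(mulrA u1).
    rewrite (@fox_charpoly _ al A al0 m2 b s2 _ [seq (1 / 2 : R)%:C - r / 2 | r <- s1]) //.
    + rewrite (mulrA u1); congr (_ * _); apply: perm_fox_coef.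
      by rewrite perm_catC /fox_params.
    + move=> r rs; have := hb 0 0 (- r / 2) (lexx _) (lexx _).
      rewrite mem_cat; have -> : - r / 2 \in [seq 0%:C - t / 2 | t <- s2].
        by apply/mapP; exists r => //; rewrite sub0r mulNr.
      by rewrite orbT => /(_ isT); lra.
    + rewrite perm_catC /fox_params; apply/seq.permP => P; congr (count _ (_ ++ _)); apply: eq_map => r.
      by rewrite sub0r mulNr.
  have adm3 h : g <= h -> h <= g + 1 ->
      admissible leb (fox_coef al A (fox_params (1 / 2) 1) h) (fox_exp al h).
    by move=> h0 h1; apply: adm => //; lra.
  have e1 : g + 1 / 2 + 1 / 2 = g + 1 by field.
  rewrite T1E e1.
  transitivity (superp leb (fun t => (u1 * (2 ^+ m2 * b m2)%:C) *
     fox_coef al A (fox_params (1 / 2) 1) (g + 1) t) (fox_exp al (g + 1)) z).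
    by apply: eq_cint => t _; congr (_ * _); exact: (congr1 (fun f => f t) T2E).
  rewrite (superpZ _ _ z0); last by apply: adm3; lra.
  rewrite (superpZ _ _ z0); last by apply: adm3; lra.
  congr (_ * _); symmetry; apply: fox_superp_shift => //; try lra.
  by move=> t /(hb _ _ _ half0 ler01); lra.
Qed.

End FoxSolution.

(** * Wright series *)

Section GeometricDomination.
Variable R : realType.
Notation cnt := (@counting nat R).
Implicit Types (u v : nat -> R) (f g : nat -> R[i]).

Lemma sum_half_le (M : R) n : 0 <= M -> \sum_(0 <= k < n) M * 2^-1 ^+ k <= 2 * M.
Proof.
move=> M0; suff -> : \sum_(0 <= k < n) M * 2^-1 ^+ k = 2 * M * (1 - 2^-1 ^+ n).
  by rewrite ler_piMr ?mulr_ge0// gerBl exprn_ge0.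
elim: n => [|n IH]; first by rewrite big_geq// expr0 subrr mulr0.
by rewrite big_nat_recr//= IH exprS; field.
Qed.

Lemma half_series_le u (M : R) n : (forall k, `|u k| <= M * 2^-1 ^+ k) ->
  \sum_(0 <= k < n) `|u k| <= 2 * M.
Proof.
move=> h; apply: (le_trans (ler_sum _ (fun k _ => h k))); apply: sum_half_le.
by have := h 0%N; rewrite expr0 mulr1; exact: le_trans.
Qed.

Lemma half_nneseries_lt u (M : R) : (forall k, `|u k| <= M * 2^-1 ^+ k) ->
  (\sum_(0 <= k <oo) `|(u k)%:E| < +oo)%E.
Proof.
move=> h; apply: (@le_lt_trans _ _ (2 * M)%:E); last exact: ltry.
apply: lime_le; first exact: is_cvg_nneseries.
by near=> n; rewrite sumEFin lee_fin half_series_le.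
Unshelve. all: by end_near. Qed.

Lemma half_integrable u (M : R) : (forall k, `|u k| <= M * 2^-1 ^+ k) ->
  cnt.-integrable setT (EFin \o u).
Proof.
move=> h; apply/integrableP; split; first by [].
by rewrite ge0_integral_count//; exact: half_nneseries_lt h.
Qed.

Lemma half_is_cvg_series u (M : R) : (forall k, `|u k| <= M * 2^-1 ^+ k) ->
  cvgn (series u).
Proof.
move=> h; apply: normed_cvg; apply: nondecreasing_is_cvgn.
  by apply: nondecreasing_series => k _ _ /=.
exists (2 * M) => _ [n _ <-]; rewrite /series/=; exact: half_series_le.
Qed.

Lemma half_Rintegral u (M : R) : (forall k, `|u k| <= M * 2^-1 ^+ k) ->
  \int[cnt]_(k in setT) u k = limn (series u).
Proof.
move=> h; rewrite /Rintegral integral_count; last first.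
  rewrite /summable -nneseries_esumT//; exact: half_nneseries_lt h.
rewrite (_ : (fun n => _) = EFin \o series u); last first.
  by apply/funext => n; rewrite /= sumEFin.
by rewrite EFin_lim//; exact: half_is_cvg_series h.
Qed.

(** All series here have quotients of consecutive terms tending to 0, so the fixed ratio 1/2 is
    enough. The condition gives integrability for the counting measure and identifies the integral
    with the limit of partial sums in [csum]. *)
Definition half_dominated f : Prop := exists M : R, forall k, cabs (f k) <= M * 2^-1 ^+ k.

Lemma half_dominated_cintble f : half_dominated f -> cintble cnt setT f.
Proof.
move=> [M hM]; split; apply: (@half_integrable _ M) => k;
  apply: le_trans (hM k); [exact: re_le_cabs|exact: im_le_cabs].
Qed.

Lemma half_dominated_cint f : half_dominated f -> cint cnt setT f = csum f.
Proof.
move=> [M hM]; rewrite /cint /csum; congr (_ +i* _);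
  apply: (@half_Rintegral _ M) => k; apply: le_trans (hM k);
  [exact: re_le_cabs|exact: im_le_cabs].
Qed.

Lemma limn_series_shift u v : u 0%N = 0 -> (forall k, u k.+1 = v k) ->
  cvgn (series v) -> limn (series u) = limn (series v).
Proof.
move=> u0 uv cv; apply: cvg_lim => //.
have e : [sequence series u n.+1]_n = series v.
  apply/funext => n; rewrite /series/= big_nat_recl// u0 add0r.
  by apply: eq_bigr => k _; rewrite uv.
by rewrite -(cvg_shiftS (series u)) e; exact: cv.
Qed.

Lemma csum_shift f g : f 0%N = 0 -> (forall k, f k.+1 = g k) -> half_dominated g ->
  csum f = csum g.
Proof.
move=> f0 fg [M hM]; rewrite /csum; congr (_ +i* _); apply: limn_series_shift => [|k|].
- by rewrite f0.
- by rewrite fg.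
- by apply: (@half_is_cvg_series _ M) => k; exact: le_trans (re_le_cabs _) (hM k).
- by rewrite f0.
- by rewrite fg.
- by apply: (@half_is_cvg_series _ M) => k; exact: le_trans (im_le_cabs _) (hM k).
Qed.

Lemma half_dominated_shift f g : f 0%N = 0 -> (forall k, f k.+1 = g k) ->
  half_dominated g -> half_dominated f.
Proof.
move=> f0 fg [M hM]; exists (2 * M) => -[|k].
  rewrite f0 cabs0 expr0 mulr1 mulr_ge0//.
  by have := hM 0%N; rewrite expr0 mulr1; exact: le_trans (cabs_ge0 _).
rewrite fg exprS (le_trans (hM k))// le_eqVlt; apply/orP; left; apply/eqP.
by field.
Qed.

(** The recurrence is asked for from [J] on only, since the Gamma estimates for the Wright terms
    hold from some index on. *)
Lemma ratio_half_dominated u (rho : nat -> R) (J : nat) : (forall k, 0 <= u k) ->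
  (forall k, (J <= k)%N -> u k.+1 <= rho k * u k) -> rho k @[k --> \oo] --> (0 : R) ->
  exists M : R, forall k, u k <= M * 2^-1 ^+ k.
Proof.
move=> u0 hr cr.
have [N [JN hN]] : exists N : nat, (J <= N)%N /\ forall k, (N <= k)%N -> rho k <= 2^-1.
  have h : \forall k \near \oo, rho k <= 2^-1.
    have := cvgr_le _ cr 2^-1; apply; first by rewrite invr_gt0.
  move: h => [N _ hN]; exists (maxn J N); split; first exact: leq_maxl.
  by move=> k /(leq_trans (leq_maxr _ _)) kN; exact: hN.
(* This sum bounds each of the finitely many u_k 2^k up to [N]; from [N] on every step at least
   halves the term. *)
pose M := \sum_(0 <= k < N.+1) u k * 2 ^+ k.
have term k : (k <= N)%N -> u k * 2 ^+ k <= M.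
  move=> kN; rewrite /M (bigD1_seq k) ?mem_index_iota ?iota_uniq//=.
  by rewrite lerDl sumr_ge0// => i _; rewrite mulr_ge0// exprn_ge0.
have hk k : (k <= N)%N -> u k <= M * 2^-1 ^+ k.
  by move=> kN; rewrite exprVn ler_pdivlMr ?exprn_gt0// term.
exists M; elim => [|k IH]; first exact: hk.
have [kN|Nk] := ltnP k N; first exact: hk.
apply: (le_trans (hr k (leq_trans JN Nk))); rewrite exprS mulrCA.
by apply: (le_trans (ler_wpM2r (u0 k) (hN k Nk))); rewrite ler_wpM2l// invr_ge0.
Qed.

End GeometricDomination.

(** * Size of the terms of the Wright series *)

Section WrightTerms.
Variable R : realType.
Notation leb := (@lebesgue_measure R).
Notation cnt := (@counting nat R).

Lemma powR_cvg0 (u : R) (y : nat -> R) : 0 < u < 1 -> y j @[j --> \oo] --> +oo ->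
  u `^ (y j - 1) @[j --> \oo] --> (0 : R).
Proof.
move=> /andP[u0 u1] yoo.
have L0 : 0 < - ln u by rewrite oppr_gt0 ln_lt0// u0.
have -> : (fun j => u `^ (y j - 1)) = (fun j => expR (- ((y j - 1) * - ln u))).
  by apply/funext => j; rewrite /powR gt_eqF// mulrN opprK.
apply: (cvg_comp (fun j => (y j - 1) * - ln u) (fun x => expR (- x))); last exact: cvgr_expR.
apply/cvgryPge => M; near=> j.
rewrite -ler_pdivrMr// lerBrDr; near: j.
by move/cvgryPge : yoo; apply.
Unshelve. all: by end_near. Qed.

(** The quotient is the integral of u^(y - 1) (1 - u)^(b - 1) over ]0, 1[ divided by Gamma(b). The
    integrand tends to 0 pointwise and, as y >= 1, stays below the integrable (1 - u)^(b - 1). *)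
Lemma gamma_quotient_cvg0_le1 (b : R) (y : nat -> R) : 0 < b -> b <= 1 ->
  y j @[j --> \oo] --> +oo -> (forall j, 1 <= y j) ->
  cabs (cgamma (y j)%:C / cgamma ((y j + b)%:C)) @[j --> \oo] --> (0 : R).
Proof.
move=> b0 b1 yoo y1.
have mI : measurable (`]0, 1[%classic : set (measurableTypeR R)) by exact: measurable_itv.
have gint := @integrable_powR_subl R b 1 b0 ltr01.
pose F j (u : R) := u `^ (y j - 1) * (1 - u) `^ (b - 1).
have mF j : measurable_fun (`]0, 1[%classic : set (measurableTypeR R)) (F j : measurableTypeR R -> R).
  have := @integrable_beta R (y j) b 1 (lt_le_trans ltr01 (y1 j)) b0 ltr01.
  by move/integrableP => [/measurable_EFinP].
have Fle j u : `]0, 1[%classic u -> `|F j u| <= (1 - u) `^ (b - 1).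
  rewrite /= in_itv/= => /andP[u0 u1].
  rewrite ger0_norm ?mulr_ge0 ?powR_ge0// ler_piMl ?powR_ge0//.
  by rewrite -[leRHS](powRr0 u) ger_powR// ?u0 ?(ltW u1)// subr_ge0.
have Fcvg u : `]0, 1[%classic u -> F j u @[j --> \oo] --> (0 : R).
  rewrite /= in_itv/= => /andP[u0 u1].
  rewrite -[X in _ --> X](mul0r ((1 - u) `^ (b - 1))); apply: cvgMl.
  by apply: powR_cvg0; rewrite ?u0.
have [_ h] := @Rintegral_dct _ _ R leb `]0, 1[%classic F (fun=> 0)
  (fun u => (1 - u) `^ (b - 1)) mI mF Fcvg gint Fle.
have Rint0 : \int[leb]_(t in `]0, 1[) (0 : R) = 0 by rewrite Rintegral_cst//= mul0r.
rewrite Rint0 in h.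
pose C := cabs (cgamma (b%:C : R[i]))^-1.
have bd j : cabs (cgamma (y j)%:C / cgamma ((y j + b)%:C)) <=
    C * (2 * \int[leb]_(u in `]0, 1[) F j u).
  have ry : 0 < re (y j)%:C by exact: lt_le_trans (y1 j).
  have := gamma_quotientE ry b0 b1 ltr01.
  rewrite /rpow ln1 mulr0 cexp0 mul1r -realCD => <-.
  rewrite cabsM ler_wpM2l ?cabs_ge0//.
  apply: cabs_cint_le => //.
  - exact: beta_kernel_meas.
  - by apply: (@integrable_beta R (y j) b 1) => //; exact: lt_le_trans (y1 j).
  - by move=> u; rewrite /= in_itv/= => /andP[u0 _]; rewrite cabs_beta_kernel.
apply: (@squeeze_cvgr _ _ _ _ (fun=> 0) (fun j => C * (2 * \int[leb]_(u in `]0, 1[) F j u))).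
- by near=> j; rewrite cabs_ge0/= bd.
- exact: cvg_cst.
- rewrite -[X in _ --> X](mulr0 C); apply: cvgMr.
  by rewrite -[X in _ --> X](mulr0 2); apply: cvgMr.
Unshelve. all: by end_near. Qed.

Lemma cgamma_real_neq0 (x : R) : 0 < x -> cgamma (x%:C : R[i]) != 0.
Proof. by move=> x0; rewrite cgamma_pos// gamma_euler_neq0. Qed.

Lemma gamma_quotient_cvg0 (d : R) (y : nat -> R) : 0 < d ->
  y j @[j --> \oo] --> +oo -> (forall j, 1 <= y j) ->
  cabs (cgamma (y j)%:C / cgamma ((y j + d)%:C)) @[j --> \oo] --> (0 : R).
Proof.
move=> d0 yoo y1.
(* Splits [d] into N + 1 equal steps of length at most 1, the range covered by
   [gamma_quotient_cvg0_le1]; the quotients multiply. *)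
pose N := Num.truncn d; pose b : R := d / N.+1%:R.
have b0 : 0 < b by rewrite divr_gt0.
have b1 : b <= 1 by rewrite ler_pdivrMr// mul1r ltW// truncnS_gt.
have dE : d = b * N.+1%:R by rewrite mulfVK// pnatr_eq0.
rewrite dE; move: (N) y yoo y1 => n; elim: n => [|n IH] y yoo y1.
  by rewrite mulr1; exact: gamma_quotient_cvg0_le1.
have yb1 j : 1 <= y j + b by rewrite (le_trans (y1 j))// lerDl ltW.
have yboo : (y j + b) @[j --> \oo] --> +oo.
  apply/cvgryPge => M; near=> j.
  by apply: (@le_trans _ _ (y j)); [near: j; move/cvgryPge : yoo; apply|rewrite lerDl ltW].
rewrite -[X in _ --> X](mulr0 0) (_ : (fun j => _) = (fun j =>
    cabs (cgamma (y j)%:C / cgamma ((y j + b)%:C)) *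
    cabs (cgamma (y j + b)%:C / cgamma ((y j + b + b * n.+1%:R)%:C)))).
  by apply: cvgM; [exact: gamma_quotient_cvg0_le1|exact: IH].
apply/funext => j.
have nz := cgamma_real_neq0 (lt_le_trans ltr01 (yb1 j)).
rewrite -cabsM mulrA (mulfVK nz); congr (cabs (_ / cgamma (_%:C))); rewrite -[in RHS]natr1; ring.
Unshelve. all: by end_near. Qed.

(* In every series of the theorem the parameter B of the denominator is p + 1, where
   z^p is the power in front, so that Gamma(B + 2 al j) = Gamma(c_j + 1) for the
   exponent c_j = p + 2 al j of z in the j-th term. *)
Definition wright_coef (al : R) (bs : seq R[i]) (p A : R) (j : nat) : R[i] :=
  (\prod_(b <- bs) cgamma (b + j%:R)) / cgamma ((p + 2 * al * j%:R)%:C + 1) * A%:C ^+ j.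

Definition wright_exp (al p : R) (j : nat) : R[i] := (p + 2 * al * j%:R)%:C.

Variables (al A : R) (bs : seq R[i]) (p : R).
Hypotheses (al_gt0 : 0 < al) (bs_gt0 : (0 < size bs)%N) (bs_al : (size bs)%:R < 2 * al).
Hypothesis p_gt : - 1 < p.
Hypothesis bs_neq0 : forall b, b \in bs -> forall j : nat, b + j%:R != 0.

Lemma wright_coefS j : cabs (wright_coef al bs p A j.+1) =
  cabs (wright_coef al bs p A j) * (\prod_(b <- bs) cabs (b + j%:R) *
   cabs (cgamma ((p + 1 + 2 * al * j%:R)%:C : R[i]) / cgamma ((p + 1 + 2 * al * j%:R + 2 * al)%:C)) * `|A|).
Proof.
have al0 := al_gt0; have p0 := p_gt.
have x0 : 0 < p + 1 + 2 * al * j%:R by rewrite ltr_wpDr ?mulr_ge0 ?(ltW al0)//; lra.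
have oneC : (1 : R[i]) = (1 : R)%:C by [].
have E1 : (p + 2 * al * j.+1%:R)%:C + 1 = (p + 1 + 2 * al * j%:R + 2 * al)%:C :> R[i].
  by rewrite [X in _ + X]oneC -realCD -natr1; congr (_%:C); ring.
have E2 : (p + 2 * al * j%:R)%:C + 1 = (p + 1 + 2 * al * j%:R)%:C :> R[i].
  by rewrite [X in _ + X]oneC -realCD; congr (_%:C); ring.
have E3 : \prod_(b <- bs) cgamma (b + j.+1%:R) =
    (\prod_(b <- bs) (b + j%:R)) * (\prod_(b <- bs) cgamma (b + j%:R)).
  rewrite -big_split/= !big_seq; apply: eq_bigr => b bI.
  by rewrite -natr1 addrA cgammaD1// bs_neq0.
rewrite /wright_coef E1 E2 E3 -(cabs_prod bs xpredT (fun b => b + j%:R)) -(cabs_real A) -!cabsM.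
congr cabs; have := cgamma_real_neq0 x0.
rewrite exprS.
move: (cgamma (p + 1 + 2 * al * j%:R)%:C) (cgamma _)^-1 (\prod_(_ <- _) cgamma _) (\prod_(_ <- _) _) (A%:C) (A%:C ^+ j).
move=> g h P Q a b g0.
transitivity ((g / g) * (Q * P * h * (a * b))); first by rewrite divff// mul1r.
by ring.
Qed.

(** Let x = p + 1 + 2 al j, m = [size bs] and d = 2 al - m > 0. From j to j + 1 the numerators
    contribute O(x^m) and the denominator Gamma(x) / Gamma(x + 2 al). Since |Gamma(x + m)| >= x^m
    |Gamma(x)|, the powers cancel and Gamma(y) / Gamma(y + d) with y = x + m is left, which tends to
    0. *)
Lemma wright_weights_half (z : R) (k : nat) : 0 < z ->
  exists M : R, forall j, cabs (wright_coef al bs p A j) *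
    (1 + cabs (wright_exp al p j)) ^+ k * z `^ re (wright_exp al p j) <= M * 2^-1 ^+ j.
Proof.
move=> z0; have al0 := al_gt0; have p0 := p_gt; have bal := bs_al.
have al20 : 0 < 2 * al by rewrite mulr_gt0.
pose d := 2 * al - (size bs)%:R.
have d0 : 0 < d by rewrite subr_gt0.
pose x (j : nat) : R := p + 1 + 2 * al * j%:R.
have x0 j : 0 < x j by rewrite ltr_wpDr ?mulr_ge0//; lra.
pose y j := x j + (size bs)%:R.
have y1 j : 1 <= y j.
  have : (1 : R) <= (size bs)%:R by rewrite ler1n.
  by have := x0 j; rewrite /y; lra.
have yoo : y j @[j --> \oo] --> +oo.
  apply/cvgryPge => M; near=> j.
  have : (M / (2 * al)) <= j%:R by near: j; exact: nbhs_infty_ger.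
  rewrite ler_pdivrMr// => h; rewrite /y /x.
  by have := ler0n R (size bs); lra.
have q0 := gamma_quotient_cvg0 d0 yoo y1.
pose K : R := \prod_(b <- bs) (cabs b + (2 * al)^-1).
have K0 : 0 <= K by apply: prodr_ge0 => b _; rewrite addr_ge0 ?cabs_ge0// invr_ge0 ltW.
(* Collects what one step contributes apart from the Gamma quotient: the numerators, [A], the
   polynomial weight and the power of [z]. *)
pose C := K * `|A| * (1 + 2 * al) ^+ k * z `^ (2 * al).
pose rho j := C * cabs (cgamma (y j)%:C / cgamma ((y j + d)%:C)).
(* From this index on 2 al j >= 1, hence [x j >= 1], and x absorbs the constants in the factors b +
   j. *)
pose J := (Num.truncn (2 * al)^-1).+1.
apply: (@ratio_half_dominated R _ rho J).
- by move=> j; rewrite !mulr_ge0 ?powR_ge0 ?exprn_ge0 ?addr_ge0 ?cabs_ge0.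
- move=> j Jj.
  have x1 : 1 <= x j.
    have : (2 * al)^-1 <= j%:R.
      by apply: (le_trans (ltW (truncnS_gt _))); rewrite ler_nat.
    by rewrite -[(2 * al)^-1]mul1r ler_pdivrMr// /x; lra.
  have jx : j%:R <= (2 * al)^-1 * x j.
    by rewrite mulrC ler_pdivlMr// /x; lra.
  have hprod : \prod_(b <- bs) cabs (b + j%:R) <= K * x j ^+ size bs.
    have -> : K * x j ^+ size bs = \prod_(b <- bs) ((cabs b + (2 * al)^-1) * x j).
      by rewrite big_split/= big_const_seq count_predT iter_mulr_1.
    apply: ler_prod => b _; rewrite cabs_ge0/=.
    apply: (le_trans (cabsD _ _)); rewrite cabs_nat mulrDl lerD//.
    by rewrite ler_peMr ?cabs_ge0.
  have hq : cabs (cgamma ((x j)%:C : R[i]) / cgamma ((x j + 2 * al)%:C)) <=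
      (x j ^+ size bs)^-1 * cabs (cgamma (y j)%:C / cgamma ((y j + d)%:C)).
    have E : y j + d = x j + 2 * al by rewrite /y /d; ring.
    have gy : cgamma (y j)%:C = cgamma (x j)%:C * \prod_(i < size bs) ((x j)%:C + i%:R).
      rewrite /y realCD realC_nat cgamma_rising// => i _.
      by apply: re_gt0_neq0 => /=.
    rewrite E gy -mulrA [_ * (_ / _)]mulrCA.
    rewrite [cabs (\prod_(_ < _) _ * _)]cabsM mulrA -[leLHS]mul1r ler_wpM2r ?cabs_ge0// mulrC ler_pdivlMr ?exprn_gt0 ?x0// mul1r.
    rewrite cabs_prod -[size bs in leLHS]card_ord -prodr_const; apply: ler_prod => i _.
    rewrite (ltW (x0 j))/= -realC_nat -realCD cabs_real.
    by apply: (le_trans _ (ler_norm _)); rewrite lerDl.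
  have cS : re (wright_exp al p j.+1) = re (wright_exp al p j) + 2 * al.
    by rewrite /= -natr1; ring.
  rewrite wright_coefS.
  have hc : 1 + cabs (wright_exp al p j.+1) <= (1 + 2 * al) * (1 + cabs (wright_exp al p j)).
    have : cabs (wright_exp al p j.+1) <= cabs (wright_exp al p j) + 2 * al.
      have -> : wright_exp al p j.+1 = wright_exp al p j + (2 * al)%:C.
        by rewrite /wright_exp -realCD -natr1; congr (_%:C); ring.
      by apply: (le_trans (cabsD _ _)); rewrite cabs_real ger0_norm// ltW.
    move: (cabs_ge0 (wright_exp al p j)).
    move: (cabs (wright_exp al p j)) (cabs (wright_exp al p j.+1)) => c c' c0.
    rewrite (_ : (1 + 2 * al) * (1 + c) = 1 + (c + 2 * al) + 2 * al * c); last by ring.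
    by move=> h; rewrite ler_wpDr ?lerD2l// mulr_ge0// (ltW al20).
  have hck : (1 + cabs (wright_exp al p j.+1)) ^+ k <=
      (1 + 2 * al) ^+ k * (1 + cabs (wright_exp al p j)) ^+ k.
    rewrite -exprMn lerXn2r ?nnegrE ?addr_ge0 ?cabs_ge0//.
    by rewrite mulr_ge0 ?addr_ge0 ?cabs_ge0// ltW.
  rewrite cS [z `^ (_ + _)]powRD; last by rewrite (gt_eqF z0) implybT.
  have h1 : \prod_(b <- bs) cabs (b + j%:R) *
      cabs (cgamma ((x j)%:C : R[i]) / cgamma ((x j + 2 * al)%:C)) * `|A| <=
      K * cabs (cgamma (y j)%:C / cgamma ((y j + d)%:C)) * `|A|.
    apply: (ler_wpM2r (normr_ge0 A)).
    apply: (le_trans (ler_pM _ _ hprod hq)); rewrite ?cabs_ge0//.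
      by apply: prodr_ge0 => b _; exact: cabs_ge0.
    by rewrite -[leLHS]mulrA mulVKf// expf_neq0// gt_eqF// x0.
  have h2 : \prod_(b <- bs) cabs (b + j%:R) *
      cabs (cgamma ((x j)%:C : R[i]) / cgamma ((x j + 2 * al)%:C)) * `|A| *
      (1 + cabs (wright_exp al p j.+1)) ^+ k <=
      K * cabs (cgamma (y j)%:C / cgamma ((y j + d)%:C)) * `|A| *
      ((1 + 2 * al) ^+ k * (1 + cabs (wright_exp al p j)) ^+ k).
    have p1 : 0 <= \prod_(b <- bs) cabs (b + j%:R) by apply: prodr_ge0 => b _; exact: cabs_ge0.
    have p2 := mulr_ge0 (mulr_ge0 p1 (cabs_ge0 (cgamma ((x j)%:C : R[i]) /
      cgamma ((x j + 2 * al)%:C)))) (normr_ge0 A).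
    have p3 := exprn_ge0 k (addr_ge0 ler01 (cabs_ge0 (wright_exp al p j.+1))).
    exact: ler_pM p2 p3 h1 hck.
  have h3 : 0 <= cabs (wright_coef al bs p A j) * z `^ re (wright_exp al p j) * z `^ (2 * al).
    by rewrite !mulr_ge0 ?powR_ge0 ?cabs_ge0.
  have := ler_wpM2l h3 h2; congr (_ <= _); last by rewrite /rho /C; ring.
  by rewrite /x; ring.
- rewrite -[X in _ --> X](mulr0 C); exact: cvgMr.
Unshelve. all: by end_near. Qed.

End WrightTerms.

HB.instance Definition _ (R : realType) :=
  @Measure_isSigmaFinite.Build _ _ _ (@counting nat R) (sigma_finite_counting R).

Lemma mulf_cancel3_aux (F : fieldType) (p n q a : F) : n != 0 ->
  p / n * a * (n / q) = p / q * a.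
Proof.
move=> n0; transitivity ((n / n) * (p / q * a)); first by ring.
by rewrite divff// mul1r.
Qed.

(** * Wright functions as superpositions for the counting measure *)

Section WrightSuperposition.
Variable R : realType.
Notation cnt := (@counting nat R).
Implicit Types (al A p z : R) (bs cs : seq R[i]).

(** Because of this the parameter (1, 1) of the Wright functions cancels the factorial in the
    series. The initial value Gamma(1) = 1 is the limit of Gauss's product at 1, which is n / (n +
    1). *)
Lemma cgamma_natS (n : nat) : cgamma (1 + n%:R : R[i]) = n`!%:R.
Proof.
have r1 : 0 < re (1 : R[i]) by rewrite /= ltr01.
have factE k : \prod_(i < k) (1 + i%:R) = k`!%:R :> R[i].
  elim: k => [|k IH]; first by rewrite big_ord0.
  by rewrite big_ord_recr/= IH nat1r factS natrM mulrC.
have g1 : gamma_euler (1 : R[i]) = 1.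
  apply: (ccvg_unique (gauss_limit r1)).
  apply: (eq_ccvg _ (@ccvg_natD R 0 1)) => k k0.
  rewrite /gauss_prod factE rpow1 ?ltr0n// add0r factS natrM realC_nat -natr1 addrC.
  have f0 : k`!%:R != 0 :> R[i] by rewrite pnatr_eq0 -lt0n fact_gt0.
  have k1 : k%:R + 1 != 0 :> R[i] by rewrite natr1 pnatr_eq0.
  by field; rewrite f0 k1.
rewrite cgamma_rising; last by move=> i _; rewrite addrC natr1 pnatr_eq0.
by rewrite cgamma_pos// g1 mul1r factE.
Qed.

Definition no_pole bs : Prop := forall b, b \in bs -> forall j : nat, b + j%:R != 0.

Definition wright_superp al A bs p : R -> R[i] :=
  superp cnt (wright_coef al bs p A) (wright_exp al p).

Lemma cmeas_nat (f : nat -> R[i]) : cmeas setT f.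
Proof. by split. Qed.

Lemma wright_admissible al A bs p : 0 < al -> (0 < size bs)%N -> (size bs)%:R < 2 * al ->
  -1 < p -> no_pole bs -> admissible cnt (wright_coef al bs p A) (wright_exp al p).
Proof.
move=> al0 b0 bal p1 np; split; [exact: cmeas_nat|exact: cmeas_nat|].
move=> z k z0; have [M hM] := wright_weights_half A al0 b0 bal p1 np k z0.
apply: (@half_integrable _ _ M) => j.
by rewrite ger0_norm// !mulr_ge0 ?powR_ge0 ?exprn_ge0 ?addr_ge0 ?cabs_ge0.
Qed.

Lemma wright_half_dominated al A bs p z : 0 < al -> (0 < size bs)%N ->
  (size bs)%:R < 2 * al -> -1 < p -> no_pole bs -> 0 < z ->
  half_dominated (fun j => wright_coef al bs p A j * rpow z (wright_exp al p j)).
Proof.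
move=> al0 b0 bal p1 np z0; have [M hM] := wright_weights_half A al0 b0 bal p1 np 0 z0.
exists M => j; have := hM j; rewrite expr0 mulr1.
by rewrite cabsM (cabs_rpow _ z0).
Qed.

Lemma half_dominatedZ (c : R[i]) f : half_dominated f -> half_dominated (fun j => c * f j).
Proof.
move=> [M hM]; exists (cabs c * M) => j.
by rewrite cabsM -mulrA ler_wpM2l ?cabs_ge0.
Qed.

Lemma wright_superpE al A bs p z : 0 < al -> (0 < size bs)%N -> (size bs)%:R < 2 * al ->
  -1 < p -> no_pole bs -> 0 < z ->
  (z `^ p)%:C * wright ([seq (b, 1) | b <- bs] ++ [:: (1, 1)])
     [:: ((p + 1)%:C, 2 * al)] (A * z `^ (2 * al))%:C =
  wright_superp al A bs p z.
Proof.
move=> al0 b0 bal p1 np z0.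
have hd := wright_half_dominated A al0 b0 bal p1 np z0.
have zp : (z `^ p)%:C != 0 :> R[i] by rewrite realC_eq0 gt_eqF// powR_gt0.
have T k : (\prod_(a <- [seq (b, 1 : R) | b <- bs] ++ [:: (1, 1)]) cgamma (a.1 + (a.2 * k%:R)%:C)) /
    (\prod_(b <- [:: ((p + 1)%:C, 2 * al)]) cgamma (b.1 + (b.2 * k%:R)%:C)) *
    ((A * z `^ (2 * al))%:C ^+ k / k`!%:R) =
    ((z `^ p)%:C)^-1 * (wright_coef al bs p A k * rpow z (wright_exp al p k)).
  rewrite big_cat/= big_map !big_seq1/= mul1r realC_nat cgamma_natS.
  have -> : (p + 1)%:C + (2 * al * k%:R)%:C = (p + 2 * al * k%:R)%:C + 1 :> R[i].
    by rewrite !realCD addrAC.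
  have -> : rpow z (wright_exp al p k) = (z `^ p)%:C * (z `^ (2 * al))%:C ^+ k.
    rewrite /wright_exp rpow_real// powRD; last by rewrite (gt_eqF z0) implybT.
    by rewrite powRrM powR_mulrn ?powR_ge0// realCM realCX.
  rewrite /wright_coef realCM exprMn.
  have f0 : k`!%:R != 0 :> R[i] by rewrite pnatr_eq0 -lt0n fact_gt0.
  move: zp f0; move: (\prod_(b <- bs) _) (cgamma _)^-1 ((z `^ p)%:C) (k`!%:R) => P g u f u0 f0.
  by field; rewrite u0 f0.
rewrite /wright; under eq_fun do rewrite T.
have hd2 := half_dominatedZ ((z `^ p)%:C)^-1 hd.
rewrite -(half_dominated_cint hd2) cintZ//; last exact: half_dominated_cintble.
by rewrite mulrA mulfV// mul1r.
Qed.

Lemma perm_wright_coef al A bs cs p j : perm_eq bs cs ->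
  wright_coef al bs p A j = wright_coef al cs p A j.
Proof. by move=> h; rewrite /wright_coef (perm_big _ h). Qed.

Lemma wright_exp_ge al p j : 0 < al -> p <= re (wright_exp al p j).
Proof. by move=> al0; rewrite /= lerDl mulr_ge0// mulr_ge0// ltW. Qed.

Lemma wright_frac_der al A bs p j : 0 < al -> -1 < p ->
  frac_der_coef al (wright_exp al p) (wright_coef al bs p A) j = wright_coef al bs (p - al) A j.
Proof.
move=> al0 p1; have := wright_exp_ge p j al0 => h.
have nz : cgamma (wright_exp al p j + 1) != 0.
  have r0 : 0 < re (wright_exp al p j + 1) by rewrite reD [re 1]/=; lra.
  by rewrite cgamma_pos// gamma_euler_neq0.
rewrite /frac_der_coef /wright_coef -/(wright_exp al p j).
have -> : (p - al + 2 * al * j%:R)%:C + 1 = wright_exp al p j + 1 - al%:C.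
  by rewrite /wright_exp !realCD realCN; ring.
exact: mulf_cancel3_aux.
Qed.

Lemma wright_exp_subl al p j : wright_exp al p j - al%:C = wright_exp al (p - al) j.
Proof. by rewrite /wright_exp !realCD realCN; ring. Qed.

(** The exponent - k + 2 al (j + 1) is 2 al - k + 2 al j: dropping the first term raises every
    parameter by 1 and releases one factor [A]. *)
Lemma wright_superp_shift al A bs (k : nat) (c : R[i]) z : 0 < al -> (0 < size bs)%N ->
  (size bs)%:R < 2 * al -> (0 < k)%N -> -1 < 2 * al - k%:R -> no_pole bs -> 0 < z ->
  superp cnt (fun j => c * wright_coef al bs (- k%:R) A j) (wright_exp al (- k%:R)) z =
  superp cnt (fun j => c * A%:C *
    wright_coef al [seq b + 1 | b <- bs] (2 * al - k%:R) A j)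
    (wright_exp al (2 * al - k%:R)) z.
Proof.
move=> al0 b0 bal k0 p1 np z0.
have np1 : no_pole [seq b + 1 | b <- bs].
  by move=> _ /mapP[b bI ->] j; rewrite -addrA nat1r np.
have hd := wright_half_dominated (bs := [seq b + 1 | b <- bs]) A al0.
rewrite size_map in hd; have {}hd := hd (2 * al - k%:R) z b0 bal p1 np1 z0.
pose g j := c * A%:C * wright_coef al [seq b + 1 | b <- bs] (2 * al - k%:R) A j *
  rpow z (wright_exp al (2 * al - k%:R) j).
have hg : half_dominated g.
  have := half_dominatedZ (c * A%:C) hd; congr half_dominated.
  by apply/funext => j; rewrite (mulrA (c * A%:C)).
pose f j := c * wright_coef al bs (- k%:R) A j * rpow z (wright_exp al (- k%:R) j).
have f0 : f 0%N = 0.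
  rewrite /f /wright_coef !mulr0 addr0.
  (* As k > 0, the denominator at j = 0 is Gamma at the pole - (k - 1). *)
  have -> : (- k%:R)%:C + 1 = - (k.-1)%:R :> R[i].
    by rewrite realCN realC_nat -{1}(prednK k0) -natr1; ring.
  by rewrite rgamma_pole mulr0 !mul0r mulr0 mul0r.
have fS j : f j.+1 = g j.
  have E : - k%:R + 2 * al * j.+1%:R = 2 * al - k%:R + 2 * al * j%:R.
    by rewrite -natr1; ring.
  rewrite /f /g /wright_coef /wright_exp E big_map exprS.
  have -> : \prod_(b <- bs) cgamma (b + j.+1%:R) = \prod_(j0 <- bs) cgamma (j0 + 1 + j%:R).
    by apply: eq_bigr => b _; rewrite -addrA nat1r.
  move: (\prod_(_ <- _) _) (cgamma _)^-1 (A%:C ^+ j) (A%:C) (rpow _ _) => u1 u2 u3 u4 u5.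
  by ring.
have hf := half_dominated_shift f0 fS hg.
by rewrite -[LHS]/(cint cnt setT f) -[RHS]/(cint cnt setT g) (half_dominated_cint hf)
  (half_dominated_cint hg) (csum_shift f0 fS hg).
Qed.

(** The exponent is 2 al (x + j), so c / al - r is 2 (x - r/2 + j), the factor leading from Gamma(x
    - r/2 + j) to its successor. This fixes the parameters of the theorem: x = 1/2 - k / (2 al) for
    the power z^(al - k) and x = 1 - k / (2 al) for z^(2 al - k). *)
Lemma wright_charpoly al A (d : nat) (a : nat -> R) (s : d.-tuple R[i]) cs (x p : R) j :
  0 < al -> x = p / (2 * al) ->
  charpoly al d a = (a d)%:C *: \prod_(r <- s) ('X - r%:P) ->
  no_pole [seq x%:C - r / 2 | r <- s] ->
  wright_coef al ([seq x%:C - r / 2 | r <- s] ++ cs) p A j *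
    (charpoly al d a).[wright_exp al p j / al%:C] =
  (2 ^+ d * a d)%:C * wright_coef al ([seq (x + 1)%:C - r / 2 | r <- s] ++ cs) p A j.
Proof.
move=> al0 xE -> np.
rewrite hornerZ horner_prod /wright_coef !big_cat/= !big_map.
have -> : \prod_(r <- s) ('X - r%:P).[wright_exp al p j / al%:C] =
    2 ^+ d * \prod_(r <- s) (x%:C - r / 2 + j%:R).
  have a0 : al%:C != 0 :> R[i] by rewrite realC_eq0 gt_eqF.
  rewrite -[d in 2 ^+ d](size_tuple s) -prodr_scale; apply: eq_bigr => r _.
  have pE : p = 2 * al * x by rewrite xE mulrC mulfVK// gt_eqF// mulr_gt0.
  rewrite !hornerE /wright_exp pE !realCD !realCM !realC_nat.
  by field; rewrite a0.
have E : \prod_(r <- s) cgamma ((x + 1)%:C - r / 2 + j%:R) =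
  \prod_(r <- s) (x%:C - r / 2 + j%:R) * \prod_(r <- s) cgamma (x%:C - r / 2 + j%:R).
  rewrite -big_split/= !big_seq; apply: eq_bigr => r rs.
  rewrite -cgammaD1; last by apply: np; apply/mapP; exists r.
  by congr cgamma; rewrite realCD; ring.
rewrite [in RHS]E.
have -> : (2 ^+ d * a d)%:C = 2 ^+ d * (a d)%:C :> R[i] by rewrite realCM realCX realC_nat.
by ring.
Qed.

End WrightSuperposition.

(** * Linearity of the system *)

Section FractionalSystem.
Variable R : realType.
Notation leb := (@lebesgue_measure R).
Implicit Types (f g phi psi : R -> R[i]) (al z : R) (a b : nat -> R).

Let mI (u v : R) : measurable (`]u, v[%classic : set (measurableTypeR R)).
Proof. exact: measurable_itv. Qed.

Lemma euler_opD al d a f g z : cdiffn d f -> cdiffn d g -> 0 < z ->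
  euler_op al d a (fun x => f x + g x) z = euler_op al d a f z + euler_op al d a g z.
Proof.
move=> df dg z0; have [_ h] := cdiffnD df dg.
rewrite /euler_op -big_split/=; apply: eq_big_nat => k /andP[_ kd].
by rewrite h// mulrDr.
Qed.

Lemma RL_derivative_atD n al f f' g g' : RL_derivative_at n al f g ->
  RL_derivative_at n al f' g' ->
  RL_derivative_at n al (fun z => f z + f' z) (fun z => g z + g' z).
Proof.
move=> [i1 d1 e1] [i2 d2 e2].
have E z t : ((z - t) `^ (n%:R - al - 1))%:C * (f t + f' t) =
    ((z - t) `^ (n%:R - al - 1))%:C * f t + ((z - t) `^ (n%:R - al - 1))%:C * f' t.
  by rewrite mulrDr.
have EI z : 0 < z -> RL_integral (n%:R - al) f z + RL_integral (n%:R - al) f' z =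
    RL_integral (n%:R - al) (fun z => f z + f' z) z.
  move=> z0; rewrite /RL_integral -mulrDr; congr (_ * _).
  transitivity (cint leb `]0, z[ (fun t => ((z - t) `^ (n%:R - al - 1))%:C * f t +
      ((z - t) `^ (n%:R - al - 1))%:C * f' t)).
    by rewrite (cintD (mI _ _) (i1 z z0) (i2 z z0)).
  by apply: eq_cint => t _; rewrite E.
have [dD eD] := cdiffnD d1 d2.
have [dE eE] := cdiffn_congr EI dD.
split => //.
- move=> z z0; apply: (eq_cintble (mI _ _) _ (cintbleD (mI _ _) (i1 z z0) (i2 z z0))) => t _.
  by rewrite E.
- by move=> z z0; rewrite e1// e2// eE// eD.
Qed.

(** With [n] fixed the conditions are linear and can be summed term by term, whereas [is_solution]
    hides the [n] of each derivative behind an existential quantifier. *)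
Definition system_at n al m1 m2 a b phi psi : Prop :=
  [/\ cdiffn m1 psi, cdiffn m2 phi,
      RL_derivative_at n al phi (euler_op al m1 a psi) &
      RL_derivative_at n al psi (euler_op al m2 b phi)].

Lemma system_at_solution n al m1 m2 a b phi psi : (0 < n)%N -> n%:R - 1 < al < n%:R ->
  system_at n al m1 m2 a b phi psi -> is_solution al m1 m2 a b phi psi.
Proof.
by move=> n0 aln [d1 d2 [i1 c1 e1] [i2 c2 e2]]; split => //; right; exists n; split.
Qed.

Lemma system_at_sym n al m1 m2 a b phi psi :
  system_at n al m1 m2 a b phi psi -> system_at n al m2 m1 b a psi phi.
Proof. by case. Qed.

Lemma system_at_congr n al m1 m2 a b phi phi' psi psi' :
  (forall z, 0 < z -> phi z = phi' z) -> (forall z, 0 < z -> psi z = psi' z) ->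
  system_at n al m1 m2 a b phi psi -> system_at n al m1 m2 a b phi' psi'.
Proof.
move=> ff gg [h1 h2 h3 h4]; split.
- exact: (cdiffn_congr gg h1).1.
- exact: (cdiffn_congr ff h2).1.
- by apply: RL_derivative_at_congr h3 => // z z0; apply: euler_op_congr.
- by apply: RL_derivative_at_congr h4 => // z z0; apply: euler_op_congr.
Qed.

Lemma system_atD n al m1 m2 a b phi phi' psi psi' :
  system_at n al m1 m2 a b phi psi -> system_at n al m1 m2 a b phi' psi' ->
  system_at n al m1 m2 a b (fun z => phi z + phi' z) (fun z => psi z + psi' z).
Proof.
move=> [d1 d2 r1 r2] [d1' d2' r1' r2']; split.
- exact: (cdiffnD d1 d1').1.
- exact: (cdiffnD d2 d2').1.
- by apply: RL_derivative_at_congr (RL_derivative_atD r1 r1') => // z z0; rewrite euler_opD.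
- by apply: RL_derivative_at_congr (RL_derivative_atD r2 r2') => // z z0; rewrite euler_opD.
Qed.

(** The zero function is treated as a superposition with weight 0. Besides empty sums it serves the
    indices with a vanishing constant, whose Gamma factors may sit at poles. *)
Lemma system_at0 n al m1 m2 a b : (0 < n)%N -> 0 < al -> n%:R - 1 < al < n%:R ->
  system_at n al m1 m2 a b (fun=> 0) (fun=> 0).
Proof.
move=> n0 al0 aln.
have adm : admissible leb (fun=> 0) (fun=> 0).
  split; [exact: cmeas_cst|exact: cmeas_cst|move=> z k z0].
  under eq_fun do rewrite cabs0 !mul0r.
  exact: integrable0.
have s0 z : superp leb (fun=> 0) (fun=> 0) z = 0.
  rewrite /superp; under eq_fun do rewrite mul0r.
  by rewrite /cint !Rintegral_cst//= !mul0r.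
have N10 : -1 < 0 :> R by rewrite oppr_lt0.
have r := superp_RL_derivative_at n0 aln adm N10 (fun=> lexx _).
have an0 : al != 0 by rewrite gt_eqF.
have dz k : cdiffn k (fun=> 0 : R[i]).
  exact: (cdiffn_congr (fun z _ => s0 z) (superp_cdiffn k adm).1).1.
have z0 (c : R -> R[i]) z : superp leb (fun=> 0) c z = 0.
  rewrite /superp; under eq_fun do rewrite mul0r.
  by rewrite /cint !Rintegral_cst//= !mul0r.
have e d (a' : nat -> R) z : 0 < z -> euler_op al d a' (fun=> 0) z = 0.
  move=> zp; rewrite -(@euler_op_congr _ al d a' _ _ z (fun z _ => s0 z) _ zp); last first.
    exact: (superp_cdiffn d adm).1.
  rewrite superp_euler_op//.
  by rewrite /superp; under eq_fun do rewrite !mul0r; rewrite /cint !Rintegral_cst//= !mul0r.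
have rr d (a' : nat -> R) : RL_derivative_at n al (fun=> 0) (euler_op al d a' (fun=> 0)).
  apply: RL_derivative_at_congr r => // z zp; rewrite e//.
  rewrite /superp /frac_der_coef; under eq_fun do rewrite !mul0r.
  by rewrite /cint !Rintegral_cst//= !mul0r.
by split.
Qed.

Lemma system_at_sum n al m1 m2 a b (r : seq nat) (F G : nat -> R -> R[i]) :
  (0 < n)%N -> 0 < al -> n%:R - 1 < al < n%:R ->
  (forall k, k \in r -> system_at n al m1 m2 a b (F k) (G k)) ->
  system_at n al m1 m2 a b (fun z => \sum_(k <- r) F k z) (fun z => \sum_(k <- r) G k z).
Proof.
move=> n0 al0 aln; elim: r => [_|k r IH h].
  by apply: system_at_congr (system_at0 m1 m2 a b n0 al0 aln) => z z0; rewrite big_nil.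
apply: system_at_congr (system_atD (h k (mem_head _ _))
  (IH (fun j jr => h j (mem_behead (s := k :: r) jr)))) => z z0; by rewrite big_cons.
Qed.

End FractionalSystem.

(** * Solutions by Wright functions *)

Section WrightSolution.
Variable R : realType.
Notation cnt := (@counting nat R).

Lemma no_pole_sub (bs cs : seq R[i]) : {subset cs <= bs} -> no_pole bs -> no_pole cs.
Proof. by move=> sub np c /sub; exact: np. Qed.

Lemma wright_frac_derZ (al A : R) (bs : seq R[i]) (p : R) (c : R[i]) (j : nat) :
  0 < al -> -1 < p ->
  frac_der_coef al (wright_exp al p) (fun j => c * wright_coef al bs p A j) j =
  c * wright_coef al bs (p - al) A j.
Proof.
move=> al0 p1; rewrite -(wright_frac_der A bs j al0 p1) /frac_der_coef.
by rewrite -(mulrA c).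
Qed.

(** This settles the terms with the constant c_k,1. Those with c_k,2 arise by exchanging the two
    equations, so the same lemma is applied a second time with the two sets of roots and
    coefficients interchanged. *)
Lemma wright_system (n m1 m2 k : nat) (al A : R) (a b : nat -> R) (c : R[i])
    (s1 : m1.-tuple R[i]) (s2 : m2.-tuple R[i]) :
  let h := k%:R / (2 * al) in
  (0 < n)%N -> 0 < al -> n%:R - 1 < al < n%:R -> (0 < k <= n)%N ->
  (0 < m1)%N -> (m1 + m2)%:R / 2 < al ->
  charpoly al m1 a = (a m1)%:C *: \prod_(s <- s1) ('X - s%:P) ->
  charpoly al m2 b = (b m2)%:C *: \prod_(s <- s2) ('X - s%:P) ->
  A = 2 ^+ m1 * a m1 * (2 ^+ m2 * b m2) ->
  no_pole (fox_params s1 s2 (1 - h) (1 / 2 - h)) ->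
  no_pole (fox_params s1 s2 (1 - h) (3 / 2 - h)) ->
  system_at n al m1 m2 a b
    (fun z => c * wright_superp al A (fox_params s1 s2 (1 - h) (1 / 2 - h)) (al - k%:R) z)
    (fun z => c * (2 ^+ m2 * b m2)%:C *
       wright_superp al A (fox_params s1 s2 (1 - h) (3 / 2 - h)) (2 * al - k%:R) z).
Proof.
move=> h n0 al0 aln kn m10 mal Pa Pb AE npl nph.
have an0 : al != 0 by rewrite gt_eqF.
have sz x y : (0 < size (fox_params s1 s2 x y))%N.
  by rewrite size_fox_params addn_gt0 m10.
have szal x y : (size (fox_params s1 s2 x y))%:R < 2 * al.
  by rewrite size_fox_params; lra.
have [k0 kn'] := andP kn.
have kR : k%:R <= n%:R :> R by rewrite ler_nat.
have [aln1 aln2] := andP aln.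
(* As k <= n and al > n - 1, the power z^(al - k) is integrable at 0. *)
have pl : -1 < al - k%:R by lra.
have ph : -1 < 2 * al - k%:R by lra.
set lo := fox_params s1 s2 (1 - h) (1 / 2 - h) in npl *.
set hi := fox_params s1 s2 (1 - h) (3 / 2 - h) in nph *.
have adml := wright_admissible A al0 (sz _ _) (szal _ _) pl npl.
have admh := wright_admissible A al0 (sz _ _) (szal _ _) ph nph.
pose u := c * (2 ^+ m2 * b m2)%:C.
have al1 := admissibleZ c adml; have ah1 := admissibleZ u admh.
apply: (@system_at_congr _ _ _ _ _ _ _
   (superp cnt (fun j => c * wright_coef al lo (al - k%:R) A j) (wright_exp al (al - k%:R))) _
   (superp cnt (fun j => u * wright_coef al hi (2 * al - k%:R) A j) (wright_exp al (2 * al - k%:R)))).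
- by move=> z z0; rewrite superpZ.
- by move=> z z0; rewrite superpZ.
have rl := superp_RL_derivative_at n0 aln al1 pl (fun j => wright_exp_ge _ j al0).
have rh := superp_RL_derivative_at n0 aln ah1 ph (fun j => wright_exp_ge _ j al0).
have half1 : 1 / 2 - h + 1 = 3 / 2 - h by field.
have hE : h = k%:R / (2 * al) by [].
split.
- exact: (superp_cdiffn m1 ah1).1.
- exact: (superp_cdiffn m2 al1).1.
- apply: (RL_derivative_at_congr (fun _ _ => erefl)) rl => z z0.
  rewrite superp_euler_op//.
  transitivity (superp cnt (fun j => c * wright_coef al lo (- k%:R) A j)
      (wright_exp al (- k%:R)) z).
    apply: eq_cint => j _.
    have e0 : al - k%:R - al = - k%:R by ring.
    by rewrite wright_frac_derZ// wright_exp_subl e0.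
  (* The left-hand side starts formally at z^(-k), the right-hand side at z^(2 al - k). After the
     shift the exponents agree, and the released factor [A] is the product of the leading constants
     of the two operators. *)
  rewrite (wright_superp_shift _ _ al0 (sz _ _) (szal _ _) k0 ph npl z0).
  rewrite /superp; apply: eq_cint => j _; congr (_ * _).
  rewrite /hi /fox_params -[RHS]mulrA (@wright_charpoly _ al A m1 a s1 _ (1 - h) (2 * al - k%:R))//.
  + rewrite (mulrA u); congr (_ * _).
      by rewrite /u AE !realCM; ring.
    congr wright_coef; rewrite /lo /fox_params map_cat -!map_comp; congr (_ ++ _);
      apply: eq_map => r /=.
      by rewrite [LHS]addrAC [in RHS]realCD.
    by rewrite -half1 [LHS]addrAC [in RHS]realCD.
  + by rewrite hE; field.
  + by apply: no_pole_sub nph => r rI; rewrite mem_cat rI.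
- apply: (RL_derivative_at_congr (fun _ _ => erefl)) rh => z z0.
  rewrite superp_euler_op//.
  have e1 : 2 * al - k%:R - al = al - k%:R by ring.
  apply: eq_cint => j _; rewrite wright_exp_subl e1; congr (_ * _).
  transitivity (u * wright_coef al hi (al - k%:R) A j).
    by rewrite -e1; exact: wright_frac_derZ.
  rewrite -mulrA (perm_wright_coef _ _ _ _ (_ : perm_eq lo
     ([seq (1 / 2 - h)%:C - r / 2 | r <- s2] ++ [seq (1 - h)%:C - r / 2 | r <- s1]))); last first.
    by rewrite perm_catC.
  rewrite (@wright_charpoly _ al A m2 b s2 _ (1 / 2 - h) (al - k%:R))//.
  + rewrite (mulrA c); congr (_ * _); apply: perm_wright_coef.
    by rewrite half1 perm_catC.
  + by rewrite hE; field.
  + by apply: no_pole_sub npl => r rI; rewrite mem_cat rI orbT.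
Qed.

Lemma wright_defined_no_pole m1 m2 (s1 : m1.-tuple R[i]) (s2 : m2.-tuple R[i]) (x y : R) :
  wright_defined (shifted x s1 ++ shifted y s2 ++ [:: (1, 1)]) ->
  no_pole (fox_params s1 s2 x y).
Proof.
move=> h b bI j.
have bI' : (b, 1) \in shifted x s1 ++ shifted y s2 ++ [:: (1, 1)].
  rewrite catA mem_cat shifted_fox_params; apply/orP; left; apply/mapP; by exists b.
have := h _ bI' 0%N j; rewrite /= mulr0 addr0; apply: contra_neq => e.
by apply/eqP; rewrite -addr_eq0 e.
Qed.

Lemma wright_fox_paramsE m1 m2 (s1 : m1.-tuple R[i]) (s2 : m2.-tuple R[i]) (al A x y p q z : R) :
  0 < al -> (0 < m1)%N -> (m1 + m2)%:R / 2 < al -> -1 < p -> q = p + 1 -> 0 < z ->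
  no_pole (fox_params s1 s2 x y) ->
  (z `^ p)%:C * wright (shifted x s1 ++ shifted y s2 ++ [:: (1, 1)])
     [:: (q%:C, 2 * al)] (A * z `^ (2 * al))%:C =
  wright_superp al A (fox_params s1 s2 x y) p z.
Proof.
move=> al0 m10 mal p1 -> z0 np; rewrite catA shifted_fox_params wright_superpE//.
- by rewrite size_fox_params addn_gt0 m10.
- by rewrite size_fox_params; lra.
Qed.

End WrightSolution.

(** * The two kinds of solutions *)

Theorem theorem4p2 (R : realType) (m1 m2 : nat) (al : R) (a b : nat -> R)
    (s1 : m1.-tuple R[i]) (s2 : m2.-tuple R[i]) :
  (0 < m1)%N -> (0 < m2)%N -> 0 < al -> a m1 * b m2 != 0 ->
  charpoly al m1 a = (a m1)%:C *: \prod_(s <- s1) ('X - s%:P) ->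
  charpoly al m2 b = (b m2)%:C *: \prod_(s <- s2) ('X - s%:P) ->
  let m := (m1 + m2)%N in
  let A := 2 ^+ (m1 + m2) * (a m1 * b m2) in
  (al < m%:R / 2 -> 0 < a m1 * b m2 ->
   exists H1 H2 : R -> R[i],
     [/\ forall z : R, 0 < z ->
           is_foxH m 0 [:: (1, 2 * al)]
             (shifted (1 / 2) s1 ++ shifted 0 s2)
             (z `^ (- (2 * al)) / A)%:C (H1 z),
         forall z : R, 0 < z ->
           is_foxH m 0 [:: (1, 2 * al)]
             (shifted 0 s1 ++ shifted (1 / 2) s2)
             (z `^ (- (2 * al)) / A)%:C (H2 z) &
         forall c1 : R[i],
           is_solution al m1 m2 a b
             (fun z => c1 * (Num.sg (b m2))%:C * H1 z)
             (fun z => c1 * (2 `^ ((m2%:R - m1%:R) / 2) *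
                             Num.sqrt (b m2 / a m1))%:C * H2 z)]) /\
  (m%:R / 2 < al ->
   forall n : nat, (0 < n)%N -> n%:R - 1 < al < n%:R ->
   forall c1 c2 : nat -> R[i],
   let h (k : nat) : R := k%:R / (2 * al) in
   let phi1_pars k := shifted (1 - h k) s1 ++ shifted (1 / 2 - h k) s2
                      ++ [:: (1, 1)] in
   let phi2_pars k := shifted (3 / 2 - h k) s1 ++ shifted (1 - h k) s2
                      ++ [:: (1, 1)] in
   let psi1_pars k := shifted (1 - h k) s1 ++ shifted (3 / 2 - h k) s2
                      ++ [:: (1, 1)] in
   let psi2_pars k := shifted (1 / 2 - h k) s1 ++ shifted (1 - h k) s2
                      ++ [:: (1, 1)] in
   let low_pars (k : nat) := [:: ((1 + al - k%:R)%:C, 2 * al)] in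
   let high_pars (k : nat) := [:: ((1 + 2 * al - k%:R)%:C, 2 * al)] in
   let w (z : R) : R[i] := (A * z `^ (2 * al))%:C in
   (forall k, (1 <= k <= n)%N -> c1 k != 0 ->
      wright_defined (phi1_pars k) /\ wright_defined (psi1_pars k)) ->
   (forall k, (1 <= k <= n)%N -> c2 k != 0 ->
      wright_defined (phi2_pars k) /\ wright_defined (psi2_pars k)) ->
   is_solution al m1 m2 a b
     (fun z =>
        \sum_(1 <= k < n.+1) c1 k * (z `^ (al - k%:R))%:C *
          wright (phi1_pars k) (low_pars k) (w z) +
        (2 ^+ m1 * a m1)%:C *
        \sum_(1 <= k < n.+1) c2 k * (z `^ (2 * al - k%:R))%:C *
          wright (phi2_pars k) (high_pars k) (w z))
     (fun z =>
        (2 ^+ m2 * b m2)%:C *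
        \sum_(1 <= k < n.+1) c1 k * (z `^ (2 * al - k%:R))%:C *
          wright (psi1_pars k) (high_pars k) (w z) +
        \sum_(1 <= k < n.+1) c2 k * (z `^ (al - k%:R))%:C *
          wright (psi2_pars k) (low_pars k) (w z))).
Proof.
move=> m10 m20 al0 ab0 Pa Pb m A; split.
  move=> alm ab_gt0.
  have [g [g2 hg]] := exists_left_line s1 s2.
  have albs x y : 2 * al < (size (fox_params s1 s2 x y))%:R.
    by rewrite size_fox_params; move: alm; rewrite /m; lra.
  have A0 : 0 < A by rewrite mulr_gt0// exprn_gt0.
  have half0 : 0 <= 1 / 2 :> R by lra.
  (* 1 / (2 pi i) times the velocity i of the line; it multiplies both H-functions and is absorbed
     into the constant c_1. *)
  pose K : R[i] := (0 +i* (2 * pi))^-1 * 'i%C.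
  exists (fun z => K * superp (@lebesgue_measure R)
      (fox_coef al A (fox_params s1 s2 (1 / 2) 0) g) (fox_exp al g) z).
  exists (fun z => K * superp (@lebesgue_measure R)
      (fox_coef al A (fox_params s1 s2 0 (1 / 2)) (g + 1 / 2)) (fox_exp al (g + 1 / 2)) z).
  have foxH x y h z : 0 <= x -> 0 <= y -> h + 1 <= 0 -> h <= g + 1 -> 0 < z ->
     is_foxH m 0 [:: (1, 2 * al)] (shifted x s1 ++ shifted y s2)
       (z `^ (- (2 * al)) / A)%:C
       (K * superp (@lebesgue_measure R) (fox_coef al A (fox_params s1 s2 x y) h)
         (fox_exp al h) z).
    move=> x0 y0 h1 hh z0; rewrite shifted_fox_params.
    have -> : m = size (fox_params s1 s2 x y) by rewrite size_fox_params.
    apply: line_is_foxH => // t /(hg _ _ _ x0 y0); lra.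
  split.
  - by move=> z z0; apply: foxH => //; lra.
  - by move=> z z0; apply: foxH => //; lra.
  - move=> c1.
    apply: is_solution_congr (fox_solution al0 ab_gt0 alm Pa Pb (c1 * K) g2 hg) => z z0.
      by rewrite [RHS]mulrA (mulrAC c1).
    by rewrite [RHS]mulrA (mulrAC c1).
move=> mal n n0 aln c1 c2 h phi1_pars phi2_pars psi1_pars psi2_pars low_pars high_pars w def1 def2.
have zero := @system_at0 R n al m1 m2 a b n0 al0 aln.
have AE : A = 2 ^+ m1 * a m1 * (2 ^+ m2 * b m2) by rewrite /A exprD mulrACA.
have kP k : (1 <= k <= n)%N -> -1 < al - k%:R /\ -1 < 2 * al - k%:R.
  move=> /andP[_ kn]; have : k%:R <= n%:R :> R by rewrite ler_nat.
  by move: aln => /andP[? ?]; split; lra.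
pose F1 k z := c1 k * (z `^ (al - k%:R))%:C * wright (phi1_pars k) (low_pars k) (w z).
pose G1 k z := (2 ^+ m2 * b m2)%:C *
  (c1 k * (z `^ (2 * al - k%:R))%:C * wright (psi1_pars k) (high_pars k) (w z)).
pose F2 k z := (2 ^+ m1 * a m1)%:C *
  (c2 k * (z `^ (2 * al - k%:R))%:C * wright (phi2_pars k) (high_pars k) (w z)).
pose G2 k z := c2 k * (z `^ (al - k%:R))%:C * wright (psi2_pars k) (low_pars k) (w z).
have lowE k : 1 + al - k%:R = al - k%:R + 1 by ring.
have highE k : 1 + 2 * al - k%:R = 2 * al - k%:R + 1 by ring.
have S1 k : (1 <= k <= n)%N -> system_at n al m1 m2 a b (F1 k) (G1 k).
  move=> kn; have [pl ph] := kP k kn.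
  (* The Gamma factors are known to avoid their poles for a nonzero constant only; otherwise both
     functions are zero. *)
  have [c0|c0] := eqVneq (c1 k) 0.
    by apply: system_at_congr zero => z z0; rewrite /F1 /G1 c0 !mul0r ?mulr0.
  have [/wright_defined_no_pole np1 /wright_defined_no_pole np2] := def1 k kn c0.
  have sys := wright_system (c1 k) n0 al0 aln kn m10 mal Pa Pb AE np1 np2.
  apply: system_at_congr sys => z z0.
    by rewrite /F1 -mulrA (wright_fox_paramsE _ al0 m10 mal pl (lowE k) z0 np1).
  by rewrite /G1 -!mulrA (wright_fox_paramsE _ al0 m10 mal ph (highE k) z0 np2) mulrCA.
have S2 k : (1 <= k <= n)%N -> system_at n al m1 m2 a b (F2 k) (G2 k).
  move=> kn; have [pl ph] := kP k kn.
  have [c0|c0] := eqVneq (c2 k) 0.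
    by apply: system_at_congr zero => z z0; rewrite /F2 /G2 c0 !mul0r ?mulr0.
  have [/wright_defined_no_pole np1 /wright_defined_no_pole np2] := def2 k kn c0.
  have AE' : A = 2 ^+ m2 * b m2 * (2 ^+ m1 * a m1) by rewrite AE mulrC.
  have mal' : (m2 + m1)%:R / 2 < al by rewrite addnC.
  have perm x y : perm_eq (fox_params s1 s2 x y) (fox_params s2 s1 y x).
    by rewrite perm_catC.
  have npl : no_pole (fox_params s2 s1 (1 - h k) (1 / 2 - h k)).
    by apply: no_pole_sub np2 => t; rewrite (perm_mem (perm _ _)).
  have nph : no_pole (fox_params s2 s1 (1 - h k) (3 / 2 - h k)).
    by apply: no_pole_sub np1 => t; rewrite (perm_mem (perm _ _)).
  (* The second family is the first one for the system with its equations exchanged; the parameter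
     lists then agree up to order. *)
  have sys := system_at_sym
    (wright_system (c2 k) n0 al0 aln kn m20 mal' Pb Pa AE' npl nph).
  have superpE x y p z : wright_superp al A (fox_params s1 s2 x y) p z =
      wright_superp al A (fox_params s2 s1 y x) p z.
    apply: eq_cint => j _; congr (_ * _); exact: perm_wright_coef.
  apply: system_at_congr sys => z z0.
    rewrite /F2 -!mulrA (wright_fox_paramsE _ al0 m10 mal ph (highE k) z0 np1) mulrCA.
    by rewrite superpE.
  rewrite /G2 -mulrA (wright_fox_paramsE _ al0 m10 mal pl (lowE k) z0 np2).
  by rewrite superpE.
apply: (system_at_solution n0 aln).
have S : system_at n al m1 m2 a b
    (fun z => \sum_(k <- index_iota 1 n.+1) (F1 k z + F2 k z))
    (fun z => \sum_(k <- index_iota 1 n.+1) (G1 k z + G2 k z)).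
  apply: system_at_sum => // k; rewrite mem_index_iota => kn.
  exact: system_atD (S1 k kn) (S2 k kn).
by apply: system_at_congr S => z z0; rewrite big_split/= -big_distrr.
Qed.
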